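(* Let $p\in[1,\infty]$. If $p<2$, then there exists a compactly supported vector field $v\in L^p(\mathbb{R}^2;\mathbb{R}^2)$ with $\operatorname{div} v=0$ in the sense of distributions which does not have the chain rule property CRP$_\infty$. If $p\ge 2$, then every compactly supported vector field $v\in L^p(\mathbb{R}^2;\mathbb{R}^2)$ with $\operatorname{div} v=0$ in the sense of distributions has the chain rule property CRP$_\infty$.
   Context: A compactly supported vector field $v\in L^p(\mathbb{R}^2;\mathbb{R}^2)$ with $\operatorname{div} v=0$ has the chain rule property CRP$_\infty$ if for every $\rho\in L^\infty(\mathbb{R}^2)$ and every $\beta\in C^1(\mathbb{R})$ the equality $\operatorname{div}(\rho v)=0$ implies $\operatorname{div}(\beta(\rho)v)=0$ (both equalities in the sense of distributions on $\mathbb{R}^2$). *)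

(* Defs.v *)
From HB Require Import structures.
From mathcomp Require Import all_boot all_order all_algebra.
From mathcomp Require Import all_classical all_reals all_analysis.

Set Implicit Arguments.
Unset Strict Implicit.
Unset Printing Implicit Defensive.

Import Order.TTheory GRing.Theory Num.Theory.
Import numFieldNormedType.Exports.

Local Open Scope classical_set_scope.
Local Open Scope ring_scope.

(* [lebesgue_measure] lives on the Borel sets of R, so functions measurable for
   the product sigma-algebra are exactly the Borel functions on R^2.  Every
   Lebesgue measurable function agrees a.e. with such a function, and all the
   notions below only depend on a.e. classes. *)
Definition lebesgue2 (R : realType) :
    {measure set (measurableTypeR R * measurableTypeR R) -> \bar R} :=
  (@lebesgue_measure R \x @lebesgue_measure R)%E.

Definition partial1 (R : realType) (f : R * R -> R) : R * R -> R :=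
  fun x => 'D_((1, 0) : R * R) f x.

Definition partial2 (R : realType) (f : R * R -> R) : R * R -> R :=
  fun x => 'D_((0, 1) : R * R) f x.

(* f is of class C^k: its iterated partial derivatives up to order k exist
   everywhere and are continuous. *)
Fixpoint class_C (R : realType) (k : nat) (f : R * R -> R) : Prop :=
  continuous f /\
  match k with
  | 0 => True
  | k'.+1 =>
      [/\ forall x, derivable f x ((1, 0) : R * R),
          forall x, derivable f x ((0, 1) : R * R),
          class_C k' (partial1 f) &
          class_C k' (partial2 f)]
  end.

Definition test_function (R : realType) (phi : R * R -> R) : Prop :=
  (forall k, class_C k phi) /\ compact (closure [set x | phi x != 0]).

Definition Lp_field (R : realType) (p : \bar R) (v : R * R -> R * R) : Prop :=
  fst \o v \in Lfun (lebesgue2 R) p /\ snd \o v \in Lfun (lebesgue2 R) p.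

(* Compactness of the essential support: v is only an a.e. class. *)
Definition compactly_supported (R : realType) (v : R * R -> R * R) : Prop :=
  exists2 K : set (R * R), compact K &
    {ae lebesgue2 R, forall x, ~ K x -> v x = 0}.

(* div w = 0 in the sense of distributions on R^2, for a locally integrable
   field w; the integrand is then integrable for every test function.  The
   fields rho v and beta(rho) v below are integrable whenever v is a compactly
   supported L^p field, rho is in L^oo and beta is continuous. *)
Definition div_free (R : realType) (w : R * R -> R * R) : Prop :=
  forall phi : R * R -> R, test_function phi ->
    (\int[lebesgue2 R]_x
      ((w x).1 * partial1 phi x + (w x).2 * partial2 phi x)%:E = 0)%E.

Definition C1 (R : realType) (beta : R -> R) : Prop :=
  (forall t, derivable beta t 1) /\ continuous (derive1 beta).

Definition CRP_infty (R : realType) (v : R * R -> R * R) : Prop :=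
  forall (rho : R * R -> R) (beta : R -> R),
    rho \in Lfun (lebesgue2 R) +oo%E -> C1 beta ->
    div_free (fun x => rho x *: v x) ->
    div_free (fun x => beta (rho x) *: v x).

(* Main.v *)
Require Import Defs.
From HB Require Import structures.
From mathcomp Require Import all_boot all_order all_algebra.
From mathcomp Require Import all_classical all_reals all_analysis.
From mathcomp Require Import measurable_realfun ess_sup_inf ring lra.

Set Implicit Arguments.
Unset Strict Implicit.
Unset Printing Implicit Defensive.

Import Order.TTheory GRing.Theory Num.Theory.
Import numFieldNormedType.Exports.

Local Open Scope classical_set_scope.
Local Open Scope ring_scope.

(** For p >= 2 the field is in L^2 with bounded support, and both v and rho v have
    stream functions H and G in W^(1,2), with grad G = rho grad H.  Testing with
    phi f(H) g(G), where f and g are smooth, gives int f(H) g(G) v.grad phi = 0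
    because grad H and grad G are parallel, hence int 1_S(H, G) v.grad phi = 0 for
    every Borel set S of the plane.  It remains to write the level sets of rho as
    preimages under (H, G).  Almost every vertical line is mapped by (H, G) to a
    curve whose slope dG/dH is rho wherever v.1 <> 0, and two such curves have a
    common point with different slopes at only countably many parameters.  The
    union S of the images of countably many dense lines, restricted to points
    where rho > c, therefore satisfies 1_S(H, G) = 1_(rho > c) almost everywhere
    on v <> 0, because a set of values that is null on a dense family of lines is
    null everywhere.  So div(1_(rho > c) v) = 0 for every c, and beta(rho) is a
    uniform limit of combinations of indicators.

    For p < 2 all the field lines y = s w(x), |s| < 1, w(x) = x (1 - x), run from
    (0, 0) to (1, 0).  A field of density G(s) along them satisfies
    div = (int G) (delta_(0,0) - delta_(1,0)) and is of size 1/w on a set of height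
    w, so it is in L^p exactly when p < 2.  The density is 1 for |s| < 1/2 and -1
    outside, and rho is 0 for |s| < 1/2 and the sign of s outside: then v and rho v
    have total flux 0 while rho^2 v has total flux -1. *)

(** * Integrable real functions *)

(** Square integrability enters through a product: in $v\cdot\nabla(\phi f(H)g(G))$ the gradient of
    $H$ is multiplied by the gradients of $H$ and $G$. The stream functions are only primitives
    along vertical lines that agree almost everywhere with primitives along horizontal lines, and
    they need not be continuous in the plane. They are therefore differentiated through difference
    quotients, one direction at a time. Products of such quotients have no common integrable bound,
    but a quotient never has a larger $L^2$ norm than the derivative it approximates, and this is
    enough to pass to the limit. The set $S$ is built from the images of chosen lines, while a flux
    identity on a line is first known only off a null set of lines that depends on $S$. To avoid
    this circle the lines are chosen among those where the identity holds for all Borel $S$ at once;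
    the countable family of rational quadrants makes such a choice possible. *)

Section integral_tools.
Context d (T : measurableType d) (R : realType).
Variable m : {measure set T -> \bar R}.
Implicit Types f g h : T -> R.

Definition intg f := m.-integrable setT (EFin \o f) : Prop.

Lemma ae_mono (P Q : T -> Prop) : {ae m, forall x, P x} ->
  (forall x, P x -> Q x) -> {ae m, forall x, Q x}.
Proof. by move=> aP PQ; apply: filterS aP. Qed.

Lemma ae_mono2 (P Q S : T -> Prop) : {ae m, forall x, P x} -> {ae m, forall x, Q x} ->
  (forall x, P x -> Q x -> S x) -> {ae m, forall x, S x}.
Proof. by move=> aP aQ PQS; apply: filterS2 aP aQ. Qed.

Lemma ae_mono3 (P Q S U : T -> Prop) : {ae m, forall x, P x} -> {ae m, forall x, Q x} ->
  {ae m, forall x, S x} -> (forall x, P x -> Q x -> S x -> U x) -> {ae m, forall x, U x}.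
Proof. by move=> aP aQ aS PQSU; apply: filterS3 aP aQ aS. Qed.

Lemma intg_meas f : intg f -> measurable_fun setT f.
Proof. by move=> /measurable_int/measurable_EFinP. Qed.

Lemma intgE f : intg f -> (\int[m]_x (f x)%:E = (\int[m]_x f x)%:E)%E.
Proof. by move=> fi; rewrite /Rintegral fineK//; exact: integrable_fin_num. Qed.

Lemma intgD f g : intg f -> intg g -> intg (fun x => f x + g x).
Proof. by move=> fi gi; exact: (integrableD _ fi gi). Qed.

Lemma intgB f g : intg f -> intg g -> intg (fun x => f x - g x).
Proof. by move=> fi gi; exact: (integrableB _ fi gi). Qed.

Lemma intgZ k f : intg f -> intg (fun x => k * f x).
Proof. by move=> fi; exact: (integrableZl _ k fi). Qed.

Lemma intg0 : intg (cst 0).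
Proof. exact: integrable0. Qed.

Lemma intg_le f g : measurable_fun setT f -> (forall x, `|f x| <= g x) ->
  intg g -> intg f.
Proof.
move=> mf fg gi; apply: (le_integrable _ _ _ gi) => //; first exact/measurable_EFinP.
by move=> x _ /=; rewrite lee_fin (le_trans (fg x))// ler_norm.
Qed.

Lemma intg_norm f : intg f -> intg (fun x => `|f x|).
Proof. by move=> fi; exact: integrable_norm. Qed.

Lemma intg_mulb f g C : intg f -> measurable_fun setT g ->
  (forall x, `|g x| <= C) -> intg (fun x => f x * g x).
Proof.
move=> fi mg gC; apply: (@intg_le _ (fun x => C * `|f x|)).
- by apply: measurable_funM => //; exact: intg_meas.
- by move=> x; rewrite normrM mulrC ler_wpM2r.
- exact/intgZ/intg_norm.
Qed.

Lemma intg_indic f (A : set T) : measurable A -> intg f ->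
  intg (fun x => \1_A x * f x).
Proof.
move=> mA fi; apply: (@intg_le _ (fun x => `|f x|)).
- by apply: measurable_funM => //; exact: intg_meas.
- by move=> x; rewrite normrM indicE; case: (_ \in _); rewrite ?normr1 ?normr0 ?mul1r ?mul0r.
- exact: intg_norm.
Qed.

Lemma intg_ae f g : measurable_fun setT g ->
  {ae m, forall x, f x = g x} -> intg f -> intg g.
Proof.
move=> mg fg fi; apply/integrableP; split; first exact/measurable_EFinP.
have /integrableP[_] := fi.
rewrite (@ge0_ae_eq_integral _ _ _ m setT (abse \o (EFin \o f)) (abse \o (EFin \o g)))//.
- by apply/measurableT_comp => //; apply/measurable_EFinP; exact: intg_meas.
- by apply/measurableT_comp => //; apply/measurable_EFinP.
- by move=> x /=.
- by move=> x /=.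
- by apply: filterS fg => x /= ->.
Qed.

Lemma intg_le_ae f g : measurable_fun setT f -> {ae m, forall x, `|f x| <= g x} ->
  intg g -> intg f.
Proof.
move=> mf fg gi; apply/integrableP; split; first exact/measurable_EFinP.
have /integrableP[mg] := gi; apply: le_lt_trans.
apply: ae_ge0_le_integral => //.
- by apply/measurableT_comp => //; exact/measurable_EFinP.
- exact: measurableT_comp.
- by apply: filterS fg => x + _ /=; rewrite lee_fin => /le_trans; apply; exact: ler_norm.
Qed.

Lemma RintD f g : intg f -> intg g ->
  \int[m]_x (f x + g x) = \int[m]_x f x + \int[m]_x g x.
Proof. by move=> fi gi; exact: RintegralD. Qed.

Lemma RintB f g : intg f -> intg g ->
  \int[m]_x (f x - g x) = \int[m]_x f x - \int[m]_x g x.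
Proof. by move=> fi gi; exact: RintegralB. Qed.

Lemma RintZ k f : intg f -> \int[m]_x (k * f x) = k * \int[m]_x f x.
Proof. by move=> fi; exact: RintegralZl. Qed.

Lemma RintN f : intg f -> \int[m]_x (- f x) = - \int[m]_x f x.
Proof.
move=> fi; rewrite -mulN1r -RintZ//; apply: eq_Rintegral => x _.
by rewrite mulN1r.
Qed.

Lemma Rint_cst0 : \int[m]_x (0 : R) = 0.
Proof. by rewrite /Rintegral integral0. Qed.

Lemma Rint_eq f g : f =1 g -> \int[m]_x f x = \int[m]_x g x.
Proof. by move=> fg; apply: eq_Rintegral => x _. Qed.

Lemma Rint_ae f g : measurable_fun setT f -> measurable_fun setT g ->
  {ae m, forall x, f x = g x} -> \int[m]_x f x = \int[m]_x g x.
Proof.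
move=> mf mg fg; rewrite /Rintegral; congr fine.
apply: ae_eq_integral => //; [exact/measurable_EFinP|exact/measurable_EFinP|].
by apply: filterS fg => x /= -> _.
Qed.

Lemma Rint_le f g : intg f -> intg g -> (forall x, f x <= g x) ->
  \int[m]_x f x <= \int[m]_x g x.
Proof. by move=> fi gi fg; apply: le_Rintegral => // x _. Qed.

Lemma Rint_norm_le f : intg f -> `|\int[m]_x f x| <= \int[m]_x `|f x|.
Proof. by move=> fi; apply: le_normr_Rintegral. Qed.

Lemma Rint_ge0 f : (forall x, 0 <= f x) -> 0 <= \int[m]_x f x.
Proof. by move=> f0; apply: Rintegral_ge0 => x _. Qed.

Lemma Rint_sets0 f : intg f ->
  (forall A, measurable A -> \int[m]_x (\1_A x * f x) = 0) ->
  {ae m, forall x, f x = 0}.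
Proof.
move=> fi f0.
have : ae_eq m setT (EFin \o f) (cst 0%E).
  apply: integral_ae_eq => // E _ mE.
  rewrite integral0 integral_mkcond.
  rewrite (_ : (EFin \o f) \_ E = EFin \o (fun x => \1_E x * f x)).
    by rewrite intgE ?f0//; exact: intg_indic.
  apply/funext => x /=; rewrite patchE indicE.
  by case: ifP => _; rewrite ?mul1r ?mul0r.
by apply: filterS => x /= /(_ I) [].
Qed.

Lemma dominated_cvg (f_ : nat -> T -> R) f g :
  (forall n, measurable_fun setT (f_ n)) -> measurable_fun setT f ->
  {ae m, forall x, f_ ^~ x @ \oo --> f x} -> intg g ->
  {ae m, forall x n, `|f_ n x| <= g x} ->
  intg f /\ \int[m]_x f_ n x @[n --> \oo] --> \int[m]_x f x.
Proof.
move=> mf_ mf cf gi fg.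
have [||||fi _ cv] := @dominated_convergence _ _ _ m setT measurableT
  (fun n => EFin \o f_ n) (EFin \o f) (EFin \o g) _ _ _ gi.
- by move=> n; exact/measurable_EFinP.
- exact/measurable_EFinP.
- apply: filterS cf => x cfx _ /=.
  by apply: cvg_EFin => //; exact: nearW.
- by apply: filterS fg => x + n _ /=; rewrite lee_fin; exact.
split=> //.
have fni n : intg (f_ n).
  apply/integrableP; split; first exact/measurable_EFinP.
  have /integrableP[mg] := gi; apply: le_lt_trans.
  apply: ae_ge0_le_integral => //.
  - by apply/measurableT_comp => //; exact/measurable_EFinP.
  - exact: measurableT_comp.
  - apply: filterS fg => x /(_ n) + _ /=.
    by rewrite lee_fin => /le_trans; apply; exact: ler_norm.
by apply/fine_cvg; rewrite -intgE.
Qed.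

(* Fatou's lemma applied to [Z_ n + Z - |X_ n - X|]; no dominating function is
   required, only that the mass of the bounds [Z_ n] does not exceed the mass
   of their limit. *)
Lemma generalized_dominated_cvg (X_ Z_ : nat -> T -> R) (X Z : T -> R) :
  (forall n, measurable_fun setT (X_ n)) -> measurable_fun setT X ->
  (forall n, intg (Z_ n)) -> intg Z ->
  {ae m, forall x, X_ ^~ x @ \oo --> X x} ->
  {ae m, forall x, Z_ ^~ x @ \oo --> Z x} ->
  {ae m, forall x n, `|X_ n x| <= Z_ n x} ->
  (forall n, \int[m]_x Z_ n x <= \int[m]_x Z x) ->
  [/\ forall n, intg (X_ n), intg X & \int[m]_x X_ n x @[n --> \oo] --> \int[m]_x X x].
Proof.
move=> mX_ mX iZ_ iZ cX cZ XZ IZ.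
have iX_ n : intg (X_ n).
  apply/integrableP; split; first exact/measurable_EFinP.
  have /integrableP[mg] := iZ_ n; apply: le_lt_trans.
  apply: ae_ge0_le_integral => //.
  - by apply/measurableT_comp => //; exact/measurable_EFinP.
  - exact: measurableT_comp.
  - apply: filterS XZ => x /(_ n) + _ /=.
    by rewrite lee_fin => /le_trans; apply; exact: ler_norm.
have XZx : {ae m, forall x, `|X x| <= Z x}.
  apply: filterS2 cX (filterI cZ XZ) => x cXx [cZx XZx].
  have cnX : `|X_ n x| @[n --> \oo] --> `|X x| by exact: (cvg_norm cXx).
  by apply: (ler_cvg_to cnX cZx); exact: nearW.
have iX : intg X.
  apply/integrableP; split; first exact/measurable_EFinP.
  have /integrableP[mg] := iZ; apply: le_lt_trans.
  apply: ae_ge0_le_integral => //.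
  - by apply/measurableT_comp => //; exact/measurable_EFinP.
  - exact: measurableT_comp.
  - apply: filterS XZx => x + _ /=.
    by rewrite lee_fin => /le_trans; apply; exact: ler_norm.
split=> //.
(* The outer absolute value makes [h] nonnegative everywhere, as Fatou's lemma requires. Almost
   everywhere it changes nothing, since there |X_ n - X| <= Z_ n + Z. *)
pose h n x := `|Z_ n x + Z x - `|X_ n x - X x| |.
have mh n : measurable_fun setT (h n).
  apply: measurableT_comp => //; apply: measurable_funB.
    by apply: measurable_funD; exact: intg_meas.
  by apply: measurableT_comp => //; apply: measurable_funB.
have h0 n x : 0 <= h n x by exact: normr_ge0.
have ihn n : intg (fun x => Z_ n x + Z x - `|X_ n x - X x|).
  by apply: intgB; [apply: intgD|apply: intg_norm; apply: intgB].
have hE n : {ae m, forall x, Z_ n x + Z x - `|X_ n x - X x| = h n x}.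
  apply: filterS2 XZ XZx => x /(_ n) a b; rewrite /h [RHS]ger0_norm// subr_ge0.
  by rewrite (le_trans (ler_normB _ _))// lerD.
have ih n : intg (h n) by exact: (intg_ae _ (hE n)).
have Ih n : \int[m]_x h n x =
    \int[m]_x Z_ n x + \int[m]_x Z x - \int[m]_x `|X_ n x - X x|.
  rewrite -RintD// -RintB//; last 2 first.
  - exact: intgD.
  - exact/intg_norm/intgB.
  by apply/esym/Rint_ae => //; exact: intg_meas.
have ch : {ae m, forall x, limn_einf (fun n => (h n x)%:E) = (2 * Z x)%:E}.
  apply: filterS2 cX (filterI cZ XZx) => x cXx [cZx XZxx].
  have : h n x @[n --> \oo] --> 2 * Z x.
    have -> : 2 * Z x = `|Z x + Z x - `|X x - X x| |.
      rewrite subrr normr0 subr0 ger0_norm; first by rewrite mulr_natl mulr2n.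
      by rewrite addr_ge0// (le_trans _ XZxx).
    apply: cvg_norm.
    apply: cvgB; first by apply: cvgD => //; exact: cvg_cst.
    by apply: cvg_norm; apply: cvgB => //; exact: cvg_cst.
  move=> ch; rewrite is_cvg_limn_einfE.
    by apply/cvg_lim => //; apply: cvg_EFin => //; exact: nearW.
  by apply/cvg_ex; exists (2 * Z x)%:E; apply: cvg_EFin => //; exact: nearW.
have := @fatou _ _ _ m setT measurableT (fun n => EFin \o h n).
move=> /(_ (fun n => (measurable_EFinP _ _).2 (mh n))).
move=> /(_ (fun n x _ => h0 n x)).
have -> : (\int[m]_x limn_einf (fun n => (EFin \o h n) x) = (2 * \int[m]_x Z x)%:E)%E.
  rewrite -RintZ// -intgE; last exact: intgZ.
  apply: ae_eq_integral => //.
  - apply: (@measurableT_comp _ _ _ _ _ _ -%E) => //.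
    apply: (@measurable_fun_limn_esup _ _ _ setT (fun n x => - (h n x)%:E)%E) => n.
    by apply: measurableT_comp => //; exact/measurable_EFinP.
  - by apply/measurable_EFinP; apply: measurable_funM => //; exact: intg_meas.
  - by apply: filterS ch => x + _.
have -> : (fun n => \int[m]_x (EFin \o h n) x)%E = (fun n => (\int[m]_x h n x)%:E).
  by apply/funext => n; rewrite -intgE.
move=> hlim.
pose c n := \int[m]_x `|X_ n x - X x|.
have c0 n : 0 <= c n by exact: Rint_ge0.
(* Fatou bounds 2 int Z by the lower limit of int Z_ n + int Z - c n, and int Z_ n <= int Z;
   cancelling the finite number 2 int Z leaves limsup c <= 0. *)
have : ((2 * \int[m]_x Z x)%:E <= (2 * \int[m]_x Z x)%:E - limn_esup (fun n => (c n)%:E))%E.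
  rewrite -limn_einfN -limn_einf_shift//; apply: le_trans hlim _.
  rewrite !limn_einf_lim; apply: lee_lim; [exact: is_cvg_einfs|exact: is_cvg_einfs|].
  apply: nearW => n; apply: le_ereal_inf_tmp => _ /= [k nk <-].
  apply: (@le_trans _ _ (\int[m]_x h k x)%:E); last first.
    by rewrite Ih -EFinB lee_fin lerB// mulr_natl mulr2n lerD2r.
  by apply: ereal_inf_lbound; exists k.
rewrite addeC -leeBlDr// subee// leeNr oppe0 => lim_le0.
have : (c n)%:E @[n --> \oo] --> 0%E.
  by apply/limn_esup_le_cvg => // n; rewrite lee_fin.
move=> /fine_cvg /= cc.
apply/cvgrPdist_le => e e0; move/cvgrPdist_le : cc => /(_ e e0).
apply: filterS => n /=; rewrite sub0r normrN (ger0_norm (c0 n)); apply: le_trans.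
rewrite distrC -RintB//; apply: Rint_norm_le; exact: intgB.
Qed.

End integral_tools.

(** * Measure-preserving maps and signed set functions *)

Section measure_preserving.
Context d (T : measurableType d) (R : realType).
Variable m : {measure set T -> \bar R}.

Definition mpres (phi : T -> T) := measurable_fun setT phi /\
  forall A, measurable A -> m (phi @^-1` A) = m A.

Variables (phi : T -> T) (mp : mpres phi).
Let mphi : measurable_fun setT phi := mp.1.

Lemma mpres_integral (f : T -> \bar R) : measurable_fun setT f ->
  (forall x, 0 <= f x)%E -> (\int[m]_x f (phi x) = \int[m]_x f x)%E.
Proof.
move=> mf f0; have := @ge0_integral_pushforward _ _ T T R phi mphi m setT f.
move=> /(_ measurableT mf (fun x _ => f0 x)); rewrite preimage_setT => <-.
by apply: eq_measure_integral => A mA _; exact: mp.2.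
Qed.

Lemma mpres_intg (f : T -> R) : intg m f -> intg m (fun x => f (phi x)).
Proof.
move=> fi; apply/integrableP; split.
  by apply/measurable_EFinP; apply: measurableT_comp mphi; exact: intg_meas fi.
have /integrableP[mf] := fi; congr (_ < _)%E.
rewrite -(mpres_integral (f := abse \o (EFin \o f)))//.
- by apply: measurableT_comp.
- by move=> x /=.
Qed.

Lemma mpres_Rint (f : T -> R) : measurable_fun setT f ->
  \int[m]_x f (phi x) = \int[m]_x f x.
Proof.
move=> mf; rewrite /Rintegral; congr fine; rewrite integralE [RHS]integralE.
congr (_ - _)%E.
- transitivity (\int[m]_x (EFin \o f)^\+%E (phi x))%E.
    by apply: eq_integral => x _; rewrite (funepos_comp (EFin \o f) phi).
  by rewrite mpres_integral//; apply: measurable_funepos; exact/measurable_EFinP.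
- transitivity (\int[m]_x (EFin \o f)^\-%E (phi x))%E.
    by apply: eq_integral => x _; rewrite (funeneg_comp (EFin \o f) phi).
  by rewrite mpres_integral//; apply: measurable_funeneg; exact/measurable_EFinP.
Qed.

Lemma mpres_ae (P : T -> Prop) :
  {ae m, forall x, P x} -> {ae m, forall x, P (phi x)}.
Proof.
move=> [N [mN N0 PN]]; exists (phi @^-1` N); split.
- by rewrite -[X in measurable X]setTI; exact: mphi.
- by rewrite mp.2.
- by move=> x /= Px; apply: PN.
Qed.

End measure_preserving.

Section pi_lambda.
Context d' (T' : measurableType d') (R : realType).
Implicit Types (A B : set T' -> R) (G : set (set T')).

(** A finite signed measure seen through proper differences and increasing unions, the two closure
    properties that turn the sets where [A] vanishes into a lambda-system. *)
Definition signed_additive A :=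
  (forall S1 S2, measurable S1 -> measurable S2 -> S2 `<=` S1 ->
    A (S1 `\` S2) = A S1 - A S2) /\
  (forall F : (set T')^nat, (forall n, measurable (F n)) -> nondecreasing_seq F ->
    A (F n) @[n --> \oo] --> A (\bigcup_k F k)).

Lemma signed_additiveB A B : signed_additive A -> signed_additive B ->
  signed_additive (fun S => A S - B S).
Proof.
move=> [Ac Au] [Bc Bu]; split.
  by move=> S1 S2 mS1 mS2 S12; rewrite Ac// Bc//; ring.
by move=> F mF tF; exact: cvgB (Au F mF tF) (Bu F mF tF).
Qed.

Lemma pi_lambda_zero G A : @measurable _ T' = <<s G >> -> setI_closed G ->
  signed_additive A -> A setT = 0 -> (forall S, G S -> A S = 0) ->
  forall S, measurable S -> A S = 0.
Proof.
move=> GE GI [Ac Au] AT AG S; rewrite GE => mS.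
suff : <<s G >> `<=` [set S | measurable S /\ A S = 0] by move=> /(_ _ mS)[].
apply: lambda_system_subset => //.
- split => //.
  + move=> S1 S2 S21 [mS1 S10] [mS2 S20]; split; first exact: measurableD.
    by rewrite Ac// S10 S20 subrr.
  + move=> F ndF HF; split; first by apply: bigcupT_measurable => k; have [] := HF k.
    have := Au F (fun n => (HF n).1) ndF.
    have -> : (fun n => A (F n)) = cst 0 by apply/funext => n; have [] := HF n.
    by move=> c; apply/esym; exact: (cvg_unique (@Rhausdorff R) (cvg_cst _) c).
- by move=> S' GS'; split; [rewrite GE; exact: sub_sigma_algebra|exact: AG].
Qed.

Lemma integral_additive d (T : measurableType d)
    (m : {measure set T -> \bar R}) (Phi : T -> T') (f : T -> R) :
  measurable_fun setT Phi -> intg m f ->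
  signed_additive (fun S => \int[m]_x (\1_S (Phi x) * f x)).
Proof.
move=> mPhi fi.
have mP S : measurable S -> measurable (Phi @^-1` S).
  by move=> mA; rewrite -[X in measurable X]setTI; exact: mPhi.
have fA S : measurable S -> intg m (fun x => \1_S (Phi x) * f x).
  by move=> mA; apply: (@intg_indic _ _ _ _ f (Phi @^-1` S)) => //; exact: mP.
split.
- move=> S1 S2 mS1 mS2 S21; rewrite -RintB//; [|exact: fA|exact: fA].
  apply: Rint_eq => x; rewrite !indicE in_setD.
  have [x2|x2] := boolP (Phi x \in S2).
    have -> : Phi x \in S1 by move: x2; rewrite !inE; exact: S21.
    by rewrite /= mul0r subrr.
  by rewrite andbT mul0r subr0.
- move=> F mF ndF.
  have [|||||_ c] := @dominated_cvg _ _ R m (fun n x => \1_(F n) (Phi x) * f x)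
    (fun x => \1_(\bigcup_k F k) (Phi x) * f x) (fun x => `|f x|); last exact: c.
  + by move=> n; apply: intg_meas; exact: fA.
  + by apply: intg_meas; apply: fA; exact: bigcupT_measurable.
  + apply: aeW => x; apply: cvgM; last exact: cvg_cst.
    have [[k _ Fk]|nF] := pselect ((\bigcup_k F k) (Phi x)).
      apply: cvg_near_cst; exists k => //= n /= kn.
      rewrite !indicE !mem_set//; first by exists k.
      by move/subsetPset : (ndF _ _ kn); exact.
    apply: cvg_near_cst; apply: nearW => n; rewrite !indicE !memNset//.
    by move=> Fn; apply: nF; exists n.
  + exact: intg_norm.
  + apply: aeW => x n; rewrite normrM indicE.
    by case: (_ \in _); rewrite ?normr1 ?normr0 ?mul1r ?mul0r.
Qed.

End pi_lambda.

(** * Countable generating pi-systems of rational rays and quadrants *)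

Section borel_generators.
Context (R : realType).

Definition rayQ : set (set (measurableTypeR R)) :=
  [set A | exists q : rat, A = `]ratr q, +oo[%classic].

Lemma rayQ_measurable : @measurable _ (measurableTypeR R) = <<s rayQ >>.
Proof.
rewrite (RGenOInfty.measurableE R) eqEsubset; split => A.
- apply: smallest_sub; first exact: smallest_sigma_algebra.
  move=> _ [x ->].
  have -> : `]x, +oo[%classic = \bigcup_(q in [set q : rat | x < ratr q])
      (`]ratr q, +oo[%classic : set R).
    apply/seteqP; split => y /=.
    + rewrite in_itv/= andbT => xy.
      have [q] := rat_in_itvoo xy.
      rewrite in_itv/= => /andP[xq qy]; exists q => //=.
      by rewrite in_itv/= qy.
    + move=> [q/= xq]; rewrite !in_itv/= !andbT; exact: lt_trans.
  rewrite bigcup_mkcond.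
  apply: (@bigcupT_measurable_rat _ (g_sigma_algebraType rayQ)
    (fun q => if q \in [set q : rat | x < ratr q] then
      (`]ratr q, +oo[%classic : set R) else set0)) => q.
  case: ifP => _; last exact: measurable0.
  by apply: sub_sigma_algebra; exists q.
- apply: smallest_sub; first exact: smallest_sigma_algebra.
  by move=> _ [q ->]; apply: sub_sigma_algebra; exists (ratr q).
Qed.

Lemma rayQ_setI : setI_closed rayQ.
Proof.
move=> _ _ [p ->] [q ->]; exists (Num.max p q).
apply/seteqP; split => x /=; rewrite !in_itv/= !andbT.
  by move=> [px qx]; case: (leP p q).
by case: (leP p q) => pq h; split => //; apply: le_lt_trans h;
  rewrite ler_rat// ltW.
Qed.

Lemma ray_lambda_zero (A : set (measurableTypeR R) -> R) :
  signed_additive A -> A setT = 0 ->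
  (forall q : rat, A (`]ratr q, +oo[%classic) = 0) ->
  forall S, measurable S -> A S = 0.
Proof.
move=> aA AT Aq; apply: (pi_lambda_zero rayQ_measurable rayQ_setI) => //.
by move=> _ [q ->].
Qed.

(** [None] puts the whole line among the rays, so the products below contain the plane itself and
    the pi-lambda argument finds its total mass there. The index type is countable, which lets
    [ae_good_line] discard a single null set. *)
Definition oray (o : option rat) : set (measurableTypeR R) :=
  if o is Some q then `]ratr q, +oo[%classic else setT.

Lemma measurable_oray o : measurable (oray o).
Proof. by case: o => [q|] //=; exact: measurable_itv. Qed.

Lemma orayI o1 o2 : exists o, oray o1 `&` oray o2 = oray o.
Proof.
case: o1 => [p|]; case: o2 => [q|]; rewrite ?setIT ?setTI.
- have [r rE] := rayQ_setI (ex_intro _ p erefl) (ex_intro _ q erefl).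
  by exists (Some r); exact: rE.
- by exists (Some p).
- by exists (Some q).
- by exists None.
Qed.

Definition quadrants : set (set (measurableTypeR R * measurableTypeR R)) :=
  [set A | exists o1 o2, A = oray o1 `*` oray o2].

Lemma quadrants_setI : setI_closed quadrants.
Proof.
move=> _ _ [p [q ->]] [p' [q' ->]].
have [r1 r1E] := orayI p p'; have [r2 r2E] := orayI q q'.
by exists r1, r2; rewrite -setXI r1E r2E.
Qed.

Lemma quadrants_measurable :
  @measurable _ (measurableTypeR R * measurableTypeR R)%type = <<s quadrants >>.
Proof.
rewrite eqEsubset; split; last first.
  apply: smallest_sub; first exact: sigma_algebra_measurable.
  by move=> _ [p [q ->]]; apply: measurableX; exact: measurable_oray.
have sg : sigma_algebra setT <<s quadrants >> by exact: smallest_sigma_algebra.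
have rayE : forall B : set (measurableTypeR R), measurable B -> <<s rayQ >> B.
  by move=> B; rewrite rayQ_measurable.
apply: smallest_sub => //; rewrite subUset; split => _ [B mB <-]; rewrite setTI.
- have : <<s rayQ >> `<=` [set B | <<s quadrants >> (fst @^-1` B)].
    apply: smallest_sub.
      have := @sigma_algebra_image _ _ setT (@fst (measurableTypeR R) (measurableTypeR R)) _ sg.
      rewrite /image_set_system.
      by under eq_fun do rewrite setTI.
    move=> _ [q ->]; apply: sub_sigma_algebra; exists (Some q), None.
    by apply/seteqP; split => z //= [].
  by apply; exact: rayE.
- have : <<s rayQ >> `<=` [set B | <<s quadrants >> (snd @^-1` B)].
    apply: smallest_sub.
      have := @sigma_algebra_image _ _ setT (@snd (measurableTypeR R) (measurableTypeR R)) _ sg.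
      rewrite /image_set_system.
      by under eq_fun do rewrite setTI.
    move=> _ [q ->]; apply: sub_sigma_algebra; exists None, (Some q).
    by apply/seteqP; split => z //= [].
  by apply; exact: rayE.
Qed.

Lemma quadrant_lambda_zero (A : set (measurableTypeR R * measurableTypeR R) -> R) :
  signed_additive A -> (forall o1 o2, A (oray o1 `*` oray o2) = 0) ->
  forall S, measurable S -> A S = 0.
Proof.
move=> aA Ao; apply: (pi_lambda_zero quadrants_measurable quadrants_setI) => //.
- by rewrite -setXTT; exact: (Ao None None).
- by move=> _ [p [q ->]].
Qed.

End borel_generators.

(** * Lebesgue measure on the plane *)

Section lebesgue_plane.
Context {R : realType}.
Notation mR := (measurableTypeR R).
Notation mu := (@lebesgue_measure R).
Notation mu2 := (lebesgue2 R).

Lemma shift1_mpres (a : R) : mpres mu (fun x : mR => x + a : mR).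
Proof.
have mS : measurable_fun [set: mR] (fun x : mR => x + a : mR).
  by apply: (@measurable_funD _ mR R setT id (cst a)).
split=> // A mA; apply/esym.
pose nu : {measure set mR -> \bar R} :=
  measure_function_pushforward__canonical__measure_function_Measure mu mS.
apply: (@lebesgue_measure_unique R nu) => // _ [[x y] _ <-].
rewrite /nu /= /pushforward.
have -> : (fun x : mR => x + a : mR) @^-1` `]x, y]%classic = `]x - a, y - a]%classic.
  by apply/seteqP; split => z /=; rewrite !in_itv/= ltrBlDr lerBrDr.
by rewrite !lebesgue_measure_itv/= !lte_fin ltrD2r -EFinB -EFinB opprB addrA subrK.
Qed.

Lemma measurable_shift2 (a b : R) :
  measurable_fun [set: mR * mR] (fun z : mR * mR => (z.1 + a, z.2 + b) : mR * mR).
Proof.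
apply: measurable_fun_pair.
- exact: (measurableT_comp (shift1_mpres a).1 measurable_fst).
- exact: (measurableT_comp (shift1_mpres b).1 measurable_snd).
Qed.

Lemma shift2_mpres (a b : R) :
  mpres mu2 (fun z : mR * mR => (z.1 + a, z.2 + b) : mR * mR).
Proof.
have mS := measurable_shift2 a b.
split=> // A mA; apply/esym.
pose nu : {measure set (mR * mR) -> \bar R} :=
  measure_function_pushforward__canonical__measure_function_Measure mu2 mS.
apply: (@product_measure_unique _ _ _ _ _ _ _ nu) => // B C mB mC.
rewrite /nu /= /pushforward.
have -> : (fun z : mR * mR => (z.1 + a, z.2 + b) : mR * mR) @^-1` (B `*` C) =
    ((fun x : mR => x + a : mR) @^-1` B) `*` ((fun x : mR => x + b : mR) @^-1` C).
  by [].
rewrite /lebesgue2 product_measure1E ?(shift1_mpres _).2//.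
- by rewrite -[X in measurable X]setTI; exact: (shift1_mpres a).1.
- by rewrite -[X in measurable X]setTI; exact: (shift1_mpres b).1.
Qed.

Lemma swap_mpres : mpres mu2 (fun z : mR * mR => (z.2, z.1) : mR * mR).
Proof.
have mS : measurable_fun [set: mR * mR] (fun z : mR * mR => (z.2, z.1) : mR * mR).
  exact: measurable_swap.
split=> // A mA; apply/esym.
pose nu : {measure set (mR * mR) -> \bar R} :=
  measure_function_pushforward__canonical__measure_function_Measure mu2 mS.
apply: (@product_measure_unique _ _ _ _ _ _ _ nu) => // B C mB mC.
rewrite /nu /= /pushforward.
have -> : (fun z : mR * mR => (z.2, z.1) : mR * mR) @^-1` (B `*` C) = C `*` B.
  by apply/seteqP; split => z [].
by rewrite /lebesgue2 product_measure1E// muleC.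
Qed.

(** Tonelli gives measurability for the positive and negative parts separately, and their difference
    is measurable whether or not the slices are integrable. *)
Lemma measurable_Rint d (T : measurableType d) (f : T * mR -> R) :
  measurable_fun setT f -> measurable_fun setT (fun x => \int[mu]_y f (x, y)).
Proof.
move=> mf; apply: measurableT_comp => //.
have -> : (fun x => \int[mu]_y (f (x, y))%:E)%E =
   (fun x => \int[mu]_y (EFin \o f)^\+ (x, y) - \int[mu]_y (EFin \o f)^\- (x, y))%E.
  apply/funext => x; rewrite integralE; congr (_ - _)%E.
    by apply: eq_integral => y _; rewrite !unlock.
  by apply: eq_integral => y _; rewrite !unlock.
apply: emeasurable_funB.
- apply: (measurable_fun_fubini_tonelli_F (m2 := mu) (EFin \o f)^\+%E) => //.
  by apply: measurable_funepos; exact/measurable_EFinP.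
- apply: (measurable_fun_fubini_tonelli_F (m2 := mu) (EFin \o f)^\-%E) => //.
  by apply: measurable_funeneg; exact/measurable_EFinP.
Qed.

Lemma intg_slices (f : mR * mR -> R) : intg mu2 f ->
  {ae mu, forall x, intg mu (fun y => f (x, y))}.
Proof. by move=> fi; exact: (ae_integrable1 fi). Qed.

Lemma Rint_fubini (f : mR * mR -> R) : intg mu2 f ->
  intg mu (fun x => \int[mu]_y f (x, y)) /\
  \int[mu2]_z f z = \int[mu]_x \int[mu]_y f (x, y).
Proof.
move=> fi; have mf := intg_meas fi.
have aeE : {ae mu, forall x, (\int[mu]_y (f (x, y))%:E)%E = (\int[mu]_y f (x, y))%:E}.
  by apply: filterS (intg_slices fi) => x; exact: intgE.
have iF := integrable_fubini_F fi.
have ii : intg mu (fun x => \int[mu]_y f (x, y)).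
  apply/integrableP; split.
    by apply/measurable_EFinP; exact: measurable_Rint.
  have /integrableP[mF] := iF; congr (_ < _)%E.
  apply: ae_eq_integral => //.
  - exact: measurableT_comp.
  - by apply: measurableT_comp => //; apply/measurable_EFinP; exact: measurable_Rint.
  - by apply: filterS aeE => x e _; congr (`|_|)%E; exact: e.
split=> //.
apply: EFin_inj; rewrite -intgE// -intgE//.
rewrite /lebesgue2 -(integral12_prod_meas1 fi).
apply: ae_eq_integral => //.
- exact: measurable_int iF.
- by apply/measurable_EFinP; exact: measurable_Rint.
- by apply: filterS aeE => x e _; exact: e.
Qed.

Lemma intg_tonelli (f : mR * mR -> R) : measurable_fun setT f ->
  {ae mu, forall x, intg mu (fun y => f (x, y))} ->
  intg mu (fun x => \int[mu]_y `|f (x, y)|) -> intg mu2 f.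
Proof.
move=> mf fx fi; apply/(@integrable12ltyP _ _ mR mR R mu mu (EFin \o f)).
  exact/measurable_EFinP.
have /integrableP[mF] := fi; apply: le_lt_trans.
apply: ae_ge0_le_integral => //.
- by move=> x _; exact: integral_ge0.
- apply: (measurable_fun_fubini_tonelli_F (m2 := mu) (abse \o (EFin \o f))) => //.
    by apply: measurableT_comp => //; exact/measurable_EFinP.
  by move=> x /=.
- exact: measurableT_comp.
- apply: filterS fx => x fxi _ /=.
  rewrite (ger0_norm (Rint_ge0 _ _))// -intgE//.
  exact: intg_norm.
Qed.

Lemma lebesgue2E (A : set (mR * mR)) :
  mu2 A = (\int[mu]_x (mu \o xsection A) x)%E.
Proof. by []. Qed.

(** The measure of the complement is the integral of the measures of its vertical slices, almost all
    of which are null. Measurability of [A] is a separate input, which every application has to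
    establish first. *)
Lemma ae_prod (A : set (mR * mR)) : measurable A ->
  {ae mu, forall x, {ae mu, forall y, A (x, y)}} -> {ae mu2, forall z, A z}.
Proof.
move=> mA Ax; exists (~` A); split=> //; first exact: measurableC.
rewrite lebesgue2E (@ae_eq_integral _ _ _ mu setT (cst 0%E)) ?integral0//.
- exact/measurable_fun_xsection/measurableC.
- apply: filterS Ax => x [N [mN N0 AN]] _ /=.
  apply/eqP; rewrite -measure_le0 -N0 le_measure ?inE//.
    exact/measurable_xsection/measurableC.
  by move=> y; rewrite /xsection/= inE => h; apply: AN.
Qed.

Lemma open2_measurable (A : set (R * R)) : open A -> measurable (A : set (mR * mR)).
Proof.
move=> oA.
pose B (i : rat * rat * nat) : set (mR * mR) :=
  (ball (ratr i.1.1 : R) (i.2.+1%:R^-1 : R)) `*` ball (ratr i.1.2 : R) (i.2.+1%:R^-1 : R).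
have -> : A = \bigcup_i (if `[< B i `<=` A >] then B i else set0).
  apply/seteqP; split => [z Az|z [i _]]; last by case: asboolP => //; apply.
  have /nbhs_ballP[e /= e0 eA] : nbhs z A by exact: open_nbhs_nbhs.
  pose n := Num.trunc ((e / 2)^-1).
  have ne : n.+1%:R^-1 < e / 2 :> R.
    rewrite invf_plt ?posrE ?divr_gt0//.
    by have /Num.Theory.trunc_itv/andP[] : 0 <= (e / 2)^-1 by rewrite invr_ge0 ltW// divr_gt0.
  have ratn (x : R) : exists q : rat, ball (ratr q : R) (n.+1%:R^-1 : R) x.
    have [q] := @rat_in_itvoo R (x - n.+1%:R^-1) (x + n.+1%:R^-1) ltac:(rewrite ltrD2l gtrN// invr_gt0//).
    rewrite in_itv/= => /andP[qx xq]; exists q.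
    rewrite /ball/= ltr_norml; apply/andP; split; last by rewrite ltrBlDr addrC.
    by rewrite ltrBrDr addrC.
  have [p pz] := ratn z.1.
  have [q qz] := ratn z.2.
  exists (p, q, n) => //; rewrite asboolT; first by split.
  move=> w [/= pw qw]; apply: eA; split => /=.
  - rewrite (_ : e = e / 2 + e / 2); last by rewrite -splitr.
    apply: (@ball_triangle _ _ (ratr p : R)); apply: (le_ball (ltW ne)) => //.
    exact: ball_sym.
  - rewrite (_ : e = e / 2 + e / 2); last by rewrite -splitr.
    apply: (@ball_triangle _ _ (ratr q : R)); apply: (le_ball (ltW ne)) => //.
    exact: ball_sym.
apply: countable_bigcupT_measurable => // i.
case: ifP => _ //; apply: measurableX; exact: measurable_ball.
Qed.

Lemma continuous2_measurable (f : R * R -> R) : continuous f ->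
  measurable_fun [set: mR * mR] (f : mR * mR -> R).
Proof.
move=> cf; apply: (measurability _ (RGenOpens.measurableE R)) => //.
move=> _ [_ [a [b ->]] <-]; rewrite setTI; apply: open2_measurable.
by move/continuousP : cf; apply; exact: interval_open.
Qed.

End lebesgue_plane.

(** * Primitives of square-integrable functions *)

Section primitive_line.
Context {R : realType}.
Notation mR := (measurableTypeR R).
Notation mu := (@lebesgue_measure R).
Implicit Types g : R -> R.

Definition prim1 g (y : R) : R := \int[mu]_(s in `]-oo, y]) g s.

Definition dq1 (F : R -> R) (h y : R) : R := (F (y + h) - F y) / h.

Lemma Rint_in (A : set mR) g : \int[mu]_(s in A) g s = \int[mu]_s (\1_A s * g s).
Proof.
rewrite Rintegral_mkcond; apply: Rint_eq => s.
by rewrite patchE indicE; case: ifP; rewrite ?mul1r ?mul0r.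
Qed.

Lemma prim1_sub g y h : intg mu g -> 0 <= h ->
  prim1 g (y + h) - prim1 g y = \int[mu]_s (\1_(`]y, y + h]) s * g s).
Proof.
move=> gi h0; rewrite /prim1 (Rint_in `]-oo, y + h]) (Rint_in `]-oo, y]).
have iA b : intg mu (fun s => \1_(`]-oo, b]) s * g s).
  by apply: intg_indic => //; exact: measurable_itv.
rewrite -(RintB (iA _) (iA _)); apply: Rint_eq => s; rewrite -mulrBl; congr (_ * _).
rewrite !indicE !mem_setE !in_itv/=.
case: (leP s y) => sy; last by case: (leP s (y + h)); rewrite ?subr0.
by rewrite (le_trans sy) ?lerDl//= subrr.
Qed.

Lemma indic_itv_intg (a b : R) : intg mu (\1_(`]a, b])).
Proof. exact: integrable_indic_itv. Qed.

Lemma Rint_indic_itv (a b : R) : a <= b -> \int[mu]_s (\1_(`]a, b]) s : R) = b - a.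
Proof.
move=> ab; rewrite /Rintegral integral_indic//= setIT lebesgue_measure_itv/= lte_fin.
by case: ltP => //= ba; apply/eqP; rewrite eq_sym subr_eq0 eq_le ab ba.
Qed.

(* Jensen's inequality, from the positivity of the variance of [g] on the interval. *)
Lemma prim1_sub_sqr g y h : intg mu g -> intg mu (fun s => g s ^+ 2) -> 0 < h ->
  (prim1 g (y + h) - prim1 g y) ^+ 2 <=
  h * \int[mu]_s (\1_(`]y, y + h]) s * g s ^+ 2).
Proof.
move=> gi g2i h0; rewrite prim1_sub//; last exact: ltW.
set I := `]y, y + h]%classic.
set a := \int[mu]_s (\1_I s * g s).
have mI : measurable (I : set mR) by exact: measurable_itv.
have iI : intg mu (\1_I) by exact: indic_itv_intg.
have i1 : intg mu (fun s => \1_I s * g s) by exact: intg_indic.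
have i2 : intg mu (fun s => \1_I s * g s ^+ 2) by exact: intg_indic.
set b := \int[mu]_s (\1_I s * g s ^+ 2).
pose c := a / h.
have : 0 <= \int[mu]_s (\1_I s * (g s - c) ^+ 2).
  by apply: Rint_ge0 => s; rewrite mulr_ge0// ?sqr_ge0// indicE ler0n.
have -> : \int[mu]_s (\1_I s * (g s - c) ^+ 2) = b - 2 * c * a + c ^+ 2 * h.
  have -> : \int[mu]_s (\1_I s * (g s - c) ^+ 2) =
     \int[mu]_s ((\1_I s * g s ^+ 2 - (2 * c) * (\1_I s * g s)) + c ^+ 2 * \1_I s).
    by apply: Rint_eq => s; ring.
  rewrite RintD; [|by apply: intgB => //; exact: intgZ|exact: intgZ].
  rewrite RintB//; last exact: intgZ.
  rewrite RintZ// RintZ// Rint_indic_itv ?lerDl ?ltW//.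
  by congr (_ + _ * _); rewrite addrAC subrr add0r.
have -> : b - 2 * c * a + c ^+ 2 * h = b - a ^+ 2 / h by rewrite /c; field; rewrite gt_eqF.
by rewrite subr_ge0 ler_pdivrMr// mulrC.
Qed.

Lemma measurable_prim1 g : intg mu g -> measurable_fun [set: mR] (prim1 g).
Proof.
move=> gi.
have -> : prim1 g = fun y => \int[mu]_s (\1_(`]-oo, y]) s * g s).
  by apply/funext => y; rewrite /prim1 Rint_in.
apply: (@measurable_Rint R _ mR (fun z => \1_(`]-oo, z.1]) z.2 * g z.2)).
apply: measurable_funM; last exact: (measurableT_comp (intg_meas gi) measurable_snd).
have -> : (fun z : mR * mR => \1_(`]-oo, z.1]) z.2 : R) =
    \1_[set z : mR * mR | (z.2 : R) <= z.1].
  by apply/funext => z; rewrite !indicE !mem_setE in_itv/=; congr (_%:R); congr nat_of_bool;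
    apply/idP/idP; rewrite inE.
apply: measurable_indic.
rewrite -[X in measurable X]setTI.
by apply: measurable_fun_le.
Qed.

(** By [prim1_sub_sqr] the squared quotient at y is at most the mean of g^2 over the interval from y
    to y + h, and integrating in y first turns this mean into the whole integral of g^2. The
    constant 1 matters: it is what [generalized_dominated_cvg] asks of the majorants. *)
Lemma dq1_prim_L2 g h : intg mu g -> intg mu (fun s => g s ^+ 2) -> h != 0 ->
  intg mu (fun y => dq1 (prim1 g) h y ^+ 2) /\
  \int[mu]_y (dq1 (prim1 g) h y ^+ 2) <= \int[mu]_y (g y ^+ 2).
Proof.
move=> gi g2i.
(* A backward quotient is a forward one at a translated point, so translation invariance reduces to
   positive steps. *)
wlog h0 : h / 0 < h.
  move=> H hn0; have [h0|h0|h0] := ltgtP h 0; last by rewrite h0 eqxx in hn0.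
  - have [||H1 H2] := H (- h); [by rewrite oppr_gt0|by rewrite oppr_eq0|].
    have E y : dq1 (prim1 g) (- h) (y + h) = dq1 (prim1 g) h y.
      by rewrite /dq1 addrK -opprB mulNr invrN mulrN opprK.
    split.
      have := mpres_intg (shift1_mpres h) H1.
      by under eq_fun do rewrite E.
    rewrite -(mpres_Rint (shift1_mpres h) (intg_meas H1)) in H2.
    by move: H2; under Rint_eq do rewrite E.
  - by apply: H => //; rewrite gt_eqF.
move=> hn0.
pose k (z : mR * mR) : R := \1_(`]0, h]) z.2 * g (z.1 + z.2) ^+ 2.
have mg := intg_meas gi; have mg2 := intg_meas g2i.
have madd : measurable_fun [set: mR * mR] (fun z : mR * mR => (z.1 : R) + z.2 : mR).
  by apply: measurable_funD; [exact: measurable_fst|exact: measurable_snd].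
have mk : measurable_fun [set: mR * mR] k.
  apply: measurable_funM.
    have mI : measurable_fun [set: mR] (\1_(`]0, h]) : mR -> R).
      exact: measurable_indic.
    exact: (measurableT_comp mI measurable_snd).
  exact: (measurableT_comp mg2 madd).
have k0 z : 0 <= k z by rewrite /k mulr_ge0 ?sqr_ge0// indicE ler0n.
(* the roles of the two variables are exchanged to integrate first in the base point *)
pose k' (z : mR * mR) : R := k (z.2, z.1).
have mk' : measurable_fun [set: mR * mR] k'.
  exact: (measurableT_comp mk swap_mpres.1).
have k'i r : intg mu (fun y => k' (r, y)).
  rewrite /k' /k/=; apply: intgZ.
  exact: (mpres_intg (shift1_mpres r) g2i).
have k'E r : \int[mu]_y k' (r, y) = \int[mu]_y (g y ^+ 2) * \1_(`]0, h]) r.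
  rewrite /k' /k/= RintZ; last exact: (mpres_intg (shift1_mpres r) g2i).
  by rewrite mulrC (mpres_Rint (shift1_mpres r) mg2).
have k'2 : intg (lebesgue2 R) k'.
  apply: intg_tonelli => //; first exact: aeW.
  have -> : (fun r => \int[mu]_y `|k' (r, y)|) =
      fun r => \int[mu]_y (g y ^+ 2) * \1_(`]0, h]) r.
    by apply/funext => r; rewrite -k'E; apply: Rint_eq => y; rewrite ger0_norm//; exact: k0.
  by apply: intgZ; exact: indic_itv_intg.
have k2 : intg (lebesgue2 R) k by exact: (mpres_intg swap_mpres k'2).
have Ik : \int[lebesgue2 R]_z k z = h * \int[mu]_y (g y ^+ 2).
  rewrite -(mpres_Rint swap_mpres mk).
  have [_ ->] := Rint_fubini k'2.
  under Rint_eq do rewrite k'E.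
  rewrite RintZ; last exact: indic_itv_intg.
  by rewrite Rint_indic_itv ?ltW// subr0 mulrC.
have [iK IK] := Rint_fubini k2.
have le y : dq1 (prim1 g) h y ^+ 2 <= h^-1 * \int[mu]_r k (y, r).
  rewrite /dq1 expr_div_n ler_pdivrMr ?exprn_gt0//.
  have -> : h^-1 * \int[mu]_r k (y, r) * h ^+ 2 = h * \int[mu]_r k (y, r).
    by field; rewrite hn0.
  have -> : \int[mu]_r k (y, r) = \int[mu]_s (\1_(`]y, y + h]) s * g s ^+ 2).
    have mm : measurable_fun [set: mR] (fun s => \1_(`]y, y + h]) s * g s ^+ 2 : R).
      by apply: measurable_funM => //; exact: measurable_indic.
    rewrite -(mpres_Rint (shift1_mpres y) mm); apply: Rint_eq => r.
    rewrite /k/= (addrC r); congr (_ * _).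
    by rewrite !indicE !mem_setE !in_itv/= ltrDl lerD2l.
  exact: prim1_sub_sqr.
have md : measurable_fun [set: mR] (fun y => dq1 (prim1 g) h y ^+ 2).
  apply: measurable_funX; rewrite /dq1.
  apply: measurable_funM => //; apply: measurable_funB.
    exact: (measurableT_comp (measurable_prim1 gi) (shift1_mpres h).1).
  exact: measurable_prim1.
have di : intg mu (fun y => dq1 (prim1 g) h y ^+ 2).
  apply: (@intg_le _ _ _ _ _ (fun y => h^-1 * \int[mu]_r k (y, r))) => //.
    by move=> y; rewrite ger0_norm ?sqr_ge0.
  exact: intgZ.
split=> //; apply: (le_trans (Rint_le di (intgZ h^-1 iK) le)).
by rewrite RintZ// -IK Ik mulrA mulVf// mul1r.
Qed.

Lemma prim1_derive g : intg mu g ->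
  {ae mu, forall y : mR, is_derive (y : R) 1 (prim1 g) (g y)}.
Proof.
move=> gi.
have li : locally_integrable [set: R] g.
  by apply: open_integrable_locally => //; exact: openT.
have gy (y : R) : mu.-integrable (`]-oo, y] : set mR) (EFin \o g).
  by apply: (integrableS measurableT) => //; exact: measurable_itv.
have := @FTC1Ny R g gy li.
apply: filterS; first exact: (ae_filter_ringOfSetsType mu).
move=> y [dF F'E]; split; first exact: dF.
by rewrite -derive1E.
Qed.

Lemma prim1_bound g y : intg mu g -> `|prim1 g y| <= \int[mu]_s `|g s|.
Proof.
move=> gi; rewrite /prim1 Rint_in.
have ig : intg mu (fun s => \1_(`]-oo, y]) s * g s) by exact: intg_indic.
apply: (le_trans (Rint_norm_le ig)); apply: Rint_le; [exact: intg_norm|exact: intg_norm|].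
move=> s; rewrite normrM indicE; case: (_ \in _); first by rewrite normr1 mul1r.
by rewrite normr0 mul0r.
Qed.

Lemma is_derive_dq_cvg (F : R -> R) (y l : R) (h : nat -> R) :
  is_derive y 1 F l -> (forall n, h n != 0) -> h n @[n --> \oo] --> (0 : R) ->
  dq1 F (h n) y @[n --> \oo] --> l.
Proof.
move=> [dF <-] hn0 h0.
have h0' : h n @[n --> \oo] --> (0 : R)^'.
  move=> A A0; move: (h0 _ A0).
  by rewrite !nbhs_filterE /fmap/=; apply: filterS => n Hn; exact: (Hn (hn0 n)).
have := cvg_comp _ _ h0' dF.
apply: cvg_trans; apply: near_eq_cvg; apply: nearW => n /=.
have -> : h n *: 1 + y = y + h n by rewrite [_ *: _]mulr1 addrC.
by rewrite /dq1 mulrC.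
Qed.

End primitive_line.

(** * Primitives along vertical lines in the plane *)

Section primitive_plane.
Context {R : realType}.
Notation mR := (measurableTypeR R).
Notation mu := (@lebesgue_measure R).
Notation mu2 := (lebesgue2 R).
Implicit Types u : R * R -> R.

(* A component of a bounded-support L^2 field, in a representative all of whose
   vertical sections are square integrable. *)
Definition regular_slices u (M : R) :=
  [/\ measurable_fun [set: mR * mR] (u : mR * mR -> R),
      forall z, M < `|z.1| \/ M < `|z.2| -> u z = 0,
      forall x, intg mu (fun y => u (x, y) ^+ 2) &
      intg mu2 (fun z => u z ^+ 2)].

Definition prim u (z : R * R) : R := prim1 (fun s => u (z.1, s)) z.2.

Definition dq2 (F : R * R -> R) (h : R) (z : R * R) : R :=
  (F (z.1, z.2 + h) - F z) / h.

(** One unit wider than the support on each side, so that difference quotients with steps shorter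
    than 1 stay inside. *)
Definition itvM (M : R) : set mR := `]- M - 1, M + 1]%classic.

Lemma measurable_itvM M : measurable_fun [set: mR] (\1_(itvM M) : mR -> R).
Proof. by apply: measurable_indic; exact: measurable_itv. Qed.

Lemma measurable_itvM1 M :
  measurable_fun [set: mR * mR] (fun z : mR * mR => \1_(itvM M) z.1 : R).
Proof. exact: (measurableT_comp (measurable_itvM M) measurable_fst). Qed.

Lemma measurable_itvM2 M :
  measurable_fun [set: mR * mR] (fun z : mR * mR => \1_(itvM M) z.2 : R).
Proof. exact: (measurableT_comp (measurable_itvM M) measurable_snd). Qed.

Lemma in_itvM M x : `|x| <= M -> \1_(itvM M) x = 1 :> R.
Proof.
move=> xM; rewrite indicE mem_set// /itvM/= in_itv/=.
move: xM; rewrite ler_norml => /andP[Mx xM]; apply/andP; split.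
  by apply: lt_le_trans Mx; rewrite ltrBlDr ltrDl.
by apply: (le_trans xM); rewrite lerDl.
Qed.

Lemma box_intg M : intg mu2 (fun z => \1_(itvM M) z.1 * \1_(itvM M) z.2 : R).
Proof.
have mf : measurable_fun [set: mR * mR] (fun z => \1_(itvM M) z.1 * \1_(itvM M) z.2 : R).
  by apply: measurable_funM; [exact: measurable_itvM1|exact: measurable_itvM2].
have i1 : intg mu (\1_(itvM M)) by exact: indic_itv_intg.
apply: intg_tonelli => //; first by apply: aeW => x /=; exact: intgZ.
have -> : (fun x => \int[mu]_y `|\1_(itvM M) (x, y).1 * \1_(itvM M) (x, y).2 : R|) =
    fun x => (\int[mu]_y \1_(itvM M) y) * \1_(itvM M) x.
  apply/funext => x /=; rewrite mulrC -RintZ//; apply: Rint_eq => y.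
  by rewrite ger0_norm// mulr_ge0// indicE ler0n.
exact: intgZ.
Qed.

Section regular.
Variables (u : R * R -> R) (M : R).
Hypothesis su : regular_slices u M.

Let mu_ : measurable_fun [set: mR * mR] (u : mR * mR -> R). Proof. by case: su. Qed.

Lemma regular_slice x : intg mu (fun y => u (x, y)).
Proof.
have [_ u0 u2 _] := su.
apply: (@intg_le _ _ _ _ _ (fun y => \1_(itvM M) y + u (x, y) ^+ 2)).
- exact: (measurableT_comp mu_ (measurable_pair1 x)).
- move=> y; have [yM|yM] := leP `|y| M; last first.
    by rewrite u0 ?normr0 ?addr_ge0 ?sqr_ge0 ?indicE//; right.
  rewrite in_itvM// -real_normK ?num_real//.
  by have := normr_ge0 (u (x, y)); nra.
- by apply: intgD => //; exact: indic_itv_intg.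
Qed.

Lemma regular_intg : intg mu2 u.
Proof.
have [_ u0 _ u2] := su.
apply: (@intg_le _ _ _ _ _ (fun z => \1_(itvM M) z.1 * \1_(itvM M) z.2 + u z ^+ 2)) => //.
- move=> z; have [zM|zM] := boolP ((`|z.1| <= M) && (`|z.2| <= M)); last first.
    rewrite u0 ?normr0 ?addr_ge0 ?mulr_ge0 ?sqr_ge0 ?indicE//.
    by move: zM; rewrite negb_and -!ltNge => /orP.
  have /andP[z1 z2] := zM.
  rewrite !in_itvM// -real_normK ?num_real//.
  by have := normr_ge0 (u z); nra.
- by apply: intgD => //; exact: box_intg.
Qed.

Lemma measurable_prim : measurable_fun [set: mR * mR] (prim u : mR * mR -> R).
Proof.
have -> : prim u = fun z => \int[mu]_s (\1_(`]-oo, z.2]) s * u (z.1, s)).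
  by apply/funext => z; rewrite /prim /prim1 Rint_in.
apply: (@measurable_Rint R _ (mR * mR)%type
  (fun w => \1_(`]-oo, w.1.2]) w.2 * u (w.1.1, w.2))).
apply: measurable_funM; last first.
  apply: (measurableT_comp mu_); apply: measurable_fun_pair.
    exact: (measurableT_comp measurable_fst measurable_fst).
  exact: measurable_snd.
have -> : (fun w : mR * mR * mR => \1_(`]-oo, w.1.2]) w.2 : R) =
    \1_[set w : mR * mR * mR | (w.2 : R) <= w.1.2].
  by apply/funext => z; rewrite !indicE !mem_setE in_itv/=; congr (_%:R); congr nat_of_bool;
    apply/idP/idP; rewrite inE.
apply: measurable_indic.
rewrite -[X in measurable X]setTI.
apply: measurable_fun_le => //.
exact: (measurableT_comp measurable_snd measurable_fst).
Qed.

Lemma measurable_dq2 (F : mR * mR -> R) h : measurable_fun setT F ->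
  measurable_fun [set: mR * mR] (dq2 F h : mR * mR -> R).
Proof.
move=> mF; apply: measurable_funM => //; apply: measurable_funB => //.
have -> : (fun z : mR * mR => F (z.1, z.2 + h)) =
    F \o (fun z : mR * mR => (z.1 + 0, z.2 + h)).
  by apply/funext => z /=; rewrite addr0.
exact: (measurableT_comp mF (measurable_shift2 0 h)).
Qed.

Lemma prim_dq_L2 h : h != 0 ->
  intg mu2 (fun z => dq2 (prim u) h z ^+ 2) /\
  \int[mu2]_z (dq2 (prim u) h z ^+ 2) <= \int[mu2]_z (u z ^+ 2).
Proof.
move=> h0; have [_ _ u2 u22] := su.
have sl x := dq1_prim_L2 (regular_slice x) (u2 x) h0.
have md : measurable_fun [set: mR * mR] (fun z => dq2 (prim u) h z ^+ 2).
  by apply: measurable_funX; apply: measurable_dq2; exact: measurable_prim.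
have di : intg mu2 (fun z => dq2 (prim u) h z ^+ 2).
  apply: intg_tonelli => //; first by apply: aeW => x; exact: (sl x).1.
  apply: (@intg_le _ mR R mu _ (fun x => \int[mu]_y (u (x, y) ^+ 2))).
  - by apply: (@measurable_Rint R _ mR (fun z => `|dq2 (prim u) h z ^+ 2|)); exact: measurableT_comp.
  - move=> x; rewrite ger0_norm ?Rint_ge0//.
    apply: le_trans (sl x).2; rewrite le_eqVlt; apply/orP; left; apply/eqP.
    by apply: Rint_eq => y; rewrite ger0_norm ?sqr_ge0.
  - exact: (Rint_fubini u22).1.
split=> //; have [i1 ->] := Rint_fubini di; have [i2 ->] := Rint_fubini u22.
by apply: Rint_le => // x; exact: (sl x).2.
Qed.

Lemma prim_dq_cvg (h : nat -> R) : (forall n, h n != 0) ->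
  h n @[n --> \oo] --> (0 : R) ->
  {ae mu2, forall z, dq2 (prim u) (h n) z @[n --> \oo] --> u z}.
Proof.
move=> hn0 h0.
(* Convergence is encoded as the vanishing of a measurable function of [z], which is the
   measurability that [ae_prod] needs. On each vertical line the claim is then Lebesgue
   differentiation. *)
pose e (z : mR * mR) := limn_esup (fun n => `|dq2 (prim u) (h n) z - u z|%:E).
have me : measurable_fun [set: mR * mR] e.
  apply: (@measurable_fun_limn_esup _ _ _ setT
    (fun n z => `|dq2 (prim u) (h n) z - u z|%:E)%E) => n.
  apply/measurable_EFinP; apply: measurableT_comp => //.
  by apply: measurable_funB => //; apply: measurable_dq2; exact: measurable_prim.
have : {ae mu2, forall z, [set z | e z = 0%E] z}.
  apply: ae_prod.
    by rewrite -[X in measurable X]setTI; exact: (me measurableT [set 0%E]).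
  apply: aeW => x; apply: filterS (prim1_derive (regular_slice x)) => y dy /=.
  have c := is_derive_dq_cvg dy hn0 h0.
  rewrite /e is_cvg_limn_esupE.
    apply/cvg_lim => //; apply: cvg_EFin; first exact: nearW.
    rewrite -(@normr0 _ R) -(subrr (u (x, y))); apply: cvg_norm.
    by apply: cvgB => //; exact: cvg_cst.
  apply/cvg_ex; exists 0%E; apply: cvg_EFin; first exact: nearW.
  rewrite -(@normr0 _ R) -(subrr (u (x, y))); apply: cvg_norm.
  by apply: cvgB => //; exact: cvg_cst.
apply: filterS => z /= ez.
have : `|dq2 (prim u) (h n) z - u z|%:E @[n --> \oo] --> 0%E.
  apply/limn_esup_le_cvg; last by move=> n; rewrite lee_fin.
  by rewrite -/(e z) ez.
move=> /fine_cvg /= c.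
apply/cvgrPdist_le => d d0; move/cvgrPdist_le : c => /(_ d d0).
by apply: filterS => n /=; rewrite sub0r normrN normr_id distrC.
Qed.

Lemma prim_zero1 z : M < `|z.1| -> prim u z = 0.
Proof.
move=> zM; rewrite /prim /prim1 Rint_in -[RHS](Rint_cst0 mu).
by apply: Rint_eq => s; have [_ -> //] := su; rewrite ?mulr0//; left.
Qed.

Lemma prim_zero2 z : z.2 < - M -> prim u z = 0.
Proof.
move=> zM; rewrite /prim /prim1 Rint_in -[RHS](Rint_cst0 mu).
apply: Rint_eq => s; rewrite indicE mem_setE in_itv/=; case: leP; last by rewrite mul0r.
move=> sz; have [_ -> //] := su; rewrite ?mulr0//; right => /=.
have : s < - M by exact: le_lt_trans zM.
by rewrite ltrNr => /lt_le_trans; apply; rewrite -normrN ler_norm.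
Qed.

(** Without the cutoff in the second variable integrability may fail: above the support [prim u] is
    constant on each vertical line, equal to the total integral of [u] there. *)
Lemma prim_strip_intg N : intg mu2 (fun z => \1_(itvM N) z.2 * prim u z).
Proof.
have [ia _] := Rint_fubini (intg_norm regular_intg).
have mf : measurable_fun [set: mR * mR] (fun z => \1_(itvM N) z.2 * prim u z).
  apply: measurable_funM; last exact: measurable_prim.
  exact: measurable_itvM2.
have i1 : intg mu (\1_(itvM N)) by exact: indic_itv_intg.
have le z : `|\1_(itvM N) z.2 * prim u z| <=
    (\int[mu]_s `|u (z.1, s)|) * \1_(itvM N) z.2.
  rewrite normrM mulrC (ger0_norm (_ : 0 <= \1_(itvM N) z.2)) ?indicE//.
  by rewrite ler_wpM2r// (prim1_bound _ (regular_slice _)).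
apply: (@intg_le _ (mR * mR)%type R mu2 _ (fun z => (\int[mu]_s `|u (z.1, s)|) * \1_(itvM N) z.2)) => //.
apply: intg_tonelli.
- apply: measurable_funM.
    exact: (measurableT_comp (intg_meas ia) measurable_fst).
  exact: measurable_itvM2.
- by apply: aeW => x /=; exact: intgZ.
- have -> : (fun x => \int[mu]_y `|(\int[mu]_s `|u ((x, y).1, s)|) * \1_(itvM N) (x, y).2|) =
    fun x => (\int[mu]_y \1_(itvM N) y) * (\int[mu]_s `|u (x, s)|).
    apply/funext => x /=; rewrite mulrC -RintZ//; apply: Rint_eq => y.
    by rewrite ger0_norm// mulr_ge0 ?Rint_ge0// indicE ler0n.
  exact: intgZ.
Qed.

End regular.

End primitive_plane.

(** * Test functions built from the stream functions *)

Section discrete_derivatives.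
Context {R : realType}.
Notation mR := (measurableTypeR R).
Notation mu := (@lebesgue_measure R).
Notation mu2 := (lebesgue2 R).
Implicit Types (K P F : R * R -> R).

Definition swp (z : R * R) : R * R := (z.2, z.1).

Lemma swpK z : swp (swp z) = z. Proof. by case: z. Qed.

Lemma measurable_swp F : measurable_fun [set: mR * mR] (F : mR * mR -> R) ->
  measurable_fun [set: mR * mR] (F \o swp : mR * mR -> R).
Proof. by move=> mF; exact: (measurableT_comp mF swap_mpres.1). Qed.

Definition translate (a b : R) F (z : R * R) := F (z.1 + a, z.2 + b).

Lemma measurable_translate a b F : measurable_fun [set: mR * mR] (F : mR * mR -> R) ->
  measurable_fun [set: mR * mR] (translate a b F : mR * mR -> R).
Proof. by move=> mF; exact: (measurableT_comp mF (measurable_shift2 a b)). Qed.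

Lemma translate_intg a b F : intg mu2 F -> intg mu2 (translate a b F).
Proof. exact: (mpres_intg (shift2_mpres a b)). Qed.

Section summation_by_parts.
Variables (K1 K2 P1 P2 : R * R -> R) (C : R).
Hypotheses (iK1 : intg mu2 K1) (mK2 : measurable_fun [set: mR * mR] (K2 : mR * mR -> R)).
Hypotheses (mP1 : measurable_fun [set: mR * mR] (P1 : mR * mR -> R)).
Hypotheses (mP2 : measurable_fun [set: mR * mR] (P2 : mR * mR -> R)).
Hypotheses (P1C : forall z, `|P1 z| <= C) (P2C : forall z, `|P2 z| <= C).
Hypotheses (K12 : {ae mu2, forall z, K1 z = K2 z}).
Hypotheses (P12 : {ae mu2, forall z, P1 z = P2 z}).

Let E (a b : R) := \int[mu2]_z (K1 z * translate a b P1 z).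

Let iKP K P a b c d : intg mu2 K -> measurable_fun [set: mR * mR] (P : mR * mR -> R) ->
  (forall z, `|P z| <= C) -> intg mu2 (fun z => translate a b K z * translate c d P z).
Proof.
move=> iK mP PC; apply: (@intg_mulb _ _ _ _ _ _ C).
- exact: translate_intg.
- exact: measurable_translate.
- by move=> z; exact: PC.
Qed.

Let corr K P a b c d : intg mu2 K -> measurable_fun [set: mR * mR] (P : mR * mR -> R) ->
  (forall z, `|P z| <= C) -> {ae mu2, forall z, K1 z = K z} ->
  {ae mu2, forall z, P1 z = P z} ->
  \int[mu2]_z (translate a b K z * translate c d P z) = E (c - a) (d - b).
Proof.
move=> iK mP PC KK PP.
have m1 : measurable_fun [set: mR * mR] (fun z : mR * mR => K1 z * translate (c - a) (d - b) P1 z).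
  by apply: measurable_funM; [exact: intg_meas iK1|exact: measurable_translate].
rewrite /E -(mpres_Rint (shift2_mpres a b) m1).
apply: Rint_ae.
- by apply: intg_meas; exact: iKP.
- exact: (measurableT_comp m1 (measurable_shift2 a b)).
- apply: filterS2 (mpres_ae (shift2_mpres a b) KK) (mpres_ae (shift2_mpres c d) PP) => z.
  rewrite /translate/= => -> e; congr (_ * _).
  by rewrite -!addrA !subrKC.
Qed.

(** By translation invariance both sides expand into the same four correlations of [K1] with
    translates of [P1]. For small h this is the identity int K_y P_x = int K_x P_y. Two
    representatives of each function occur because each will be differentiable along the lines of
    one direction only. *)
Lemma summation_by_parts h : h != 0 ->
  \int[mu2]_z (dq2 K1 h z * dq2 (P2 \o swp) h (swp z)) =
  \int[mu2]_z (dq2 (K2 \o swp) (- h) (swp z) * dq2 P1 (- h) z).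
Proof.
move=> h0.
have iK2 : intg mu2 K2 := intg_ae mK2 K12 iK1.
have K11 : {ae mu2, forall z, K1 z = K1 z} by apply: aeW.
have P11 : {ae mu2, forall z, P1 z = P1 z} by apply: aeW.
have e0 F z : F z = translate 0 0 F z by rewrite /translate !addr0; case: z.
transitivity (h^-1 ^+ 2 * (E h (- h) - E 0 (- h) - E h 0 + E 0 0)).
  have -> : E h (- h) - E 0 (- h) - E h 0 + E 0 0 =
      \int[mu2]_z (translate 0 h K1 z * translate h 0 P2 z) - \int[mu2]_z (translate 0 h K1 z * translate 0 0 P2 z)
      - \int[mu2]_z (translate 0 0 K1 z * translate h 0 P2 z) + \int[mu2]_z (translate 0 0 K1 z * translate 0 0 P2 z).
    by rewrite !corr// !subr0 !sub0r.
  rewrite -RintB; [|exact: iKP|exact: iKP].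
  rewrite -RintB; [|by apply: intgB; exact: iKP|exact: iKP].
  rewrite -RintD; [|by apply: intgB; [apply: intgB|]; exact: iKP|exact: iKP].
  rewrite -RintZ; last by apply: intgD; [apply: intgB; [apply: intgB|]|]; exact: iKP.
  apply: Rint_eq => z; rewrite -!e0 /dq2 /translate /swp /= !addr0.
  by case: z => x y /=; field.
transitivity (h^-1 ^+ 2 * (E h (- h) - E h 0 - E 0 (- h) + E 0 0)); first by congr (_ * (_ + _)); ring.
have -> : E h (- h) - E h 0 - E 0 (- h) + E 0 0 =
    \int[mu2]_z (translate (- h) 0 K2 z * translate 0 (- h) P1 z) - \int[mu2]_z (translate (- h) 0 K2 z * translate 0 0 P1 z)
    - \int[mu2]_z (translate 0 0 K2 z * translate 0 (- h) P1 z) + \int[mu2]_z (translate 0 0 K2 z * translate 0 0 P1 z).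
  by rewrite !corr// !subr0 !sub0r !opprK.
rewrite -RintB; [|exact: iKP|exact: iKP].
rewrite -RintB; [|by apply: intgB; exact: iKP|exact: iKP].
rewrite -RintD; [|by apply: intgB; [apply: intgB|]; exact: iKP|exact: iKP].
rewrite -RintZ; last by apply: intgD; [apply: intgB; [apply: intgB|]|]; exact: iKP.
apply: Rint_eq => z; rewrite -!e0 /dq2 /translate /swp /= !addr0.
by case: z => x y /=; field.
Qed.

End summation_by_parts.

Definition lipschitz_derivable (C : R) (f f' : R -> R) :=
  [/\ forall x : R, is_derive x 1 f (f' x), forall x, `|f x| <= C,
      forall x y, `|f y - f x| <= C * `|y - x| &
      measurable_fun [set: R] f'].

(** Wide enough to contain products of ramps beside smooth functions: ramps are what localizes a
    flux identity on a single line, but they may fail to be differentiable at two points. *)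
Definition yreg (C : R) (phi phi' : R * R -> R) :=
  [/\ measurable_fun [set: mR * mR] (phi : mR * mR -> R),
      measurable_fun [set: mR * mR] (phi' : mR * mR -> R),
      forall z, `|phi z| <= C,
      forall x y y', `|phi (x, y') - phi (x, y)| <= C * `|y' - y| &
      {ae mu2, forall z : mR * mR,
        is_derive (z.2 : R) 1 (fun y : R => phi (z.1, y)) (phi' z)}].

Definition weight phi H G (f g : R -> R) (z : R * R) := phi z * f (H z) * g (G z).

Definition weight_der phi phi' H G u w (f f' g g' : R -> R) (z : R * R) : R :=
  phi' z * f (H z) * g (G z) + phi z * (f' (H z) * u z) * g (G z)
  + phi z * f (H z) * (g' (G z) * w z).

Lemma cvg_of_dq (F : R -> R) (y l : R) (h : nat -> R) :
  (forall n, h n != 0) -> h n @[n --> \oo] --> (0 : R) ->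
  dq1 F (h n) y @[n --> \oo] --> l -> F (y + h n) @[n --> \oo] --> F y.
Proof.
move=> hn0 h0 dF.
have -> : (fun n => F (y + h n)) = (fun n => F y + h n * dq1 F (h n) y).
  by apply/funext => n; rewrite /dq1 mulrC divfK// subrKC.
rewrite -[X in _ --> X]addr0 -(mul0r l).
by apply: cvgD; [exact: cvg_cst|exact: cvgM].
Qed.

(* Caratheodory's formulation of the derivative. *)
Lemma cvg_dq_comp (f : R -> R) (F : R -> R) (y l l' : R) (h : nat -> R) :
  (forall n, h n != 0) -> h n @[n --> \oo] --> (0 : R) ->
  is_derive (F y) 1 f l' ->
  dq1 F (h n) y @[n --> \oo] --> l ->
  dq1 (f \o F) (h n) y @[n --> \oo] --> l' * l.
Proof.
move=> hn0 h0 [df <-] dF.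
pose a := F y.
pose q t := if t == a then 'D_1 f a else (f t - f a) / (t - a).
have qE t : f t - f a = q t * (t - a).
  rewrite /q; case: eqVneq => [->|ta]; first by rewrite !subrr mulr0.
  by rewrite divfK// subr_eq0.
have cq : q t @[t --> a] --> q a.
  have qa : q a = 'D_1 f a by rewrite /q eqxx.
  apply/cvgrPdist_lt => e e0; rewrite qa.
  move/cvgrPdist_lt : df => /(_ e e0).
  rewrite -/a => /= H.
  have {}H : \forall r \near 0, r != 0 -> `|'D_1 f a - r^-1 *: ((f \o shift a) r%:A - f a)| < e.
    by move: H; rewrite /dnbhs near_withinE.
  have : \forall t \near a, (t - a) != 0 ->
      `|'D_1 f a - (t - a)^-1 *: ((f \o shift a) (t - a)%:A - f a)| < e.
    by rewrite (near_shift (0 : R)) subr0; apply: filterS H => r /= Hr; rewrite addrK.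
  apply: filterS => t Ht; rewrite /q; case: (eqVneq t a) => [_|ta].
    by rewrite subrr normr0.
  by move: Ht; rewrite subr_eq0 => /(_ ta) /=; rewrite [_%:A]mulr1 subrK mulrC.
have -> : (fun n => dq1 (f \o F) (h n) y) = fun n => q (F (y + h n)) * dq1 F (h n) y.
  by apply/funext => n; rewrite /dq1/= qE mulrA.
have qa : q a = 'D_1 f a by rewrite /q eqxx.
rewrite -qa; apply: cvgM => //.
apply: (cvg_comp _ _ (cvg_of_dq hn0 h0 dF)); exact: cq.
Qed.

Lemma cvg_dq_mul (F G : R -> R) (y l l' : R) (h : nat -> R) :
  (forall n, h n != 0) -> h n @[n --> \oo] --> (0 : R) ->
  dq1 F (h n) y @[n --> \oo] --> l -> dq1 G (h n) y @[n --> \oo] --> l' ->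
  dq1 (fun t => F t * G t) (h n) y @[n --> \oo] --> l * G y + F y * l'.
Proof.
move=> hn0 h0 dF dG.
have -> : (fun n => dq1 (fun t => F t * G t) (h n) y) =
    fun n => dq1 F (h n) y * G (y + h n) + F y * dq1 G (h n) y.
  by apply/funext => n; rewrite /dq1; field; exact: hn0.
apply: cvgD; apply: cvgM => //; last exact: cvg_cst.
exact: (cvg_of_dq hn0 h0 dG).
Qed.

End discrete_derivatives.

(** * Passage to the limit in the difference quotients *)

Section chain_rule_limit.
Context {R : realType}.
Notation mR := (measurableTypeR R).
Notation mu := (@lebesgue_measure R).
Notation mu2 := (lebesgue2 R).

Lemma normr_mul3_le (a b c A B D : R) : `|a| <= A -> `|b| <= B -> `|c| <= D ->
  `|a * b * c| <= A * B * D.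
Proof. by move=> aA bB cD; rewrite !normrM ler_pM// ?mulr_ge0// ler_pM. Qed.

(** The increment of the product is telescoped, one factor changing at a time, and the Lipschitz
    bounds of [f] and [g] hand the increments over to [H] and [G]. The result is linear in the two
    quotients, hence controlled in L^2 as soon as they are. *)
Lemma weight_dq_bound (C : R) phi phi' (H G : R * R -> R) f f' g g' h z :
  yreg C phi phi' -> lipschitz_derivable C f f' -> lipschitz_derivable C g g' ->
  h != 0 ->
  `|dq2 (weight phi H G f g) h z| <= C ^+ 3 * (1 + `|dq2 H h z| + `|dq2 G h z|).
Proof.
move=> [_ _ phiC phiL _] [_ fC fL _] [_ gC gL _] h0.
case: z => x y; rewrite /dq2 /weight /=.
set H1 := H (x, y + h); set H0 := H (x, y); set G1 := G (x, y + h); set G0 := G (x, y).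
set p1 := phi (x, y + h); set p0 := phi (x, y).
have -> : p1 * f H1 * g G1 - p0 * f H0 * g G0 =
   (p1 - p0) * f H1 * g G1 + p0 * (f H1 - f H0) * g G1 + p0 * f H0 * (g G1 - g G0).
  by ring.
rewrite !normrM !normfV ler_pdivrMr ?normr_gt0//.
have -> : C ^+ 3 * (1 + `|H1 - H0| / `|h| + `|G1 - G0| / `|h|) * `|h| =
    (C * `|h|) * C * C + C * (C * `|H1 - H0|) * C + C * C * (C * `|G1 - G0|).
  by field; rewrite normr_eq0.
apply: (le_trans (ler_normD _ _)); apply: lerD.
  apply: (le_trans (ler_normD _ _)); apply: lerD; apply: normr_mul3_le.
  all: try exact: phiC.
  all: try exact: fC.
  all: try exact: gC.
  all: try exact: fL.
  by apply: (le_trans (phiL _ _ _)); rewrite addrAC subrr add0r.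
by apply: normr_mul3_le; [exact: phiC|exact: fC|exact: gL].
Qed.

Lemma weight_bound (C : R) phi phi' (H G : R * R -> R) f f' g g' z :
  yreg C phi phi' -> lipschitz_derivable C f f' -> lipschitz_derivable C g g' ->
  `|weight phi H G f g z| <= C * C * C.
Proof.
move=> [_ _ phiC phiL _] [_ fC fL _] [_ gC gL _].
by apply: normr_mul3_le.
Qed.

Lemma derivable_measurable (f f' : R -> R) (C : R) : lipschitz_derivable C f f' ->
  measurable_fun [set: R] f.
Proof.
move=> [df _ _ _]; apply: continuous_measurable_fun => x.
by apply: differentiable_continuous; apply/derivable1_diffP; have [] := df x.
Qed.

Lemma measurable_weight (C : R) phi phi' (H G : R * R -> R) f f' g g' :
  yreg C phi phi' -> lipschitz_derivable C f f' -> lipschitz_derivable C g g' ->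
  measurable_fun [set: mR * mR] (H : mR * mR -> R) ->
  measurable_fun [set: mR * mR] (G : mR * mR -> R) ->
  measurable_fun [set: mR * mR] (weight phi H G f g : mR * mR -> R).
Proof.
move=> [mphi _ _ _ _] rf rg mH mG; apply: measurable_funM.
  apply: measurable_funM => //.
  exact: (measurableT_comp (derivable_measurable rf) mH).
exact: (measurableT_comp (derivable_measurable rg) mG).
Qed.

Lemma measurable_weight_der (C : R) phi phi' (H G u w : R * R -> R) f f' g g' :
  yreg C phi phi' -> lipschitz_derivable C f f' -> lipschitz_derivable C g g' ->
  measurable_fun [set: mR * mR] (H : mR * mR -> R) ->
  measurable_fun [set: mR * mR] (G : mR * mR -> R) ->
  measurable_fun [set: mR * mR] (u : mR * mR -> R) ->
  measurable_fun [set: mR * mR] (w : mR * mR -> R) ->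
  measurable_fun [set: mR * mR] (weight_der phi phi' H G u w f f' g g' : mR * mR -> R).
Proof.
move=> [mphi mphi' _ _ _] rf rg mH mG mu_ mw.
have mf := measurableT_comp (derivable_measurable rf) mH.
have mg := measurableT_comp (derivable_measurable rg) mG.
have [_ _ _ mf'] := rf; have [_ _ _ mg'] := rg.
have mf'H := measurableT_comp mf' mH; have mg'G := measurableT_comp mg' mG.
by repeat first [apply: measurable_funD | apply: measurable_funM | by []].
Qed.

Section limit.
Variables (u u2 w2 : R * R -> R) (M C : R).
Hypotheses (su : regular_slices u M) (su2 : regular_slices u2 M).
Hypothesis sw2 : regular_slices w2 M.
(* no net flux through almost every line *)
Hypothesis uflux : {ae mu2, forall z : mR * mR, M < (z.2 : R) -> prim u z = 0}.
Variables (phi phi' : R * R -> R) (f f' g g' : R -> R).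
Hypotheses (rphi : yreg C phi phi') (rf : lipschitz_derivable C f f').
Hypothesis rg : lipschitz_derivable C g g'.
Variable h : nat -> R.
Hypotheses (h_neq0 : forall n, h n != 0) (h_lt1 : forall n, `|h n| < 1).
Hypothesis h_cvg0 : h n @[n --> \oo] --> (0 : R).

Let H := prim u2.
Let G := prim w2.
Let Psi := weight phi H G f g.
Let dPsi := weight_der phi phi' H G u2 w2 f f' g g'.
Let C0 : 0 <= C.
Proof. by case: rphi => _ _ /(_ (0, 0)) + _ _; apply: le_trans. Qed.

Lemma weight_dq_cvg :
  {ae mu2, forall z, dq2 Psi (h n) z @[n --> \oo] --> dPsi z}.
Proof.
have [_ _ _ _ dphi] := rphi; have [df _ _ _] := rf; have [dg _ _ _] := rg.
apply: (ae_mono3 dphi (prim_dq_cvg su2 h_neq0 h_cvg0) (prim_dq_cvg sw2 h_neq0 h_cvg0)).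
move=> -[x y] /= dphixy dH dG.
have c1 := is_derive_dq_cvg dphixy h_neq0 h_cvg0.
have c2 := cvg_dq_comp h_neq0 h_cvg0 (df (H (x, y)))
  (dH : dq1 (fun t => H (x, t)) (h n) y @[n --> \oo] --> u2 (x, y)).
have c3 := cvg_dq_comp h_neq0 h_cvg0 (dg (G (x, y)))
  (dG : dq1 (fun t => G (x, t)) (h n) y @[n --> \oo] --> w2 (x, y)).
have := cvg_dq_mul h_neq0 h_cvg0 (cvg_dq_mul h_neq0 h_cvg0 c1 c2) c3.
rewrite /dPsi /weight_der /= mulrDl; exact.
Qed.

(** Below the box and beside it the primitive vanishes because [u] does; above the box it vanishes
    by [uflux]. Steps shorter than 1 reach at most into the enlarged box. *)
Lemma prim_dq_support : {ae mu2, forall z n, dq2 (prim u) (h n) z != 0 ->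
  \1_(itvM M) z.1 * \1_(itvM M) z.2 = 1 :> R}.
Proof.
have fl : {ae mu2, forall z n, M < z.2 + h n -> prim u (z.1 + 0, z.2 + h n) = 0}.
  by apply/ae_foralln => n; exact: (mpres_ae (shift2_mpres 0 (h n)) uflux).
apply: (ae_mono2 uflux fl) => -[x y] /= f1 f2 n; apply: contra_neqP => xy.
have hn := h_lt1 n; move: hn; rewrite ltr_norml => /andP[hn1 hn2].
have [xM|xM] := leP `|x| M; last first.
  by rewrite /dq2 /= !(prim_zero1 su)// subrr mul0r.
have [yM|yM] := leP `|y| M; first by case: xy; rewrite !in_itvM// mulr1.
move: (yM); rewrite ltr_normr => /orP[yM'|yM'].
- have [yM2|yM2] := ltP (M + 1) y.
    rewrite /dq2 /= f1//.
    have := f2 n; rewrite addr0 => ->; first by rewrite subrr mul0r.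
    lra.
  case: xy; rewrite in_itvM// mul1r indicE mem_set// /itvM/= in_itv/=.
  have M0 : 0 <= M by exact: le_trans xM.
  by apply/andP; split => //; lra.
- have [yM2|yM2] := leP y (- M - 1).
    rewrite /dq2 /= !(prim_zero2 su)//=; [by rewrite subrr mul0r|lra|lra].
  case: xy; rewrite in_itvM// mul1r indicE mem_set// /itvM/= in_itv/=.
  have M0 : 0 <= M by exact: le_trans xM.
  by apply/andP; split => //; lra.
Qed.

(** Both factors converge almost everywhere, but no single function dominates their products. The
    majorants [Z n] below have integrals at most that of their limit [Zl], because passing from a
    function to the difference quotient of its primitive does not increase the L^2 norm; this is the
    situation of [generalized_dominated_cvg]. *)
Lemma dq_weight_limit :
  intg mu2 (fun z => u z * dPsi (swp z)) /\
  \int[mu2]_z (dq2 (prim u) (h n) z * dq2 Psi (h n) (swp z)) @[n --> \oo] -->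
  \int[mu2]_z (u z * dPsi (swp z)).
Proof.
have [mu_ _ _ u22] := su; have [mu2_ _ _ u222] := su2; have [mw2_ _ _ w222] := sw2.
have mH : measurable_fun [set: mR * mR] (H : mR * mR -> R) := measurable_prim su2.
have mG : measurable_fun [set: mR * mR] (G : mR * mR -> R) := measurable_prim sw2.
have mPsi : measurable_fun [set: mR * mR] (Psi : mR * mR -> R).
  exact: (measurable_weight rphi rf rg).
have mdPsi : measurable_fun [set: mR * mR] (dPsi : mR * mR -> R).
  exact: (measurable_weight_der rphi rf rg).
pose chi (z : R * R) : R := \1_(itvM M) z.1 * \1_(itvM M) z.2.
pose Z n (z : R * R) := C ^+ 3 * ((2 * dq2 (prim u) (h n) z ^+ 2 + chi z) +
  (dq2 H (h n) (swp z) ^+ 2 + dq2 G (h n) (swp z) ^+ 2)).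
pose Zl (z : R * R) := C ^+ 3 * ((2 * u z ^+ 2 + chi z) + (u2 (swp z) ^+ 2 + w2 (swp z) ^+ 2)).
have chi0 z : 0 <= chi z by rewrite /chi mulr_ge0// indicE ler0n.
have ichi : intg mu2 chi by exact: box_intg.
have iu n := (prim_dq_L2 su (h_neq0 n)).1.
have iu2 n := (prim_dq_L2 su2 (h_neq0 n)).1.
have iw2 n := (prim_dq_L2 sw2 (h_neq0 n)).1.
have iu2s n : intg mu2 (fun z => dq2 H (h n) (swp z) ^+ 2) := mpres_intg swap_mpres (iu2 n).
have iw2s n : intg mu2 (fun z => dq2 G (h n) (swp z) ^+ 2) := mpres_intg swap_mpres (iw2 n).
have lu2s : intg mu2 (fun z => u2 (swp z) ^+ 2) := mpres_intg swap_mpres u222.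
have lw2s : intg mu2 (fun z => w2 (swp z) ^+ 2) := mpres_intg swap_mpres w222.
have [] := @generalized_dominated_cvg _ _ R mu2 (fun n z => dq2 (prim u) (h n) z * dq2 Psi (h n) (swp z))
  Z (fun z => u z * dPsi (swp z)) Zl; last by move=> _ iX cX; split.
- move=> n; apply: measurable_funM; first exact: (measurable_dq2 _ (measurable_prim su)).
  by apply: (measurable_swp (F := dq2 Psi (h n))); exact: measurable_dq2.
- by apply: measurable_funM => //; exact: measurable_swp.
- move=> n; apply: intgZ; apply: intgD; apply: intgD => //; exact: intgZ.
- by apply: intgZ; apply: intgD; apply: intgD => //; exact: intgZ.
- apply: (ae_mono2 (prim_dq_cvg su h_neq0 h_cvg0) (mpres_ae swap_mpres weight_dq_cvg)).
  by move=> z c1 c2; exact: cvgM.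
- apply: (ae_mono3 (prim_dq_cvg su h_neq0 h_cvg0)
    (mpres_ae swap_mpres (prim_dq_cvg su2 h_neq0 h_cvg0))
    (mpres_ae swap_mpres (prim_dq_cvg sw2 h_neq0 h_cvg0))).
  move=> z c1 c2 c3; apply: cvgM; first exact: cvg_cst.
  apply: cvgD; apply: cvgD; [|exact: cvg_cst|exact: cvgM|exact: cvgM].
  by apply: cvgM; [exact: cvg_cst|exact: cvgM].
- apply: (ae_mono prim_dq_support) => z dz n; rewrite /Z.
  have := weight_dq_bound H G (swp z) rphi rf rg (h_neq0 n).
  rewrite -/Psi; set a := dq2 (prim u) (h n) z; set b := dq2 H _ _.
  set c := dq2 G _ _; set d := dq2 Psi _ _ => dle.
  (* Where the quotient [a] of the first factor vanishes the bound is trivial. Elsewhere [chi]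
     equals 1, and the claim is a (1 + b + c) <= 2 a^2 + 1 + b^2 + c^2 for the absolute values. The
     constant 1 is thus paid by the integrable function [chi]. *)
  have [a0|a0] := eqVneq a 0.
    rewrite a0 mul0r normr0 mulr_ge0 ?exprn_ge0//.
    rewrite expr0n mulr0 add0r; apply: addr_ge0; first exact: chi0.
    by apply: addr_ge0; exact: sqr_ge0.
  rewrite /chi (dz n a0) normrM.
  apply: (le_trans (ler_wpM2l (normr_ge0 _) dle)).
  rewrite mulrCA ler_wpM2l ?exprn_ge0//.
  rewrite -(real_normK (num_real a)) -(real_normK (num_real b)) -(real_normK (num_real c)).
  move: (`|a|) (`|b|) (`|c|); clear a b c d dle a0 => a b c.
  have h1 : 0 <= (a - 1) ^+ 2 by exact: sqr_ge0.
  have h2 : 0 <= (a - b) ^+ 2 by exact: sqr_ge0.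
  have h3 : 0 <= (a - c) ^+ 2 by exact: sqr_ge0.
  have [h4 h5] : 0 <= b ^+ 2 /\ 0 <= c ^+ 2 by rewrite !sqr_ge0.
  have h6 : 0 <= a ^+ 2 by exact: sqr_ge0.
  nra.
- move=> n; rewrite /Z /Zl RintZ; last first.
    by apply: intgD; apply: intgD => //; exact: intgZ.
  rewrite RintZ; last by apply: intgD; apply: intgD => //; exact: intgZ.
  rewrite ler_wpM2l ?exprn_ge0//.
  rewrite RintD; [|by apply: intgD => //; exact: intgZ|exact: intgD].
  rewrite RintD; [|exact: intgZ|by []].
  rewrite RintD//.
  rewrite [leRHS]RintD; [|by apply: intgD => //; exact: intgZ|exact: intgD].
  rewrite (RintD (intgZ 2 u22) ichi) (RintD lu2s lw2s) !RintZ//.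
  apply: lerD.
    by rewrite lerD2r ler_wpM2l//; exact: (prim_dq_L2 su (h_neq0 n)).2.
  apply: lerD.
  + rewrite (mpres_Rint swap_mpres (intg_meas (iu2 n))) (mpres_Rint swap_mpres (intg_meas u222)).
    exact: (prim_dq_L2 su2 (h_neq0 n)).2.
  + rewrite (mpres_Rint swap_mpres (intg_meas (iw2 n))) (mpres_Rint swap_mpres (intg_meas w222)).
    exact: (prim_dq_L2 sw2 (h_neq0 n)).2.
Qed.

End limit.
End chain_rule_limit.

(** * Stream functions and the weighted flux identity *)

Section stream_functions.
Context {R : realType}.
Notation mR := (measurableTypeR R).
Notation mu := (@lebesgue_measure R).
Notation mu2 := (lebesgue2 R).

(* [u1] and [u2 \o swp] play the roles of [v.1] and [- v.2]; the common value
   [prim u1 = prim u2 \o swp] is the stream function of v, and [stream_v], [stream_rhov] below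
   are the stream functions of v and rho v. *)
Record stream_data (u1 u2 rho : R * R -> R) (M L : R) : Prop := {
  sd_u1 : regular_slices u1 M ;
  sd_u2 : regular_slices u2 M ;
  sd_rho : measurable_fun [set: mR * mR] (rho : mR * mR -> R) ;
  sd_rhoL : forall z, `|rho z| <= L ;
  sd_H : {ae mu2, forall z : mR * mR, prim u1 z = prim u2 (swp z)} ;
  sd_G : {ae mu2, forall z : mR * mR, prim (fun z => rho z * u1 z) z =
                          prim (fun z => rho (swp z) * u2 z) (swp z)} }.

Lemma regular_slicesM u rho (M L : R) : regular_slices u M ->
  measurable_fun [set: mR * mR] (rho : mR * mR -> R) -> (forall z, `|rho z| <= L) ->
  regular_slices (fun z => rho z * u z) M.
Proof.
move=> [mu_ u0 u2 u22] mrho rhoL; have L0 : 0 <= L by exact: le_trans (rhoL (0, 0)).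
have le z : `|(rho z * u z) ^+ 2| <= L ^+ 2 * u z ^+ 2.
  rewrite ger0_norm ?sqr_ge0// exprMn ler_wpM2r ?sqr_ge0//.
  by rewrite -(real_normK (num_real (rho z))) lerXn2r// nnegrE.
have mru : measurable_fun [set: mR * mR] (fun z : mR * mR => rho z * u z).
  exact: measurable_funM.
split=> //.
- by move=> z /u0 ->; rewrite mulr0.
- move=> x; apply: (@intg_le _ mR R mu _ (fun y => L ^+ 2 * u (x, y) ^+ 2)).
  + apply: measurable_funX.
    exact: (measurableT_comp mru (measurable_pair1 x)).
  + by move=> y; exact: le.
  + exact: intgZ.
- apply: (@intg_le _ (mR * mR)%type R mu2 _ (fun z => L ^+ 2 * u z ^+ 2)) => //.
  + exact: measurable_funX.
  + exact: intgZ.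
Qed.

Section stream.
Variables (u1 u2 rho : R * R -> R) (M L : R).
Hypothesis sd : stream_data u1 u2 rho M L.

Let w1 z := rho z * u1 z.
Let w2 z := rho (swp z) * u2 z.

Let su1 := sd_u1 sd.
Let su2 := sd_u2 sd.

Let sw1 : regular_slices w1 M := regular_slicesM su1 (sd_rho sd) (sd_rhoL sd).
Let sw2 : regular_slices w2 M :=
  regular_slicesM su2 (measurable_swp (sd_rho sd)) (fun z => sd_rhoL sd (swp z)).

(** Reflection in the diagonal. It provides the absence of net flux for [prim u2], needed for the
    half of the summation by parts in which the roles of the coordinates are exchanged. *)
Lemma stream_data_sym : stream_data u2 u1 (rho \o swp) M L.
Proof.
split; [exact: su2|exact: su1| | | | ].
- exact: measurable_swp (sd_rho sd).
- by move=> z; exact: sd_rhoL sd _.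
- by apply: (ae_mono (mpres_ae swap_mpres (sd_H sd))) => z /= ->; rewrite /swp/=; case: z.
- apply: (ae_mono (mpres_ae swap_mpres (sd_G sd))) => z /= e.
  have E : (fun z => (rho \o swp) (swp z) * u1 z) = fun z => rho z * u1 z.
    by apply/funext => z' /=; rewrite swpK.
  by rewrite E e -/(swp z) swpK.
Qed.

Definition stream_v : R * R -> R := prim u1.
Definition stream_rhov : R * R -> R := prim w1.

Lemma measurable_stream_v : measurable_fun [set: mR * mR] (stream_v : mR * mR -> R).
Proof. exact: measurable_prim su1. Qed.

Lemma measurable_stream_rhov : measurable_fun [set: mR * mR] (stream_rhov : mR * mR -> R).
Proof. exact: measurable_prim sw1. Qed.

(** Almost everywhere the vertical primitive equals a horizontal one, and on a horizontal line above
    the support there is nothing to integrate. *)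
Lemma stream_flux : {ae mu2, forall z : mR * mR, M < (z.2 : R) -> stream_v z = 0}.
Proof.
apply: (ae_mono (sd_H sd)) => z e zM; rewrite /stream_v e (prim_zero1 su2)//.
by rewrite ltr_normr zM.
Qed.

Lemma stream_v_intg : intg mu2 stream_v.
Proof.
apply: (intg_ae _ _ (prim_strip_intg su1 M)); first exact: measurable_stream_v.
apply: (ae_mono stream_flux) => z zM.
have [z2|z2] := leP `|z.2| M; first by rewrite in_itvM// mul1r.
move: z2; rewrite ltr_normr => /orP[|z2]; first by move/zM; rewrite /stream_v => ->; rewrite mulr0.
by rewrite /stream_v (prim_zero2 su1) ?mulr0// ltrNr.
Qed.

(** The product of v with grad phi, the sign of the second component being absorbed in [u2]. *)
Definition flux_density (phix phiy : R * R -> R) (z : R * R) : R :=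
  u1 z * phix z - u2 (swp z) * phiy z.

Definition admissible (C : R) (phi phix phiy : R * R -> R) :=
  yreg C phi phiy /\ yreg C (phi \o swp) (phix \o swp).

End stream.

Section chain_rule.
Variables (u1 u2 rho : R * R -> R) (M L : R).
Hypothesis sd : stream_data u1 u2 rho M L.
Let w1 z := rho z * u1 z.
Let w2 z := rho (swp z) * u2 z.
Let su1 := sd_u1 sd.
Let su2 := sd_u2 sd.
Let sw1 : regular_slices w1 M := regular_slicesM su1 (sd_rho sd) (sd_rhoL sd).
Let sw2 : regular_slices w2 M :=
  regular_slicesM su2 (measurable_swp (sd_rho sd)) (fun z => sd_rhoL sd (swp z)).

Let hn (n : nat) : R := n.+2%:R^-1.
Let hn0 n : hn n != 0. Proof. by rewrite invr_eq0. Qed.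
Let hn1 n : `|hn n| < 1.
Proof. by rewrite ger0_norm ?invr_ge0// invf_lt1// ltr1n. Qed.
Let hnc : hn n @[n --> \oo] --> (0 : R).
Proof.
have := @cvg_harmonic R; rewrite -cvg_shiftS.
by apply: cvg_trans; apply: near_eq_cvg; exact: nearW.
Qed.

(* The test function [phi f(H) g(G)] is admissible because H and G lie in W^{1,2};
   the terms where the derivative falls on [f(H) g(G)] cancel since the gradients
   of H and G are parallel. *)
Lemma stream_weighted_flux C phi phix phiy f f' g g' :
  admissible C phi phix phiy ->
  lipschitz_derivable C f f' -> lipschitz_derivable C g g' ->
  \int[mu2]_z (f (stream_v u1 z) * g (stream_rhov u1 rho z) * flux_density u1 u2 phix phiy z) = 0.
Proof.
move=> [rphi rphis] rf rg.
pose Psi1 := weight phi (prim u1) (prim w1) f g.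
pose Psi2 := weight (phi \o swp) (prim u2) (prim w2) f g.
have fl1 := stream_flux sd; have fl2 := stream_flux (stream_data_sym sd).
(* Summation by parts turns forward steps into backward ones. With step h the limit pairs H_y with
   the x-derivative of phi f(H) g(G); with step -h, below, it pairs H_x with the y-derivative. *)
have [i1 c1] := dq_weight_limit su1 su2 sw2 fl1 rphis rf rg hn0 hn1 hnc.
have hm0 n : - hn n != 0 by rewrite oppr_eq0.
have hm1 n : `|- hn n| < 1 by rewrite normrN.
have hmc : - hn n @[n --> \oo] --> (0 : R) by rewrite -oppr0; exact: cvgN.
have [i2 c2] := dq_weight_limit su2 su1 sw1 fl2 rphi rf rg hm0 hm1 hmc.
have mPsi1 : measurable_fun [set: mR * mR] (Psi1 : mR * mR -> R).
  exact: (measurable_weight rphi rf rg (measurable_prim su1) (measurable_prim sw1)).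
have mPsi2 : measurable_fun [set: mR * mR] (Psi2 : mR * mR -> R).
  exact: (measurable_weight rphis rf rg (measurable_prim su2) (measurable_prim sw2)).
have P12 : {ae mu2, forall z, Psi1 z = (Psi2 \o swp) z}.
  apply: (ae_mono2 (sd_H sd) (sd_G sd)) => z /= eH eG.
  by rewrite /Psi1 /Psi2 /weight /= swpK eH eG.
pose a n := \int[mu2]_z (dq2 (prim u1) (hn n) z * dq2 Psi2 (hn n) (swp z)).
pose b n := \int[mu2]_z (dq2 (prim u2) (- hn n) z * dq2 Psi1 (- hn n) (swp z)).
have ab : a = b.
  apply/funext => n; rewrite /a /b.
  have mD : measurable_fun [set: mR * mR] (fun z : mR * mR =>
      dq2 (prim u2) (- hn n) z * dq2 Psi1 (- hn n) (swp z)).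
    apply: measurable_funM; first exact: (measurable_dq2 _ (measurable_prim su2)).
    by apply: (measurable_swp (F := dq2 Psi1 (- hn n))); exact: measurable_dq2.
  have := @summation_by_parts R (prim u1) (prim u2 \o swp) Psi1 (Psi2 \o swp)
    (C * C * C) (stream_v_intg sd) (measurable_swp (measurable_prim su2)) mPsi1
    (measurable_swp mPsi2) (fun z => weight_bound _ _ z rphi rf rg)
    (fun z => weight_bound _ _ (swp z) rphis rf rg) (sd_H sd) P12 _ (hn0 n).
  have -> : (Psi2 \o swp) \o swp = Psi2 by apply/funext => z /=; rewrite swpK.
  have -> : (prim u2 \o swp) \o swp = prim u2 by apply/funext => z /=; rewrite swpK.
  move=> ->; rewrite -(mpres_Rint swap_mpres mD).
  by apply: Rint_eq => z; rewrite -/(swp z) swpK.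
have eqlim : \int[mu2]_z (u1 z * weight_der (phi \o swp) (phix \o swp) (prim u2) (prim w2)
      u2 w2 f f' g g' (swp z)) =
    \int[mu2]_z (u2 z * weight_der phi phiy (prim u1) (prim w1) u1 w1 f f' g g' (swp z)).
  have ca : a n @[n --> \oo] --> _ := c1.
  have cb : b n @[n --> \oo] --> _ := c2.
  by rewrite ab in ca; exact: (cvg_unique (@Rhausdorff R) ca cb).
have i2s := mpres_intg swap_mpres i2.
rewrite -(mpres_Rint swap_mpres (intg_meas i2)) in eqlim.
move/eqP: eqlim; rewrite -subr_eq0 -RintB// => /eqP <-.
have [_ mphiy _ _ _] := rphi; have [_ mphix _ _ _] := rphis.
have mphix' : measurable_fun [set: mR * mR] (phix : mR * mR -> R).
  have := measurable_swp mphix.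
  by have -> : (phix \o swp) \o swp = phix by apply/funext => z /=; rewrite swpK.
have [mu1 _ _ _] := su1; have [mu2' _ _ _] := su2.
apply: Rint_ae.
- apply: measurable_funM.
    apply: measurable_funM.
      exact: (measurableT_comp (derivable_measurable rf) (measurable_stream_v sd)).
    exact: (measurableT_comp (derivable_measurable rg) (measurable_stream_rhov sd)).
  apply: measurable_funB; apply: measurable_funM => //.
  exact: (measurable_swp mu2').
- by apply: measurable_funB; [exact: intg_meas i1|exact: intg_meas i2s].
(* The terms with f' cancel by symmetry. So do those with g', because both partial derivatives of
   the second stream function are the same multiple [rho] of those of the first. Only the
   derivatives of [phi] survive. *)
- apply: (ae_mono2 (sd_H sd) (sd_G sd)) => z eH eG.
  rewrite -/(swp z) swpK /weight_der /flux_density /stream_v /stream_rhov /=.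
  rewrite !swpK -/w1 -/w2 eH -eG -eH /w1 /w2 !swpK.
  ring.
Qed.

End chain_rule.
End stream_functions.

(** * Borel functions of the stream functions *)

Section logistic_step.
Context {R : realType}.
Implicit Types x y c h : R.

(** Smooth, bounded, 1-Lipschitz and with exponential tails: rescaled copies are admissible weights
    that converge everywhere to the indicator of an open ray. *)
Definition logistic x : R := (1 + expR (- x))^-1.

Let den_gt0 x : 0 < 1 + expR (- x). Proof. by rewrite ltr_wpDr// expR_ge0. Qed.

Lemma logistic_ge0 x : 0 <= logistic x.
Proof. by rewrite invr_ge0 ltW. Qed.

Lemma logistic_le1 x : logistic x <= 1.
Proof. by rewrite invf_le1// lerDl expR_ge0. Qed.

Lemma is_derive_logistic x : is_derive x 1 logistic (expR (- x) * logistic x ^+ 2).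
Proof.
have d : is_derive x 1 (fun y => 1 + expR (- y)) (- expR (- x)).
  by apply: is_derive_eq; rewrite add0r mul1r mulrN1.
have n0 : 1 + expR (- x) != 0 by rewrite gt_eqF.
have := @is_deriveV R (fun y => 1 + expR (- y)) x _ 1 n0 d.
have -> : - (1 + expR (- x)) ^- 2 *: (- expR (- x)) = expR (- x) * logistic x ^+ 2; last by [].
by rewrite scaleNr scalerN opprK [LHS]mulrC /logistic exprVn.
Qed.

Lemma logistic_lip x y : `|logistic y - logistic x| <= `|y - x|.
Proof.
wlog xy : x y / x <= y.
  move=> W; have [xy|/ltW yx] := leP x y; first exact: W.
  by rewrite distrC (distrC y); exact: W.
have -> : logistic y - logistic x =
    (expR (- x) - expR (- y)) * (logistic x * logistic y).
  by rewrite /logistic; field; rewrite !gt_eqF.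
have E : expR (- y) = expR (- x) * expR (x - y) by rewrite -expRD; congr expR; ring.
have e1 : 1 + (x - y) <= expR (x - y) by exact: expR_ge1Dx.
have e2 : expR (x - y) <= 1 by rewrite -expR0 ler_expR subr_le0.
rewrite E -[X in X - _]mulr1 -mulrBr -mulrA.
have p0 := expR_ge0 (- x); have l0 := logistic_ge0 x; have l1 := logistic_ge0 y.
have q1 := logistic_le1 y.
have q2 : expR (- x) * logistic x <= 1.
  by rewrite /logistic ler_pdivrMr// mul1r lerDr.
rewrite ger0_norm; last by rewrite !mulr_ge0// subr_ge0.
rewrite (ger0_norm (_ : 0 <= y - x)) ?subr_ge0//.
rewrite mulrCA (mulrA (expR _)) -[leRHS]mulr1.
apply: ler_pM; [by rewrite subr_ge0|by rewrite !mulr_ge0|lra|].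
by rewrite -[leRHS]mulr1; apply: ler_pM => //; rewrite mulr_ge0.
Qed.

Lemma logistic_tail x : `|logistic x - (0 < x)%R%:R| <= expR (- `|x|).
Proof.
have [x0|x0] := ltP 0 x.
  rewrite (gtr0_norm x0) ler0_norm ?subr_le0 ?logistic_le1// opprB.
  have -> : 1 - logistic x = expR (- x) * logistic x.
    by rewrite /logistic; field; rewrite gt_eqF.
  by rewrite ler_piMr ?expR_ge0// logistic_le1.
rewrite subr0 (ger0_norm (logistic_ge0 x)) (ler0_norm x0) opprK /logistic.
by rewrite -[expR x]invrK -expRN lef_pV2 ?posrE ?expR_gt0// lerDr.
Qed.

Definition step a b h := logistic (a * h - b).

Lemma lipschitz_derivable_le C C' (f f' : R -> R) : C <= C' ->
  lipschitz_derivable C f f' -> lipschitz_derivable C' f f'.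
Proof.
move=> CC [df fC fL mf']; split=> //.
- by move=> x; exact: le_trans (fC x) CC.
- by move=> x y; apply: (le_trans (fL x y)); rewrite ler_wpM2r.
Qed.

Lemma step_reg a b : lipschitz_derivable (1 + `|a|) (step a b)
  (fun h => expR (- (a * h - b)) * step a b h ^+ 2 * a).
Proof.
have da h : is_derive h 1 (fun t => a * t - b) a.
  by apply: is_derive_eq; rewrite subr0 [LHS]mulr1.
have ds h : is_derive h 1 (step a b) (expR (- (a * h - b)) * step a b h ^+ 2 * a).
  by rewrite /step; exact: (is_derive1_comp (is_derive_logistic _) (da h)).
split=> //.
- move=> h; rewrite (ger0_norm (logistic_ge0 _)) (le_trans (logistic_le1 _))//.
  by rewrite lerDl.
- move=> x y; apply: (le_trans (logistic_lip _ _)).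
  have -> : a * y - b - (a * x - b) = a * (y - x) by ring.
  by rewrite normrM ler_wpM2r// lerDr.
- have ma : measurable_fun [set: R] (fun h : R => a * h - b).
    by apply: measurable_funB => //; apply: measurable_funM.
  have ms : measurable_fun [set: R] (step a b).
    apply: continuous_measurable_fun => x.
    by apply: differentiable_continuous; apply/derivable1_diffP; have [] := ds x.
  apply: measurable_funM => //; apply: measurable_funM; last exact: measurable_funX.
  apply: (measurableT_comp (f := expR)) => //.
  exact: measurableT_comp.
Qed.

Lemma cst_reg (C : R) : 1 <= C -> lipschitz_derivable C (cst 1) (cst 0).
Proof.
move=> C1; split.
- by move=> x; exact: is_derive_cst.
- by move=> x /=; rewrite normr1.
- by move=> x y /=; rewrite subrr normr0 mulr_ge0// (le_trans _ C1).
- exact: measurable_cst.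
Qed.

Let sq (n : nat) : R := n%:R.

(* the shift by [n] makes the steps vanish in the limit at [c] itself *)
Definition steps c (n : nat) := step (sq n ^+ 2) (sq n ^+ 2 * c + sq n).

Lemma steps_cvg c h : steps c n h @[n --> \oo] --> ((c < h)%R%:R : R).
Proof.
have large : \forall n \near \oo, `|steps c n h - (c < h)%R%:R| <= expR (- n%:R).
  have [ch|hc] := ltP c h.
    have d0 : 0 < h - c by rewrite subr_gt0.
    near=> n.
    have n0 : (0 : R) < n%:R by rewrite ltr0n; near: n; exact: nbhs_infty_gt.
    (* The argument of the logistic function is n (n (h - c) - 1), which is at least n from here
       on. *)
    have nd : 2 <= n%:R * (h - c).
      rewrite -ler_pdivrMr//; near: n; exact: nbhs_infty_ger.
    have big : n%:R <= sq n ^+ 2 * h - (sq n ^+ 2 * c + sq n).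
      by rewrite /sq; nra.
    have := logistic_tail (sq n ^+ 2 * h - (sq n ^+ 2 * c + sq n)).
    rewrite (lt_le_trans n0 big) => /le_trans; apply.
    by rewrite ler_expR lerN2 (le_trans big)// ler_norm.
  apply: nearW => n.
  have le : sq n ^+ 2 * h - (sq n ^+ 2 * c + sq n) <= - n%:R.
    have := sqr_ge0 (sq n); rewrite /sq; nra.
  have := logistic_tail (sq n ^+ 2 * h - (sq n ^+ 2 * c + sq n)).
  have -> : (0 < sq n ^+ 2 * h - (sq n ^+ 2 * c + sq n)) = false.
    by apply/negbTE; rewrite -leNgt (le_trans le)// oppr_le0.
  move=> /le_trans; apply.
  by rewrite ler_expR lerN2 -normrN (le_trans _ (ler_norm _))// lerNr.
have e0 : expR (- n%:R) @[n --> \oo] --> (0 : R).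
  apply: (@squeeze_cvgr _ _ _ _ (cst 0) (fun n : nat => n.+1%:R^-1)).
  - apply: nearW => n; rewrite expR_ge0/= expRN lef_pV2 ?posrE ?expR_gt0//.
    by rewrite -natr1 addrC expR_ge1Dx.
  - exact: cvg_cst.
  - exact: cvg_harmonic.
apply/cvgrPdist_le => e e_gt0; move/cvgrPdist_le : e0 => /(_ e e_gt0) e0.
apply: filterS2 large e0 => n l; rewrite sub0r normrN ger0_norm ?expR_ge0// => e'.
by rewrite distrC (le_trans l).
Unshelve. all: by end_near. Qed.

Lemma steps_reg c n : lipschitz_derivable (1 + `|sq n ^+ 2|) (steps c n)
  (fun h => expR (- (sq n ^+ 2 * h - (sq n ^+ 2 * c + sq n))) * steps c n h ^+ 2 * sq n ^+ 2).
Proof. exact: step_reg. Qed.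

Lemma steps_norm c n h : `|steps c n h| <= 1.
Proof. by rewrite ger0_norm ?logistic_ge0// logistic_le1. Qed.

End logistic_step.

(** * From smooth weights to Borel sets of values *)

Section borel_flux.
Context {R : realType}.
Notation mR := (measurableTypeR R).
Notation mu := (@lebesgue_measure R).
Notation mu2 := (lebesgue2 R).

Lemma yreg_le C C' (phi phi' : R * R -> R) : C <= C' -> yreg C phi phi' -> yreg C' phi phi'.
Proof.
move=> CC [m1 m2 pC pL pd]; split=> //.
- by move=> z; exact: le_trans (pC z) CC.
- by move=> x y y'; apply: (le_trans (pL x y y')); rewrite ler_wpM2r.
Qed.

Lemma admissible_le C C' (phi phix phiy : R * R -> R) : C <= C' ->
  admissible C phi phix phiy -> admissible C' phi phix phiy.
Proof. by move=> CC [a1 a2]; split; exact: yreg_le CC _. Qed.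

(** The derivative is a limit of quotients that the Lipschitz condition bounds by [C]. *)
Lemma yreg_der_bound C (phi phi' : R * R -> R) : yreg C phi phi' ->
  {ae mu2, forall z, `|phi' z| <= C}.
Proof.
move=> [_ _ _ pL pd]; apply: (ae_mono pd) => -[x y] /= d.
pose h (n : nat) : R := n.+1%:R^-1.
have h0 n : h n != 0 by rewrite invr_eq0.
have := is_derive_dq_cvg d h0 (@cvg_harmonic R) => c.
apply: (ler_cvg_to (cvg_norm c) (@cvg_cst _ C _ \oo _)).
apply: nearW => n; rewrite /dq1 normrM normfV ler_pdivrMr ?normr_gt0//.
by apply: (le_trans (pL _ _ _)); rewrite addrAC subrr add0r.
Qed.

Section borel.
Variables (u1 u2 rho : R * R -> R) (M L : R).
Hypothesis sd : stream_data u1 u2 rho M L.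
Variables (C : R) (phi phix phiy : R * R -> R).
Hypothesis adm : admissible C phi phix phiy.
Let fl := flux_density u1 u2 phix phiy.

Lemma measurable_phix : measurable_fun [set: mR * mR] (phix : mR * mR -> R).
Proof.
have [_ [_ m _ _ _]] := adm; have := measurable_swp m.
by have -> : (phix \o swp) \o swp = phix by apply/funext => z /=; rewrite swpK.
Qed.

Lemma flux_density_intg : intg mu2 fl.
Proof.
have [[_ mphiy _ _ _] _] := adm; have mphix := measurable_phix.
have [mu1 _ _ _] := sd_u1 sd; have [mu2' _ _ _] := sd_u2 sd.
have iu2 : intg mu2 (fun z => u2 (swp z)) := mpres_intg swap_mpres (regular_intg (sd_u2 sd)).
have C0 : 0 <= C by have [[_ _ /(_ (0, 0)) + _ _] _] := adm; apply: le_trans.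
apply: (@intg_le_ae _ (mR * mR)%type R mu2 _ (fun z => C * (`|u1 z| + `|u2 (swp z)|))).
- apply: measurable_funB; apply: measurable_funM => //.
  exact: measurable_swp.
- apply: (ae_mono2 (yreg_der_bound adm.1) (mpres_ae swap_mpres (yreg_der_bound adm.2))) => z b1 b2.
  rewrite /fl /flux_density (le_trans (ler_normB _ _))// mulrDr !normrM.
  move: b2; rewrite /= swpK => b2.
  by rewrite !(mulrC C); apply: lerD; apply: ler_wpM2l.
- by apply: intgZ; apply: intgD; apply: intg_norm => //; exact: regular_intg (sd_u1 sd).
Qed.

Let limit_flux (f_ g_ : nat -> R -> R) (f g : R -> R) :
  (forall n, exists C' f', lipschitz_derivable C' (f_ n) f') ->
  (forall n, exists C' f', lipschitz_derivable C' (g_ n) f') ->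
  (forall n x, `|f_ n x| <= 1) -> (forall n x, `|g_ n x| <= 1) ->
  (forall x, f_ n x @[n --> \oo] --> f x) -> (forall x, g_ n x @[n --> \oo] --> g x) ->
  measurable_fun [set: R] f -> measurable_fun [set: R] g ->
  \int[mu2]_z (f (stream_v u1 z) * (g (stream_rhov u1 rho z) * fl z)) = 0.
Proof.
move=> rf rg f1 g1 cf cg mf mg.
have mH := measurable_stream_v sd; have mG := measurable_stream_rhov sd.
pose F_ n (z : mR * mR) := f_ n (stream_v u1 z) * g_ n (stream_rhov u1 rho z) * fl z.
have F0 n : \int[mu2]_z F_ n z = 0.
  have [C1 [f' r1]] := rf n; have [C2 [g' r2]] := rg n.
  pose C' := Num.max C (Num.max C1 C2).
  have CC' : C <= C' by rewrite le_max lexx.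
  have C1C' : C1 <= C' by rewrite !le_max lexx orbT.
  have C2C' : C2 <= C' by rewrite !le_max lexx !orbT.
  exact: (stream_weighted_flux sd (admissible_le CC' adm)
    (lipschitz_derivable_le C1C' r1) (lipschitz_derivable_le C2C' r2)).
have mF n : measurable_fun [set: mR * mR] (F_ n).
  have [C1 [f' r1]] := rf n; have [C2 [g' r2]] := rg n.
  apply: measurable_funM; last exact: intg_meas flux_density_intg.
  apply: measurable_funM.
    exact: (measurableT_comp (derivable_measurable r1) mH).
  exact: (measurableT_comp (derivable_measurable r2) mG).
have [|||||_] := @dominated_cvg _ _ R mu2 F_ (fun z => f (stream_v u1 z) * (g (stream_rhov u1 rho z) * fl z))
   (fun z => `|fl z|).
- exact: mF.
- apply: measurable_funM; first exact: (measurableT_comp mf mH).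
  apply: measurable_funM; first exact: (measurableT_comp mg mG).
  exact: intg_meas flux_density_intg.
- apply: aeW => z; rewrite mulrA; apply: cvgM; last exact: cvg_cst.
  exact: cvgM.
- exact: intg_norm flux_density_intg.
- apply: aeW => z n; rewrite !normrM -[leRHS]mul1r ler_wpM2r//.
  by rewrite -[leRHS]mul1r ler_pM.
- have E : (fun n => \int[mu2]_z F_ n z) = (fun=> 0) by apply/funext => n; exact: F0.
  rewrite -[X in X --> _]/((fun n => \int[mu2]_z F_ n z) @ \oo) E => c.
  exact: (cvg_unique (@Rhausdorff R) c (cvg_cst _)).
Qed.

Let ray_ind (c h : R) : \1_(`]c, +oo[%classic) h = (c < h)%R%:R :> R.
Proof. by rewrite indicE mem_setE in_itv/= andbT. Qed.

Let steps_r (c : R) n : exists C' f', lipschitz_derivable C' (@steps R c n) f'.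
Proof. by eexists; eexists; exact: steps_reg. Qed.

Let cst_r (n : nat) : exists C' f', lipschitz_derivable C' (cst 1 : R -> R) f'.
Proof. by exists 1, (cst 0); exact: cst_reg. Qed.

Let cst_n (n : nat) (x : R) : `|(cst 1 : R -> R) x| <= 1.
Proof. by rewrite /= normr1. Qed.

Let cst_c (x : R) : (cst 1 : R -> R) x @[_ --> \oo] --> (cst 1 : R -> R) x.
Proof. exact: cvg_cst. Qed.

Definition Phi (z : R * R) : R * R := (stream_v u1 z, stream_rhov u1 rho z).

Lemma measurable_Phi : measurable_fun [set: mR * mR] (Phi : mR * mR -> mR * mR).
Proof.
by apply: measurable_fun_pair; [exact: measurable_stream_v sd|exact: measurable_stream_rhov sd].
Qed.

(** Products of logistic steps converge to the indicator of a quadrant, which settles quadrants by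
    dominated convergence. The integral is a finite signed measure in [S], and quadrants form a
    generating pi-system. *)
Theorem borel_flux (S : set (mR * mR)) : measurable S ->
  \int[mu2]_z (\1_S (Phi z) * fl z) = 0.
Proof.
have ind (o : option rat) : exists f_ : nat -> R -> R,
  [/\ forall n, exists C' f', lipschitz_derivable C' (f_ n) f',
      forall n x, `|f_ n x| <= 1,
      forall x, f_ n x @[n --> \oo] --> (\1_(@oray R o) x : R) &
      measurable_fun [set: R] (\1_(@oray R o) : R -> R)].
  case: o => [q|].
    exists (@steps R (ratr q)); split.
    - exact: steps_r.
    - exact: steps_norm.
    - by move=> x; rewrite ray_ind; exact: steps_cvg.
    - by apply: measurable_indic; exact: measurable_itv.
  exists (fun=> cst 1); split.
  - exact: cst_r.
  - exact: cst_n.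
  - by move=> x; rewrite indicT; exact: cst_c.
  - by apply: measurable_indic; exact: measurableT.
apply: (quadrant_lambda_zero (integral_additive measurable_Phi flux_density_intg)).
move=> o1 o2; have [f_ [f1 f2 f3 f4]] := ind o1; have [g_ [g1 g2 g3 g4]] := ind o2.
rewrite -[RHS](limit_flux f1 g1 f2 g2 f3 g3 f4 g4).
apply: Rint_eq => z; rewrite mulrA; congr (_ * _).
by rewrite !indicE in_setX/=; case: (_ \in _); case: (_ \in _); rewrite /= ?mulr1 ?mulr0.
Qed.

End borel.
End borel_flux.

(** * Restriction to vertical lines *)

Section density_arguments.
Context {R : realType}.
Notation mR := (measurableTypeR R).
Notation mu := (@lebesgue_measure R).
Notation mu2 := (lebesgue2 R).

Lemma ae_countable d (T : measurableType d) (m : {measure set T -> \bar R})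
    (I : countType) (P : I -> T -> Prop) :
  (forall i, {ae m, forall x, P i x}) -> {ae m, forall x, forall i, P i x}.
Proof.
move=> aP.
have : {ae m, forall x, forall n, if unpickle n is Some i then P i x else True}.
  by apply/ae_foralln => n; case: unpickle => [i|]; [exact: aP|exact: aeW].
by move=> H; apply: (ae_mono H) => x /= Hx i; have := Hx (pickle i); rewrite pickleK.
Qed.

Lemma ae_dense (P : R -> Prop) : {ae mu, forall t : mR, P t} ->
  forall a b : R, a < b -> exists2 t, a < t < b & P t.
Proof.
move=> [N [mN N0 PN]] a b ab; apply: contrapT => nP.
have : (mu (`]a, b[%classic : set mR) <= mu N)%E.
  apply: le_measure; rewrite ?inE//.
  move=> t /=; rewrite in_itv/= => tab; apply: PN => /= Pt; apply: nP.
  by exists t.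
by rewrite N0 lebesgue_measure_itv/= lte_fin ab -EFinB lee_fin leNgt subr_gt0 ab.
Qed.

(** Every t is a limit of points of [D] strictly to its right, and the closed rays starting there
    converge pointwise to the open ray starting at t. *)
Lemma dense_rays d (T : measurableType d) (m : {measure set T -> \bar R})
    (X g : T -> R) (D : set R) :
  measurable_fun setT X -> intg m g ->
  (forall a b : R, a < b -> exists2 t, a < t < b & D t) ->
  (forall s, D s -> \int[m]_x (\1_(`[s, +oo[%classic) (X x) * g x) = 0) ->
  forall t, \int[m]_x (\1_(`]t, +oo[%classic) (X x) * g x) = 0.
Proof.
move=> mX ig dD D0 t.
have seqP n : exists s, t < s < t + n.+1%:R^-1 /\ D s.
  have [|s ts Ds] := dD t (t + n.+1%:R^-1); first by rewrite ltrDl invr_gt0.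
  by exists s.
pose s n := sval (cid (seqP n)).
have sP n : t < s n < t + n.+1%:R^-1 /\ D (s n) by rewrite /s; case: cid.
have mI (A : set mR) : measurable A -> measurable_fun setT (fun x => \1_A (X x) : R).
  move=> mA; have mA1 : measurable_fun [set: mR] (\1_A : mR -> R) by exact: measurable_indic.
  exact: (measurableT_comp mA1 mX).
have [|||||_ c] := @dominated_cvg _ _ R m (fun n x => \1_(`[s n, +oo[%classic) (X x) * g x)
    (fun x => \1_(`]t, +oo[%classic) (X x) * g x) (fun x => `|g x|).
- move=> n; apply: measurable_funM; last exact: (intg_meas ig).
  by apply: mI; exact: measurable_itv.
- apply: measurable_funM; last exact: (intg_meas ig).
  by apply: mI; exact: measurable_itv.
- apply: aeW => x; apply: cvgM; last exact: cvg_cst.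
  have [tx|xt] := ltP t (X x).
    apply: cvg_near_cst.
    have e0 : 0 < X x - t by rewrite subr_gt0.
    have /cvgrPdist_lt /(_ _ e0) := @cvg_harmonic R.
    apply: filterS => n; rewrite sub0r normrN ger0_norm /harmonic/= ?invr_ge0// => hn.
    rewrite !indicE !mem_setE !in_itv/= !andbT tx.
    have [/andP[_ sn] _] := sP n.
    by rewrite (ltW (lt_trans sn _))// -ltrBrDl.
  apply: cvg_near_cst; apply: nearW => n.
  rewrite !indicE !mem_setE !in_itv/= !andbT.
  have [/andP[ts _] _] := sP n.
  by rewrite !leNgt (le_lt_trans xt ts) ltNge xt.
- exact: intg_norm.
- apply: aeW => x n; rewrite normrM indicE.
  by case: (_ \in _); rewrite ?normr1 ?normr0 ?mul1r ?mul0r.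
apply: (cvg_unique (@Rhausdorff R) c).
have -> : (fun n => \int[m]_x (\1_(`[s n, +oo[%classic) (X x) * g x)) = cst 0.
  by apply/funext => n; apply: D0; have [] := sP n.
exact: cvg_cst.
Qed.

Lemma interval_zero (f : R -> R) : measurable_fun [set: mR] (f : mR -> R) ->
  (forall N : nat, intg mu (fun x => \1_(`]- N%:R, N%:R[%classic) x * f x)) ->
  (forall p q : rat, \int[mu]_x (\1_(`]ratr p, ratr q[%classic) x * f x) = 0) ->
  {ae mu, forall x : mR, f x = 0}.
Proof.
move=> mf fN f0.
have intv p N x : \1_(`]ratr p, +oo[%classic : set R) x * (\1_(`]- N%:R, N%:R[%classic) x * f x)
    = \1_(`]ratr (Num.max p (- N%:R)), ratr N%:R[%classic : set R) x * f x.
  rewrite mulrA; congr (_ * _).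
  rewrite !indicE !mem_setE !in_itv/= andbT ratr_nat.
  have -> : (ratr (Num.max p (- N%:R)) < x) = (ratr p < x) && (- N%:R < x).
    have [pN|Np] := leP p (- N%:R).
      rewrite rmorphN/= ratr_nat; have [Nx|] := boolP (- N%:R < x); last by rewrite andbF.
      rewrite andbT; apply/esym/(le_lt_trans _ Nx).
      by rewrite -(ratr_nat R) -rmorphN/= ler_rat.
    have [px|] := boolP (ratr p < x) => //=; apply/esym/(lt_trans _ px).
    by rewrite -(ratr_nat R) -rmorphN/= ltr_rat.
  by case: (ratr p < x); case: (- N%:R < x); case: (x < N%:R); rewrite /= ?mulr1 ?mulr0 ?mul0r.
have N0 N : {ae mu, forall x : mR, \1_(`]- N%:R, N%:R[%classic) x * f x = 0}.
  apply: (Rint_sets0 (fN N)).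
  apply: (ray_lambda_zero (integral_additive (@measurable_id _ mR setT) (fN N))).
  - rewrite -[RHS](f0 (- N%:R) N%:R); apply: Rint_eq => x.
    by rewrite indicT mul1r rmorphN/= ratr_nat.
  - by move=> q; rewrite -[RHS](f0 (Num.max q (- N%:R)) N%:R); apply: Rint_eq => x; exact: intv.
apply: (ae_mono (ae_countable N0)) => x /= H.
pose N := (Num.trunc `|x|).+1.
have xN : `|x| < N%:R by have /Num.Theory.trunc_itv/andP[] := normr_ge0 x.
have := H N; rewrite indicE mem_set ?mul1r//= in_itv/=.
by move: xN; rewrite ltr_norml.
Qed.

(** The derivative is an interval indicator, so a ramp in one variable integrates a flux over an
    interval of lines. A ramp stays constant past [q] and is not compactly supported; it is only
    tested against fields of bounded support. *)
Definition ramp (p q : R) : R -> R := prim1 (\1_(`]p, q[%classic)).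

Lemma itvoo_intg (p q : R) : intg mu (\1_(`]p, q[%classic)).
Proof. exact: integrable_indic_itv. Qed.

Lemma indic_norm1 (T : Type) (A : set T) x : `|\1_A x : R| <= 1.
Proof. by rewrite indicE; case: (_ \in _); rewrite ?normr1 ?normr0. Qed.

Lemma ramp_bound p q y : `|ramp p q y| <= \int[mu]_s \1_(`]p, q[%classic) s.
Proof.
apply: (le_trans (prim1_bound _ (itvoo_intg _ _))).
rewrite le_eqVlt; apply/orP; left; apply/eqP; apply: Rint_eq => s.
by rewrite ger0_norm// indicE.
Qed.

Lemma ramp_lip p q y y' : `|ramp p q y' - ramp p q y| <= `|y' - y|.
Proof.
wlog yy : y y' / y <= y'.
  move=> W; have [yy|/ltW yy] := leP y y'; first exact: W.
  by rewrite distrC (distrC y'); exact: W.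
have h0 : 0 <= y' - y by rewrite subr_ge0.
have := prim1_sub y (itvoo_intg p q) h0; rewrite subrKC -/(ramp p q) => ->.
have iI := indic_itv_intg y y'.
have iP : intg mu (fun s => \1_(`]y, y']) s * \1_(`]p, q[%classic) s).
  by apply: intg_indic; [exact: measurable_itv|exact: itvoo_intg].
apply: (le_trans (Rint_norm_le iP)); rewrite (ger0_norm h0) -Rint_indic_itv//.
apply: Rint_le => //; first exact: intg_norm.
move=> s; rewrite normrM -[leRHS]mulr1 ler_pM// ?indic_norm1//.
by rewrite ger0_norm// indicE.
Qed.

Lemma lebesgue2X (A B : set mR) : measurable A -> measurable B ->
  mu2 (A `*` B) = (mu A * mu B)%E.
Proof. by move=> mA mB; exact: (@product_measure1E _ _ mR mR R mu mu A B). Qed.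

Lemma ae_snd (P : R -> Prop) : {ae mu, forall y : mR, P y} ->
  {ae mu2, forall z : mR * mR, P z.2}.
Proof.
move=> [N [mN N0 PN]]; exists (setT `*` N); split.
- exact: measurableX.
- by rewrite lebesgue2X// N0 mule0.
- by move=> z /= nP; split=> //; apply: PN.
Qed.

Lemma yreg_tensor (A B : R) (a b b' : R -> R) :
  measurable_fun [set: mR] (a : mR -> R) -> (forall x, `|a x| <= A) ->
  measurable_fun [set: mR] (b : mR -> R) -> (forall y, `|b y| <= B) ->
  measurable_fun [set: mR] (b' : mR -> R) ->
  (forall y y', `|b y' - b y| <= `|y' - y|) ->
  {ae mu, forall y : mR, is_derive (y : R) 1 b (b' y)} ->
  yreg (A * B + A) (fun z => a z.1 * b z.2) (fun z => a z.1 * b' z.2).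
Proof.
move=> ma aA mb bB mb' bL db.
have A0 : 0 <= A by exact: le_trans (aA 0).
have B0 : 0 <= B by exact: le_trans (bB 0).
split.
- by apply: measurable_funM; [exact: (measurableT_comp ma measurable_fst)|
    exact: (measurableT_comp mb measurable_snd)].
- by apply: measurable_funM; [exact: (measurableT_comp ma measurable_fst)|
    exact: (measurableT_comp mb' measurable_snd)].
- by move=> z; rewrite normrM (@le_trans _ _ (A * B))// ?ler_pM// lerDl.
- move=> x y y' /=; rewrite -mulrBr normrM ler_pM// (le_trans (aA _))// lerDr mulr_ge0//.
- apply: (ae_mono (ae_snd db)) => z /= d.
  exact: (@is_deriveZ R _ _ b (a z.1) z.2 1 _ d).
Qed.

Definition ramp_fn (p q p' q' : R) (z : R * R) : R := ramp p q z.1 * ramp p' q' z.2.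

Lemma ramp_admissible p q p' q' : exists C, admissible C (ramp_fn p q p' q')
  (fun z => \1_(`]p, q[%classic) z.1 * ramp p' q' z.2)
  (fun z => ramp p q z.1 * \1_(`]p', q'[%classic) z.2).
Proof.
set A := \int[mu]_s (\1_(`]p, q[%classic) s : R).
set B := \int[mu]_s (\1_(`]p', q'[%classic) s : R).
have mr a b : measurable_fun [set: mR] (ramp a b : mR -> R).
  exact: measurable_prim1 (itvoo_intg a b).
have mi a b : measurable_fun [set: mR] (\1_(`]a, b[%classic) : mR -> R).
  exact: intg_meas (itvoo_intg a b).
exists (Num.max (A * B + A) (B * A + B)); split.
- apply: (@yreg_le _ (A * B + A)); first by rewrite le_max lexx.
  apply: yreg_tensor => //; [exact: ramp_bound|exact: ramp_bound|exact: ramp_lip|].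
  exact: prim1_derive (itvoo_intg _ _).
- apply: (@yreg_le _ (B * A + B)); first by rewrite le_max lexx orbT.
  have -> : ramp_fn p q p' q' \o swp = fun z => ramp p' q' z.1 * ramp p q z.2.
    by apply/funext => z; rewrite /ramp_fn/= mulrC.
  have -> : (fun z => \1_(`]p, q[%classic) z.1 * ramp p' q' z.2) \o swp =
      fun z => ramp p' q' z.1 * \1_(`]p, q[%classic) z.2.
    by apply/funext => z /=; rewrite mulrC.
  apply: yreg_tensor => //; [exact: ramp_bound|exact: ramp_bound|exact: ramp_lip|].
  exact: prim1_derive (itvoo_intg _ _).
Qed.

Section lines.
Variables (u1 u2 rho : R * R -> R) (M L : R).
Hypothesis sd : stream_data u1 u2 rho M L.

Notation Phi := (Phi u1 rho).

Let mPhi : measurable_fun [set: mR * mR] (Phi : mR * mR -> mR * mR) := measurable_Phi sd.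
Let mi (a b : R) : measurable_fun [set: mR] (\1_(`]a, b[%classic) : mR -> R) :=
  intg_meas (itvoo_intg a b).
Let mr (a b : R) : measurable_fun [set: mR] (ramp a b : mR -> R) :=
  measurable_prim1 (itvoo_intg a b).

(* the flux through the line [x = t] carried by [Phi^-1(S)], weighted by a ramp *)
Definition line_flux (p q : R) (S : set (mR * mR)) (t : R) : R :=
  \int[mu]_y (\1_S (Phi (t, y)) * (u1 (t, y) * ramp p q y)).

(** The value that the divergence theorem on the half-plane to the right of x = t predicts for
    [line_flux], the test function being the ramp in the second coordinate. *)
Definition half_plane_flux (p q : R) (S : set (mR * mR)) (t : R) : R :=
  \int[mu2]_z (\1_S (Phi z) * (\1_(`[t, +oo[%classic) z.1 *
     (u2 (swp z) * \1_(`]p, q[%classic) z.2))).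

Let iu2s : intg mu2 (fun z => u2 (swp z)) := mpres_intg swap_mpres (regular_intg (sd_u2 sd)).

Lemma u2_strip_intg p q : intg mu2 (fun z => u2 (swp z) * \1_(`]p, q[%classic) z.2).
Proof.
apply: (intg_mulb (C := 1) iu2s); last by move=> z; exact: indic_norm1.
exact: (measurableT_comp (mi p q) measurable_snd).
Qed.

Lemma half_plane_indic t (g : R * R -> R) : intg mu2 g ->
  intg mu2 (fun z => \1_(`[t, +oo[%classic) z.1 * g z).
Proof.
move=> ig; apply: (@intg_indic _ _ _ mu2 g (fst @^-1` (`[t, +oo[%classic : set mR))) => //.
by rewrite -[X in measurable X]setTI; apply: measurable_fst.
Qed.

Lemma line_intg p q t : intg mu (fun y => u1 (t, y) * ramp p q y).
Proof.
apply: (intg_mulb (C := \int[mu]_s \1_(`]p, q[%classic) s)); last exact: ramp_bound.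
  exact: (regular_slice (sd_u1 sd)).
exact: mr.
Qed.

Lemma mPhi_slice t : measurable_fun [set: mR] (fun y : mR => Phi (t, y) : mR * mR).
Proof. exact: (measurableT_comp mPhi (measurable_pair1 t)). Qed.

(** Testing [borel_flux] with a product of two ramps shows that both fluxes have the same integral
    over every rational interval of lines. *)
Lemma line_flux_ae p q S : measurable S ->
  {ae mu, forall t : mR, line_flux p q S t = half_plane_flux p q S t}.
Proof.
move=> mS.
pose k z := \1_S (Phi z) * (u1 z * ramp p q z.2).
pose n z := \1_S (Phi z) * (u2 (swp z) * \1_(`]p, q[%classic) z.2).
have mP : measurable (Phi @^-1` S) by rewrite -[X in measurable X]setTI; exact: mPhi.
have mr2 : measurable_fun [set: mR * mR] (fun z : mR * mR => ramp p q z.2 : R).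
  exact: (measurableT_comp (mr p q) measurable_snd).
have ik : intg mu2 k.
  apply: (@intg_indic _ _ _ mu2 _ (Phi @^-1` S)) => //.
  apply: (intg_mulb (C := \int[mu]_s \1_(`]p, q[%classic) s)) => //.
    exact: regular_intg (sd_u1 sd).
  by move=> z; exact: ramp_bound.
have in_ : intg mu2 n.
  by apply: (@intg_indic _ _ _ mu2 _ (Phi @^-1` S)) => //; exact: u2_strip_intg.
have [ikx _] := Rint_fubini ik; have [inx _] := Rint_fubini in_.
pose m x := \int[mu]_y n (x, y).
have hpE t : half_plane_flux p q S t = \int[mu]_x (\1_(`[t, +oo[%classic) x * m x).
  rewrite /half_plane_flux.
  have i1 := half_plane_indic t in_.
  transitivity (\int[mu2]_z (\1_(`[t, +oo[%classic) z.1 * n z)).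
    by apply: Rint_eq => z; rewrite /n mulrCA.
  have [_ ->] := Rint_fubini i1.
  apply: (Rint_ae (m := mu)).
  + exact: (measurable_Rint (intg_meas i1)).
  + apply: measurable_funM; last exact: intg_meas inx.
    by apply: measurable_indic; exact: measurable_itv.
  + by apply: (ae_mono (intg_slices in_)) => x ix; rewrite /= /m -RintZ.
have mhp : measurable_fun [set: mR] (half_plane_flux p q S : mR -> R).
  have -> : half_plane_flux p q S = fun t => \int[mu]_x (\1_(`[t, +oo[%classic) x * m x).
    exact/funext.
  apply: (@measurable_Rint R _ mR (fun z => \1_(`[z.1, +oo[%classic) z.2 * m z.2)).
  apply: measurable_funM; last exact: (measurableT_comp (intg_meas inx) measurable_snd).
  have -> : (fun z : mR * mR => \1_(`[z.1, +oo[%classic) z.2 : R) =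
      \1_[set z : mR * mR | (z.1 : R) <= z.2].
    by apply/funext => z; rewrite !indicE !mem_setE in_itv/= andbT; congr (_%:R);
      congr nat_of_bool; apply/idP/idP; rewrite inE.
  apply: measurable_indic; rewrite -[X in measurable X]setTI.
  by apply: measurable_fun_le.
have hpb t : `|half_plane_flux p q S t| <= \int[mu]_x `|m x|.
  rewrite hpE.
  have i1 : intg mu (fun x => \1_(`[t, +oo[%classic) x * m x).
    by apply: intg_indic => //; exact: measurable_itv.
  apply: (le_trans (Rint_norm_le i1)); apply: Rint_le; [exact: intg_norm|exact: intg_norm|].
  by move=> x; rewrite normrM -[leRHS]mul1r ler_wpM2r// indic_norm1.
have mlf : measurable_fun [set: mR] (line_flux p q S : mR -> R) := intg_meas ikx.
have hpi a b : intg mu (fun t => \1_(`]a, b[%classic) t * half_plane_flux p q S t).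
  exact: (intg_mulb (C := \int[mu]_x `|m x|) (itvoo_intg a b)).
have lfi a b : intg mu (fun t => \1_(`]a, b[%classic) t * line_flux p q S t).
  by apply: intg_indic => //; exact: measurable_itv.
suff H : {ae mu, forall t : mR, line_flux p q S t - half_plane_flux p q S t = 0}.
  by apply: (ae_mono H) => t /eqP; rewrite subr_eq0 => /eqP.
apply: interval_zero.
- exact: measurable_funB.
- move=> N; under eq_fun do rewrite mulrBr.
  by apply: intgB.
move=> a b; under Rint_eq do rewrite mulrBr.
rewrite RintB//; set a' := ratr a; set b' := ratr b.
have [C adm] := ramp_admissible a' b' p q.
have := borel_flux sd adm mS.
(* Fubini turns the flux identity into its integral over a' < t < b' *)
pose k1 z := \1_(`]a', b'[%classic) z.1 * k z.
pose n1 z := ramp a' b' z.1 * n z.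
have ik1 : intg mu2 k1.
  apply: (@intg_indic _ _ _ mu2 k (fst @^-1` (`]a', b'[%classic : set mR))) => //.
  by rewrite -[X in measurable X]setTI; apply: measurable_fst.
have in1 : intg mu2 n1.
  rewrite /n1; under eq_fun do rewrite mulrC.
  apply: (intg_mulb (C := \int[mu]_s \1_(`]a', b'[%classic) s)) => //.
    exact: (measurableT_comp (mr a' b') measurable_fst).
  by move=> z; exact: ramp_bound.
have -> : \int[mu2]_z (\1_S (Phi z) * flux_density u1 u2
      (fun z => \1_(`]a', b'[%classic) z.1 * ramp p q z.2)
      (fun z => ramp a' b' z.1 * \1_(`]p, q[%classic) z.2) z) =
    \int[mu2]_z k1 z - \int[mu2]_z n1 z.
  by rewrite -RintB//; apply: Rint_eq => z; rewrite /flux_density /k1 /n1 /k /n; ring.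
have -> : \int[mu2]_z k1 z = \int[mu]_t (\1_(`]a', b'[%classic) t * line_flux p q S t).
  have [_ ->] := Rint_fubini ik1; apply: (Rint_ae (m := mu)).
  + exact: (measurable_Rint (intg_meas ik1)).
  + exact: intg_meas (lfi _ _).
  + by apply: (ae_mono (intg_slices ik)) => x ix; rewrite /= /line_flux -RintZ.
suff -> : \int[mu2]_z n1 z = \int[mu]_t (\1_(`]a', b'[%classic) t * half_plane_flux p q S t).
  by [].
transitivity (\int[mu]_x (ramp a' b' x * m x)).
  have [_ ->] := Rint_fubini in1; apply: (Rint_ae (m := mu)).
  + exact: (measurable_Rint (intg_meas in1)).
  + by apply: measurable_funM; [exact: mr|exact: intg_meas inx].
  + by apply: (ae_mono (intg_slices in_)) => x ix; rewrite /= /m -RintZ.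
(* The ramp at x is the integral over a' < t < b' of the indicator of t <= x. Exchanging the
   integrals in t and x turns the weighted integral of [m] into an integral of half-plane fluxes. *)
pose j (z : mR * mR) := \1_(`]a', b'[%classic) z.1 * (\1_(`[z.1, +oo[%classic) z.2 * m z.2).
have mj : measurable_fun [set: mR * mR] j.
  apply: measurable_funM; first exact: (measurableT_comp (mi a' b') measurable_fst).
  apply: measurable_funM; last exact: (measurableT_comp (intg_meas inx) measurable_snd).
  have -> : (fun z : mR * mR => \1_(`[z.1, +oo[%classic) z.2 : R) =
      \1_[set z : mR * mR | (z.1 : R) <= z.2].
    by apply/funext => z; rewrite !indicE !mem_setE in_itv/= andbT; congr (_%:R);
      congr nat_of_bool; apply/idP/idP; rewrite inE.
  apply: measurable_indic; rewrite -[X in measurable X]setTI.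
  by apply: measurable_fun_le.
have ray_m t : intg mu (fun x => \1_(`[t, +oo[%classic) x * m x).
  by apply: intg_indic => //; exact: measurable_itv.
have ij : intg mu2 j.
  pose j0 (z : mR * mR) := \1_(`]a', b'[%classic) z.1 * m z.2.
  have mj0 : measurable_fun [set: mR * mR] j0.
    apply: measurable_funM; first exact: (measurableT_comp (mi a' b') measurable_fst).
    exact: (measurableT_comp (intg_meas inx) measurable_snd).
  apply: (@intg_le _ (mR * mR)%type R mu2 _ (fun z => `|j0 z|)) => //.
    move=> z; rewrite /j /j0 mulrCA normrM -[leRHS]mul1r ler_wpM2r// indic_norm1//.
  apply: intg_norm; apply: intg_tonelli => //.
    by apply: aeW => t; rewrite /j0 /=; apply: (intgZ _ inx).
  have -> : (fun t => \int[mu]_y `|j0 (t, y)|) =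
      fun t => (\int[mu]_x `|m x|) * \1_(`]a', b'[%classic) t.
    apply/funext => t; rewrite mulrC -RintZ; last exact: intg_norm.
    by apply: Rint_eq => y; rewrite /j0 normrM ger0_norm// indicE.
  by apply: intgZ; exact: itvoo_intg.
have -> : \int[mu]_t (\1_(`]a', b'[%classic) t * half_plane_flux p q S t) = \int[mu2]_z j z.
  have [_ ->] := Rint_fubini ij.
  by apply: Rint_eq => t; rewrite hpE -RintZ.
have ijs := mpres_intg swap_mpres ij.
rewrite -(mpres_Rint swap_mpres mj).
have [_ ->] := Rint_fubini ijs.
apply: Rint_eq => x; rewrite /ramp /prim1 Rint_in mulrC -RintZ; last first.
  by apply: intg_indic; [exact: measurable_itv|exact: itvoo_intg].
apply: Rint_eq => s; rewrite /j/=.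
have -> : \1_(`]-oo, x]) s = \1_(`[s, +oo[%classic) x :> R.
  by rewrite !indicE !mem_setE !in_itv/= andbT.
by rewrite mulrC mulrAC mulrC mulrA mulrC.
Qed.

End lines.

End density_arguments.

(** * Sets of values that are null on a dense family of lines *)

Section lines_null.
Context {R : realType}.
Notation mR := (measurableTypeR R).
Notation mu := (@lebesgue_measure R).
Notation mu2 := (lebesgue2 R).
Variables (u1 u2 rho : R * R -> R) (M L : R).
Hypothesis sd : stream_data u1 u2 rho M L.

Notation Phi := (Phi u1 rho).
Let mPhi : measurable_fun [set: mR * mR] (Phi : mR * mR -> mR * mR) := measurable_Phi sd.
Let iu2s : intg mu2 (fun z => u2 (swp z)) := mpres_intg swap_mpres (regular_intg (sd_u2 sd)).

(** The quantifier over [S] stands inside: later [S] is built from the very lines on which it is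
    tested, so the exceptional lines must not depend on it. *)
Definition good_line (t : R) := forall (p q : rat) (S : set (mR * mR)), measurable S ->
  line_flux u1 rho (ratr p) (ratr q) S t = half_plane_flux u1 u2 rho (ratr p) (ratr q) S t.

(** One null set serves all rational weights and all rational quadrants. On a line outside it the
    difference of the two fluxes is a signed measure in [S] that vanishes on quadrants, hence on all
    Borel sets. *)
Lemma ae_good_line : {ae mu, forall t : mR, good_line t}.
Proof.
have H : {ae mu, forall t : mR, forall i : (rat * rat) * (option rat * option rat),
    line_flux u1 rho (ratr i.1.1) (ratr i.1.2) (oray i.2.1 `*` oray i.2.2) t =
    half_plane_flux u1 u2 rho (ratr i.1.1) (ratr i.1.2) (oray i.2.1 `*` oray i.2.2) t}.
  apply: ae_countable => -[[p q] [r1 r2]] /=.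
  by apply: (line_flux_ae sd); apply: measurableX; exact: measurable_oray.
apply: (ae_mono H) => t Ht p q S mS; apply/eqP; rewrite -subr_eq0; apply/eqP; move: S mS.
apply: (quadrant_lambda_zero (A := fun S => line_flux u1 rho (ratr p) (ratr q) S t -
  half_plane_flux u1 u2 rho (ratr p) (ratr q) S t)).
- apply: signed_additiveB.
    exact: (integral_additive (mPhi_slice sd t) (line_intg sd _ _ t)).
  exact: (integral_additive mPhi (half_plane_indic t (u2_strip_intg sd _ _))).
- by move=> o1 o2; rewrite (Ht ((p, q), (o1, o2))) subrr.
Qed.

Section null.
Variables (S : set (mR * mR)) (D : set R).
Hypothesis mS : measurable S.
Hypothesis dD : forall a b : R, a < b -> exists2 t, a < t < b & D t.
Hypothesis Dgood : forall t, D t -> good_line t.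
Hypothesis Dnull : forall t, D t -> {ae mu, forall y : mR, S (Phi (t, y)) -> u1 (t, y) = 0}.

Let N : nat := (Num.trunc `|M|).+1.
Let MN : M < N%:R.
Proof.
apply: le_lt_trans (ler_norm M) _.
by have /Num.Theory.trunc_itv/andP[] := normr_ge0 M.
Qed.

Let mSPhi : measurable (Phi @^-1` S).
Proof. by rewrite -[X in measurable X]setTI; exact: mPhi. Qed.

(** Rays become bounded rational intervals, the weights that [good_line] speaks of; the part cut off
    lies where [f] vanishes, since [N] exceeds [M]. *)
Let strip_ray (f : R -> R) r y : (M < `|y| -> f y = 0) ->
  \1_(oray r) y * f y = \1_(`]ratr (if r is Some q then q else - N%:R), ratr (N%:R : rat)[%classic) y * f y.
Proof.
move=> f0; have [yM|yM] := ltP M `|y|; first by rewrite f0// !mulr0.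
congr (_ * _); rewrite !indicE ratr_nat.
have yN : `|y| < N%:R by exact: le_lt_trans yM MN.
move: yN; rewrite ltr_norml => /andP[y1 y2].
case: r => [q|] /=.
  by rewrite !mem_setE !in_itv/= andbT y2 andbT.
by rewrite in_setT mem_setE in_itv/= y2 rmorphN/= ratr_nat y1.
Qed.

(** On a line of [D] the line flux vanishes by [Dnull], hence so does the half-plane flux. The
    latter, unlike the former, passes to the limit in t, so density of [D] is enough. *)
Lemma half_plane_flux0 (p q : rat) t :
  \int[mu2]_z (\1_(`]t, +oo[%classic) z.1 * (\1_S (Phi z) *
     (u2 (swp z) * \1_(`]ratr p, ratr q[%classic) z.2))) = 0.
Proof.
apply: (dense_rays (D := D)) => //.
- exact: (@intg_indic _ _ _ mu2 _ (Phi @^-1` S) mSPhi (u2_strip_intg sd _ _)).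
- move=> s Ds.
  transitivity (half_plane_flux u1 u2 rho (ratr p) (ratr q) S s).
    by apply: Rint_eq => z; rewrite mulrCA.
  rewrite -(Dgood Ds)// /line_flux -[RHS](Rint_cst0 mu).
  apply: Rint_ae => //.
    apply: measurable_funM; last exact: intg_meas (line_intg sd _ _ s).
    have mS1 : measurable_fun [set: mR * mR] (\1_S : mR * mR -> R).
      exact: measurable_indic.
    exact: (measurableT_comp mS1 (mPhi_slice sd s)).
  apply: (ae_mono (Dnull Ds)) => y; rewrite indicE.
  by case: (boolP (_ \in S)); rewrite ?mul0r// inE => Sy /(_ Sy) ->; rewrite mul0r mulr0.
Qed.

(** Within the support every rational quadrant is a half-plane cut by a horizontal strip, so the
    vanishing half-plane fluxes determine the signed measure with this density. *)
Lemma null_horizontal : {ae mu2, forall z : mR * mR, \1_S (Phi z) * u2 (swp z) = 0}.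
Proof.
have ih : intg mu2 (fun z => \1_S (Phi z) * u2 (swp z)).
  exact: (@intg_indic _ _ _ mu2 _ (Phi @^-1` S)).
apply: (Rint_sets0 ih).
apply: (quadrant_lambda_zero (integral_additive (@measurable_id _ (mR * mR)%type setT) ih)).
move=> o1 o2.
have [_ u20 _ _] := sd_u2 sd.
pose p := if o2 is Some q then q else - N%:R.
pose t : R := ratr (if o1 is Some q then q else - N%:R).
rewrite -[RHS](half_plane_flux0 p N%:R t).
apply: Rint_eq => z.
have -> : \1_(oray o1 `*` oray o2) z = \1_(oray o1) z.1 * \1_(oray o2) z.2 :> R.
  by rewrite !indicE in_setX; case: (_ \in _); case: (_ \in _); rewrite /= ?mulr1 ?mulr0.
have [z1|z1] := ltP M `|z.1|; first by rewrite u20 ?mulr0 ?mul0r ?mulr0//; right.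
have -> : \1_(oray o1) z.1 = \1_(`]t, +oo[%classic) z.1 :> R.
  rewrite /t {t}; case: o1 => [q|] //=; rewrite indicT indicE mem_setE in_itv/= andbT.
  have : `|z.1| < N%:R by exact: le_lt_trans z1 MN.
  by rewrite ltr_norml rmorphN/= ratr_nat => /andP[-> _].
rewrite -mulrA; congr (_ * _); rewrite mulrCA; congr (_ * _).
rewrite (mulrC (u2 _)); apply: (strip_ray (f := fun y => u2 (y, z.1))) => zM.
by rewrite u20//; left.
Qed.

(** With the horizontal part gone every half-plane flux is zero. Hence on each good line, in [D] or
    not, the line flux against every rational ramp is zero. *)
Lemma null_vertical : {ae mu2, forall z : mR * mR, \1_S (Phi z) * u1 z = 0}.
Proof.
have hp0 (p q : rat) t : half_plane_flux u1 u2 rho (ratr p) (ratr q) S t = 0.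
  rewrite -[RHS](Rint_cst0 mu2); apply: Rint_ae => //.
    apply: intg_meas; apply: (@intg_indic _ _ _ mu2 _ (Phi @^-1` S)) => //.
    exact: (half_plane_indic t (u2_strip_intg sd _ _)).
  apply: (ae_mono null_horizontal) => z z0.
  transitivity ((\1_S (Phi z) * u2 (swp z)) *
    (\1_(`[t, +oo[%classic) z.1 * \1_(`]ratr p, ratr q[%classic) z.2)); first by ring.
  by rewrite z0 mul0r.
pose g z := \1_S (Phi z) * u1 z.
have mg : measurable_fun [set: mR * mR] (g : mR * mR -> R).
  apply: intg_meas; apply: (@intg_indic _ _ _ mu2 _ (Phi @^-1` S)) => //.
  exact: regular_intg (sd_u1 sd).
apply: (@ae_prod R [set z | g z = 0]).
  by rewrite -[X in measurable X]setTI; exact: (mg measurableT [set 0]).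
apply: (ae_mono ae_good_line) => t gt.
have ig : intg mu (fun y => g (t, y)).
  have mSt : measurable ((fun y => Phi (t, y)) @^-1` S : set mR).
    by rewrite -[X in measurable X]setTI; exact: (mPhi_slice sd t).
  exact: (@intg_indic _ _ _ mu _ _ mSt (regular_slice (sd_u1 sd) t)).
have [_ u10 _ _] := sd_u1 sd.
have g0 y : M < `|y| -> g (t, y) = 0 by move=> yM; rewrite /g u10 ?mulr0//; right.
(* By Fubini the integral of this tail function over a rational interval is the line flux against
   the corresponding ramp, so [W] vanishes almost everywhere. [dense_rays] then removes the
   exceptional set. *)
pose W s := \int[mu]_y (\1_(`[s, +oo[%classic) y * g (t, y)).
have mI : measurable_fun [set: mR * mR] (fun z : mR * mR => \1_(`[z.1, +oo[%classic) z.2 : R).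
  have -> : (fun z : mR * mR => \1_(`[z.1, +oo[%classic) z.2 : R) =
      \1_[set z : mR * mR | (z.1 : R) <= z.2].
    by apply/funext => z; rewrite !indicE !mem_setE in_itv/= andbT; congr (_%:R);
      congr nat_of_bool; apply/idP/idP; rewrite inE.
  apply: measurable_indic; rewrite -[X in measurable X]setTI.
  by apply: measurable_fun_le.
have mg2 : measurable_fun [set: mR * mR] (fun z : mR * mR => g (t, z.2) : R).
  exact: (measurableT_comp (intg_meas ig) measurable_snd).
have mW : measurable_fun [set: mR] (W : mR -> R).
  apply: (@measurable_Rint R _ mR (fun z => \1_(`[z.1, +oo[%classic) z.2 * g (t, z.2))).
  exact: measurable_funM.
have ray_g s : intg mu (fun y => \1_(`[s, +oo[%classic) y * g (t, y)).
  by apply: intg_indic => //; exact: measurable_itv.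
have Wb s : `|W s| <= \int[mu]_y `|g (t, y)|.
  apply: (le_trans (Rint_norm_le (ray_g s))).
  apply: Rint_le; [exact: intg_norm|exact: intg_norm|].
  by move=> y; rewrite normrM -[leRHS]mul1r ler_wpM2r// indic_norm1.
have iW a b : intg mu (fun s => \1_(`]a, b[%classic) s * W s).
  exact: (intg_mulb (C := \int[mu]_y `|g (t, y)|) (itvoo_intg a b)).
have W0 : {ae mu, forall s : mR, W s = 0}.
  apply: interval_zero => // p q.
  have := gt p q S mS; rewrite hp0 => E; rewrite -[RHS]E /line_flux.
  pose j (z : mR * mR) := \1_(`]ratr p, ratr q[%classic) z.1 *
    (\1_(`[z.1, +oo[%classic) z.2 * g (t, z.2)).
  have mi : measurable_fun [set: mR] (\1_(`]ratr p, ratr q[%classic) : mR -> R).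
    exact: intg_meas (itvoo_intg _ _).
  have mj : measurable_fun [set: mR * mR] j.
    apply: measurable_funM; first exact: (measurableT_comp mi measurable_fst).
    exact: measurable_funM.
  have ij : intg mu2 j.
    apply: intg_tonelli => //; first by apply: aeW => s; rewrite /j/=; exact: intgZ.
    apply: (@intg_le _ mR R mu _ (fun s => (\int[mu]_y `|g (t, y)|) *
        \1_(`]ratr p, ratr q[%classic) s)).
    - by apply: (@measurable_Rint R _ mR (fun z => `|j z|)); exact: measurableT_comp.
    - move=> s; rewrite (ger0_norm (Rint_ge0 _ _))// mulrC -RintZ; last exact: intg_norm.
      apply: Rint_le.
      + by apply: intg_norm; rewrite /j/=; exact: intgZ.
      + by apply: intgZ; exact: intg_norm.
      + move=> y; rewrite /j/= normrM (ger0_norm (_ : 0 <= \1_(`]_, _[%classic) s)) ?indicE//.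
        rewrite ler_wpM2l// normrM -[leRHS]mul1r ler_wpM2r//.
        by rewrite -indicE indic_norm1.
    - by apply: intgZ; exact: itvoo_intg.
  transitivity (\int[mu2]_z j z).
    have [_ ->] := Rint_fubini ij.
    by apply: Rint_eq => s; rewrite /W -RintZ.
  have ijs := mpres_intg swap_mpres ij.
  rewrite -(mpres_Rint swap_mpres mj).
  have [_ ->] := Rint_fubini ijs.
  apply: Rint_eq => y; rewrite /ramp /prim1 (Rint_in `]-oo, y]) [RHS]mulrA -[RHS]RintZ; last first.
    by apply: intg_indic; [exact: measurable_itv|exact: itvoo_intg].
  apply: Rint_eq => s; rewrite /j/=.
  have -> : \1_(`]-oo, y]) s = \1_(`[s, +oo[%classic) y :> R.
    by rewrite !indicE !mem_setE !in_itv/= andbT.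
  by rewrite /g; ring.
have rays := dense_rays (@measurable_id _ mR setT) ig (ae_dense W0) (fun s W0s => W0s).
apply: (Rint_sets0 ig).
apply: (ray_lambda_zero (integral_additive (@measurable_id _ mR setT) ig)).
- rewrite -[RHS](rays (ratr (- N%:R))); apply: Rint_eq => y.
  have [yM|yM] := ltP M `|y|; first by rewrite g0// !mulr0.
  congr (_ * _); rewrite indicT indicE mem_setE in_itv/= andbT.
  have : `|y| < N%:R by exact: le_lt_trans yM MN.
  by rewrite ltr_norml rmorphN/= ratr_nat => /andP[-> _].
- by move=> q; exact: rays.
Qed.

Theorem null_on_lines : {ae mu2, forall z : mR * mR, S (Phi z) -> u1 z = 0 /\ u2 (swp z) = 0}.
Proof.
apply: (ae_mono2 null_vertical null_horizontal) => z + + Sz.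
by rewrite indicE mem_set// !mul1r.
Qed.

End null.
End lines_null.

(** * Regular points of plane curves *)

Section curves.
Context {R : realType}.
Implicit Types (h g : R -> R).

(** [r] is the slope at y of the curve with coordinates [h] and [g]; a nonzero [alpha] excludes
    vertical tangents and stationary points. *)
Definition regular_point h g (alpha r y : R) :=
  [/\ is_derive y 1 h alpha, is_derive y 1 g (r * alpha) & alpha != 0].

Lemma is_derive_near (f : R -> R) (y l : R) : is_derive y 1 f l ->
  (f (y + t) - f y) / t @[t --> (0 : R)^'] --> l.
Proof.
move=> [df <-]; apply: cvg_trans df; apply: near_eq_cvg; apply: nearW => t /=.
by rewrite [_ *: 1]mulr1 (addrC t) mulrC.
Qed.

(* [b] records on which side of [c] the slope of the curve lies *)
Definition sided h g (c : R) (b : bool) (n : nat) (y : R) := forall y2 : R,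
  `|y2 - y| < n.+1%:R^-1 -> y2 != y ->
  if b then (h y2 - h y) * ((g y2 - c * h y2) - (g y - c * h y)) < 0
  else 0 < (h y2 - h y) * ((g y2 - c * h y2) - (g y - c * h y)).

(** Divided by the square of y2 - y, the product in [sided] tends to (r - c) alpha^2, which has the
    sign of r - c. *)
Lemma regular_sided h g alpha r y c : regular_point h g alpha r y -> r != c ->
  exists n, sided h g c (r < c) n y.
Proof.
move=> [dh dg a0] rc.
have ch := is_derive_near dh; have cg := is_derive_near dg.
pose q t := (h (y + t) - h y) / t * ((g (y + t) - g y) / t - c * ((h (y + t) - h y) / t)).
have cq : q t @[t --> (0 : R)^'] --> alpha * (r * alpha - c * alpha).
  by apply: cvgM => //; apply: cvgB => //; apply: cvgM => //; exact: cvg_cst.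
have lE : alpha * (r * alpha - c * alpha) = (r - c) * alpha ^+ 2 by ring.
rewrite lE in cq.
have a2 : 0 < alpha ^+ 2 by rewrite exprn_even_gt0.
have qE t : t != 0 -> (h (y + t) - h y) * ((g (y + t) - c * h (y + t)) - (g y - c * h y)) =
    q t * t ^+ 2 by move=> t0; rewrite /q; field.
have : \forall t \near (0 : R)^', if r < c then q t < 0 else 0 < q t.
  case: ltP => [rc'|cr].
    apply: (cvgr_lt _ cq); by rewrite pmulr_llt0// subr_lt0.
  by apply: (cvgr_gt _ cq); rewrite pmulr_lgt0// subr_gt0 lt_neqAle eq_sym rc.
rewrite near_withinE => /nbhs_ballP[e /= e0 He].
have : \forall n \near \oo, (n.+1%:R^-1 : R) < e.
  have /cvgrPdist_lt /(_ _ e0) := @cvg_harmonic R.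
  by apply: filterS => n; rewrite sub0r normrN ger0_norm /harmonic/= ?invr_ge0.
move=> [n _ /(_ n (leqnn n)) ne]; exists n => y2 y2n y2y.
have t0 : y2 - y != 0 by rewrite subr_eq0.
have := He (y2 - y); rewrite /ball/= sub0r normrN => /(_ (lt_trans y2n ne) t0).
have := qE _ t0; rewrite subrKC => ->.
have t2 : 0 < (y2 - y) ^+ 2 by rewrite exprn_even_gt0.
by case: ltP => _ Hq; [rewrite pmulr_llt0|rewrite pmulr_lgt0].
Qed.

(* If two curves meet at two pairs of nearby regular points, the chord joining the two
   common points would have slope both below and above [c]. *)
Lemma crossing_countable h1 g1 h2 g2 :
  countable [set y : R | exists alpha r y' alpha' r',
    [/\ regular_point h1 g1 alpha r y, regular_point h2 g2 alpha' r' y',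
        h1 y = h2 y', g1 y = g2 y' & r != r']].
Proof.
(* A code records a rational [c] strictly between the two slopes, the side of the first slope, and
   for each curve the size of a neighbourhood with a rational point near the parameter. The half
   radii put two parameters with the same code into each other's neighbourhood, so a code determines
   the parameter on the first curve. *)
pose code := ((rat * bool) * ((nat * rat) * (nat * rat)))%type.
pose Y (k : code) : set R := let: ((c, b), ((n, p), (m, q))) := k in
  [set y | exists y', [/\ sided h1 g1 (ratr c) b n y, `|y - ratr p| < n.+1%:R^-1 / 2,
     sided h2 g2 (ratr c) (~~ b) m y', `|y' - ratr q| < m.+1%:R^-1 / 2 &
     h1 y = h2 y' /\ g1 y = g2 y']].
have YE k : countable (Y k).
  have sub1 ya yb : Y k ya -> Y k yb -> ya = yb.
    case: k => -[c b] [[n p] [m q]] /= [a' [sa pa sa' pa' [ha ga]]] [b' [_ pb _ pb' [hb gb]]].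
    apply: contrapT => /eqP yab; rewrite eq_sym in yab.
    have near1 (u v w e : R) : `|u - w| < e / 2 -> `|v - w| < e / 2 -> `|v - u| < e.
      rewrite !ltr_norml => /andP[u1 u2] /andP[v1 v2].
      by apply/andP; split; lra.
    have H1 := sa yb (near1 _ _ _ _ pa pb) yab.
    (* If the parameters on the second curve agree, the chord of the first curve is zero, against
       the strict inequality in [sided]. Otherwise both curves share a chord, with opposite
       signs. *)
    have [ab'|ab'] := eqVneq b' a'.
      by move: H1; rewrite ha hb ga gb ab' !subrr mul0r ltxx; case: (b).
    have H2 := sa' b' (near1 _ _ _ _ pa' pb') ab'.
    move: H1 H2; rewrite ha hb ga gb; case: (b) => /= H1 H2.
      by have := lt_trans H1 H2; rewrite ltxx.
    by have := lt_trans H1 H2; rewrite ltxx.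
  have [[y0 Yy0]|nY] := pselect (exists y0, Y k y0).
    have -> : Y k = [set y0] by apply/seteqP; split => y /= => [Yy|->//]; exact: sub1.
    exact: countable1.
  have -> : Y k = set0 by apply/seteqP; split => // y Yy; apply: nY; exists y.
  exact: countable0.
apply: (@sub_countable _ _ _ (\bigcup_(k in setT) Y k)); last first.
  by apply: bigcup_countable; [exact: countableP|move=> k _; exact: YE].
apply: subset_card_le => y [alpha [r [y' [alpha' [r' [G1 G2 hE gE rr]]]]]].
have [c [crr rc rc']] : exists c : rat, [/\ (r < ratr c) = ~~ (r' < ratr c), r != ratr c & r' != ratr c].
  have [lt|lt|E] := ltgtP r r'; last by rewrite E eqxx in rr.
  - have [c] := rat_in_itvoo lt; rewrite in_itv/= => /andP[c1 c2]; exists c; split.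
    + by rewrite c1 -leNgt ltW.
    + by rewrite lt_eqF.
    + by rewrite gt_eqF.
  - have [c] := rat_in_itvoo lt; rewrite in_itv/= => /andP[c1 c2]; exists c; split.
    + by rewrite c1 /= ltNge ltW.
    + by rewrite gt_eqF.
    + by rewrite lt_eqF.
have [n sn] := regular_sided G1 rc; have [m sm] := regular_sided G2 rc'.
have ratn (x e : R) : 0 < e -> exists q : rat, `|x - ratr q| < e.
  move=> e0; have [|q] := @rat_in_itvoo R (x - e) (x + e); first by lra.
  by rewrite in_itv/= => /andP[q1 q2]; exists q; rewrite ltr_norml; apply/andP; split; lra.
have [p yp] := ratn y (n.+1%:R^-1 / 2) ltac:(by rewrite divr_gt0 ?invr_gt0).
have [q yq] := ratn y' (m.+1%:R^-1 / 2) ltac:(by rewrite divr_gt0 ?invr_gt0).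
exists ((c, r < ratr c), ((n, p), (m, q))) => //=.
exists y'; split=> //.
by rewrite crr negbK.
Qed.

End curves.

(** * Borel images of regular points of a curve *)

Section line_images.
Context {R : realType}.
Notation mR := (measurableTypeR R).
Notation mu := (@lebesgue_measure R).
Notation mu2 := (lebesgue2 R).

Lemma compact_exhaustion (A : set mR) : measurable A -> (mu A < +oo)%E ->
  exists K : nat -> set R, [/\ forall n, compact (K n), forall n, K n `<=` A &
    {ae mu, forall y : mR, A y -> exists n, K n y}].
Proof.
move=> mA finA.
have KP n : exists V : set R, [/\ compact V, V `<=` A & (mu (A `\` V) < (n.+1%:R^-1)%:E)%E].
  exact: lebesgue_regularity_inner.
pose K n := sval (cid (KP n)).
have KE n : [/\ compact (K n), K n `<=` A & (mu (A `\` K n) < (n.+1%:R^-1)%:E)%E].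
  by rewrite /K; case: cid.
exists K; split; [by move=> n; have [] := KE n|by move=> n; have [] := KE n|].
have mK n : measurable (K n : set mR) by apply: compact_measurable; have [] := KE n.
exists (A `\` \bigcup_n K n); split.
- by apply: measurableD => //; exact: bigcupT_measurable.
- apply/eqP; rewrite -measure_le0; apply/lee_addgt0Pr => e e0.
  rewrite add0e.
  have [n _ /(_ n (leqnn n)) ne] : \forall n \near \oo, (n.+1%:R^-1 : R) < e.
    have /cvgrPdist_lt /(_ _ e0) := @cvg_harmonic R.
    by apply: filterS => n; rewrite sub0r normrN ger0_norm /harmonic/= ?invr_ge0.
  apply: (@le_trans _ _ (mu (A `\` K n))).
    apply: le_measure; rewrite ?inE.
    + by apply: measurableD => //; exact: bigcupT_measurable.
    + exact: measurableD.
    + by move=> y [Ay nK]; split=> // Ky; apply: nK; exists n.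
  by have [_ _ /ltW/le_trans] := KE n; apply; rewrite lee_fin ltW.
- by move=> y /= /not_implyP[Ay nK]; split=> // -[n _ Kn]; apply: nK; exists n.
Qed.

Lemma compact2_measurable (A : set (R * R)) : compact A -> measurable (A : set (mR * mR)).
Proof.
move=> cA; rewrite -[A]setCK; apply: measurableC; apply: open2_measurable.
by apply: closed_openC; apply: compact_closed => //; exact: norm_hausdorff.
Qed.

(* The points of [B] where the curve is regular are covered, up to a null set, by
   compact sets, whose images by the curve are Borel. *)
Lemma curve_image (h g u : R -> R) (r : R -> R) (B : set mR) :
  measurable B -> (mu B < +oo)%E -> (forall y, B y -> u y != 0) ->
  {ae mu, forall y : mR, is_derive (y : R) 1 h (u y)} ->
  {ae mu, forall y : mR, is_derive (y : R) 1 g (r y * u y)} ->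
  exists S : set (mR * mR), [/\ measurable S,
    forall z, S z -> exists2 y, B y & regular_point h g (u y) (r y) y /\ z = (h y, g y) &
    {ae mu, forall y : mR, B y -> S (h y, g y)}].
Proof.
move=> mB finB Bu dh dg.
have [N [mN N0 PN]] : {ae mu, forall y : mR,
    is_derive (y : R) 1 h (u y) /\ is_derive (y : R) 1 g (r y * u y)}.
  by apply: (ae_mono2 dh dg).
have mBN : measurable (B `\` N) by exact: measurableD.
have finBN : (mu (B `\` N) < +oo)%E.
  by apply: le_lt_trans finB; apply: le_measure; rewrite ?inE//; exact: subDsetl.
have [K [cK KB aeK]] := compact_exhaustion mBN finBN.
have KP n y : K n y -> regular_point h g (u y) (r y) y.
  move=> /KB[By nNy].
  have [d1 d2] : is_derive y 1 h (u y) /\ is_derive y 1 g (r y * u y).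
    by apply: contrapT => nd; apply: nNy; exact: PN.
  by split=> //; exact: Bu.
exists (\bigcup_n ((fun y => (h y, g y)) @` K n)); split.
- apply: bigcupT_measurable => n; apply: compact2_measurable.
  apply: continuous_compact => //.
  (* The curve is differentiable, hence continuous, at the points of [K n], and this suffices for
     continuity on that compact set. *)
  apply: continuous_in_subspaceT => y; rewrite inE => Ky.
  have [[d1 _] [d2 _] _] := KP n y Ky.
  have c1 : h x @[x --> y] --> h y.
    by apply: differentiable_continuous; exact/derivable1_diffP.
  have c2 : g x @[x --> y] --> g y.
    by apply: differentiable_continuous; exact/derivable1_diffP.
  exact: cvg_pair c1 c2.
- move=> z [n _ [y Ky <-]]; exists y; last by split=> //; exact: KP Ky.
  by have [] := KB _ _ Ky.
- have nN : {ae mu, forall y : mR, ~ N y}.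
    by exists N; split=> // y /= /contrapT.
  apply: (ae_mono2 aeK nN) => y Hy Ny By; have [//|n Ky] := Hy.
  by exists n => //; exists y.
Qed.

End line_images.

(** * Renormalization *)

Section renormalization.
Context {R : realType}.
Notation mR := (measurableTypeR R).
Notation mu := (@lebesgue_measure R).
Notation mu2 := (lebesgue2 R).

Definition side (c : R) (b : bool) (s : R) : Prop := if b then s <= c else c < s.

Lemma measurable_side c b : measurable [set s : mR | side c b s].
Proof.
case: b => /=.
  have -> : [set s : mR | (s : R) <= c] = `]-oo, c]%classic.
    by apply/seteqP; split => s /=; rewrite in_itv.
  exact: measurable_itv.
have -> : [set s : mR | c < (s : R)] = `]c, +oo[%classic.
  by apply/seteqP; split => s /=; rewrite in_itv/= andbT.
exact: measurable_itv.
Qed.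

Lemma regular_slices_derive (u : R * R -> R) M x : regular_slices u M ->
  {ae mu, forall y : mR, is_derive (y : R) 1 (fun y => prim u (x, y)) (u (x, y))}.
Proof. by move=> su; exact: prim1_derive (regular_slice su x). Qed.

Section separation.
(* countably many curves [y |-> (h i y, g i y)] of slope [s i], and a Borel set [S] made of
   regular points of these curves with slope on the side [b] of [c] *)
Variables (h g v s : rat * rat -> R -> R) (c : R) (b : bool) (S : set (mR * mR)).
Hypothesis mS : measurable S.
Hypothesis SP : forall z, S z -> exists i y,
  [/\ regular_point (h i) (g i) (v i y) (s i y) y, side c b (s i y) & z = (h i y, g i y)].

(** On a vertical line the pair of primitives is a curve whose slope is [r] almost everywhere on
    [u <> 0]. A meeting with [S] at a slope on the wrong side would be a crossing at different
    slopes, and [crossing_countable] leaves only countably many of these for each of the countably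
    many curves. Here [u] and [r] are independent of the curves, so that the lemma applies to
    vertical slices and, after a swap, to horizontal ones. *)
Lemma separation (u r : R * R -> R) M :
  regular_slices u M -> measurable_fun [set: mR * mR] (r : mR * mR -> R) ->
  regular_slices (fun z => r z * u z) M ->
  {ae mu2, forall z : mR * mR, u z != 0 ->
     S (prim u z, prim (fun z => r z * u z) z) -> side c b (r z)}.
Proof.
move=> su mr sw; set w := fun z => r z * u z.
have [mu_ _ _ _] := su.
have mPhi : measurable_fun [set: mR * mR] (fun z : mR * mR => (prim u z, prim w z) : mR * mR).
  by apply: measurable_fun_pair; [exact: (measurable_prim su)|exact: (measurable_prim sw)].
pose A := [set z : mR * mR | u z != 0 -> S (prim u z, prim w z) -> side c b (r z)].
apply: (@ae_prod R A).
  have -> : A = [set z : mR * mR | u z = 0] `|`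
      (~` ((fun z : mR * mR => (prim u z, prim w z) : mR * mR) @^-1` S) `|`
      r @^-1` [set t | side c b t]).
    apply/seteqP; split => z /=.
      have [->|u0] := eqVneq (u z) 0; first by left.
      move=> /(_ u0) H; right.
      by have [Sz|nSz] := pselect (S (prim u z, prim w z)); [right; exact: H|left].
    by case=> [z0|[nS|H]] u0 Sz => //; rewrite z0 eqxx in u0.
  apply: measurableU.
    by rewrite -[X in measurable X]setTI; exact: (mu_ measurableT [set 0]).
  apply: measurableU.
    by apply: measurableC; rewrite -[X in measurable X]setTI; exact: mPhi.
  by rewrite -[X in measurable X]setTI; apply: mr => //; exact: measurable_side.
apply: aeW => x.
pose cross i := [set y : R | exists alpha r1 y' alpha' r1',
    [/\ regular_point (fun y => prim u (x, y)) (fun y => prim w (x, y)) alpha r1 y,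
        regular_point (h i) (g i) alpha' r1' y',
        prim u (x, y) = h i y', prim w (x, y) = g i y' & r1 != r1']].
have ncross : {ae mu, forall y : mR, forall i, ~ cross i y}.
  apply: ae_countable => i.
  have cc : countable (cross i) by exact: crossing_countable.
  exists (cross i : set mR); split.
  - exact: countable_measurable.
  - exact: countable_lebesgue_measure0.
  - by move=> y /= /contrapT.
apply: (ae_mono3 (regular_slices_derive x su) (regular_slices_derive x sw) ncross).
move=> y du dw nc u0 /SP[i [y' [G sd [hE gE]]]].
have [<-//|rs] := eqVneq (s i y') (r (x, y)).
exfalso; apply: (nc i).
exists (u (x, y)), (r (x, y)), y', (v i y'), (s i y'); split => //.
by rewrite eq_sym.
Qed.

End separation.

Variables (u1 u2 rho : R * R -> R) (M L : R).
Hypothesis sd : stream_data u1 u2 rho M L.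

Notation Phi := (Phi u1 rho).
Let mPhi : measurable_fun [set: mR * mR] (Phi : mR * mR -> mR * mR) := measurable_Phi sd.

Let good_lines_dense (i : rat * rat) : exists t : R, good_line u1 u2 rho t /\
  ((ratr i.1 : R) < ratr i.2 -> ratr i.1 < t < ratr i.2).
Proof.
have ag := ae_good_line sd.
have [lt|_] := ltP (ratr i.1 : R) (ratr i.2).
  by have [t ti gt] := ae_dense ag lt; exists t; split.
by have [t _ gt] := ae_dense ag (@ltr01 R); exists t; split.
Qed.

Let tq (i : rat * rat) : R := sval (cid (good_lines_dense i)).
Let tqP i : good_line u1 u2 rho (tq i) /\
  ((ratr i.1 : R) < ratr i.2 -> ratr i.1 < tq i < ratr i.2).
Proof. by rewrite /tq; case: cid. Qed.

Let tq_dense (a b : R) : a < b -> exists2 t, a < t < b & range tq t.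
Proof.
move=> ab.
have [p] := rat_in_itvoo ab; rewrite in_itv/= => /andP[ap pb].
have [q] := rat_in_itvoo pb; rewrite in_itv/= => /andP[pq qb].
have [_ /(_ pq) /andP[h1 h2]] := tqP (p, q).
exists (tq (p, q)); last by exists (p, q).
by rewrite (lt_trans ap h1) (lt_trans h2 qb).
Qed.

Let su1 := sd_u1 sd.
Let su2 := sd_u2 sd.
Let sw1 : regular_slices (fun z => rho z * u1 z) M :=
  regular_slicesM su1 (sd_rho sd) (sd_rhoL sd).
Let sw2 : regular_slices (fun z => rho (swp z) * u2 z) M :=
  regular_slicesM su2 (measurable_swp (sd_rho sd)) (fun z => sd_rhoL sd (swp z)).

Let hq i y := prim u1 (tq i, y).
Let gq i y := prim (fun z => rho z * u1 z) (tq i, y).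
Let vq i y := u1 (tq i, y).
Let sq i y := rho (tq i, y).

(** A countable union over the chosen lines of the Borel sets given by [curve_image]; the finite
    measure required there comes from the bounded support of [u1]. *)
Lemma side_image (c : R) (b : bool) : exists S : set (mR * mR), [/\ measurable S,
  forall z, S z -> exists i y,
    [/\ regular_point (hq i) (gq i) (vq i y) (sq i y) y, side c b (sq i y) & z = (hq i y, gq i y)] &
  forall i, {ae mu, forall y : mR, u1 (tq i, y) != 0 -> side c b (rho (tq i, y)) -> S (Phi (tq i, y))}].
Proof.
have Bi i : exists S : set (mR * mR), [/\ measurable S,
    forall z, S z -> exists y,
      [/\ regular_point (hq i) (gq i) (vq i y) (sq i y) y, side c b (sq i y) & z = (hq i y, gq i y)] &
    {ae mu, forall y : mR, u1 (tq i, y) != 0 -> side c b (rho (tq i, y)) -> S (Phi (tq i, y))}].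
  pose B := [set y : mR | u1 (tq i, y) != 0 /\ side c b (rho (tq i, y))].
  have [mu1 u10 _ _] := su1.
  have mu1t : measurable_fun [set: mR] (fun y : mR => u1 (tq i, y)).
    exact: (measurableT_comp mu1 (measurable_pair1 (tq i))).
  have mrt : measurable_fun [set: mR] (fun y : mR => rho (tq i, y)).
    exact: (measurableT_comp (sd_rho sd) (measurable_pair1 (tq i))).
  have mB : measurable B.
    have -> : B = ~` ((fun y : mR => u1 (tq i, y)) @^-1` [set 0]) `&`
        ((fun y : mR => rho (tq i, y)) @^-1` [set s | side c b s]).
      by apply/seteqP; split => y /= [/eqP ? ?]; split=> //; exact/eqP.
    apply: measurableI.
      by apply: measurableC; rewrite -[X in measurable X]setTI; exact: (mu1t measurableT [set 0]).
    by rewrite -[X in measurable X]setTI; apply: mrt => //; exact: measurable_side.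
  have finB : (mu B < +oo)%E.
    apply: (@le_lt_trans _ _ (mu (`[- M, M]%classic : set mR))).
      apply: le_measure; rewrite ?inE// => y [u0 _] /=; rewrite in_itv/= -ler_norml.
      rewrite leNgt; apply: contra u0 => My; apply/eqP; apply: u10; by right.
    by rewrite lebesgue_measure_itv/=; case: ifP => _; rewrite ?ltry.
  have [S [mS SP aS]] := curve_image mB finB (fun y (By : B y) => By.1)
    (regular_slices_derive (tq i) su1) (regular_slices_derive (tq i) sw1).
  exists S; split=> //.
  - by move=> z /SP[y [u0 sy] [G ->]]; exists y; split.
  - by apply: (ae_mono aS) => y Hy u0 sy; apply: Hy; split.
pose S i := sval (cid (Bi i)).
have SE i : [/\ measurable (S i),
    forall z, S i z -> exists y,
      [/\ regular_point (hq i) (gq i) (vq i y) (sq i y) y, side c b (sq i y) & z = (hq i y, gq i y)] &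
    {ae mu, forall y : mR, u1 (tq i, y) != 0 -> side c b (rho (tq i, y)) -> S i (Phi (tq i, y))}].
  by rewrite /S; case: cid.
exists (\bigcup_i S i); split.
- apply: countable_bigcupT_measurable; first exact: countableP.
  by move=> i; have [] := SE i.
- by move=> z [i _ Sz]; have [_ /(_ z Sz)[y Hy] _] := SE i; exists i, y.
- move=> i; have [_ _ H] := SE i.
  by apply: (ae_mono H) => y Hy u0 sy; exists i => //; exact: Hy.
Qed.

(** [S1] and [S2] collect points of slope at most [c] and above [c]. On the chosen lines they catch
    almost every point with [u1 <> 0], so by [null_on_lines] they catch almost every point of the
    plane where the field is nonzero. By [separation] neither catches a point of the other kind, and
    [S2] has the required property. *)
Lemma superlevel_sets (c : R) : exists2 S : set (mR * mR), measurable S &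
  {ae mu2, forall z : mR * mR, u1 z != 0 \/ u2 (swp z) != 0 -> (c < rho z <-> S (Phi z))}.
Proof.
have [S1 [mS1 SP1 aS1]] := side_image c true.
have [S2 [mS2 SP2 aS2]] := side_image c false.
exists S2 => //.
have mN : measurable (~` (S1 `|` S2)) by apply: measurableC; exact: measurableU.
have cover : {ae mu2, forall z : mR * mR, (~` (S1 `|` S2)) (Phi z) -> u1 z = 0 /\ u2 (swp z) = 0}.
  apply: (null_on_lines sd mN tq_dense).
  - by move=> _ [i _ <-]; have [] := tqP i.
  - move=> _ [i _ <-]; apply: (ae_mono2 (aS1 i) (aS2 i)) => y H1 H2 nS.
    apply: contrapT => /eqP u0; apply: nS.
    have [le|gt] := leP (rho (tq i, y)) c; first by left; exact: H1.
    by right; exact: H2.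
have v1 := separation mS1 SP1 su1 (sd_rho sd) sw1.
have v2 := separation mS2 SP2 su1 (sd_rho sd) sw1.
(* Where only [u2] is nonzero the vertical slope is undefined, and the same sets are tested against
   horizontal slices. [sd_H] and [sd_G] identify the horizontal primitives with [Phi]. *)
have h1 := mpres_ae swap_mpres (separation mS1 SP1 su2 (measurable_swp (sd_rho sd)) sw2).
have h2 := mpres_ae swap_mpres (separation mS2 SP2 su2 (measurable_swp (sd_rho sd)) sw2).
have hor : {ae mu2, forall z : mR * mR, u2 (swp z) != 0 ->
    (S1 (Phi z) -> rho z <= c) /\ (S2 (Phi z) -> c < rho z)}.
  apply: (ae_mono2 (ae_mono2 h1 h2 (fun z a b => conj a b)) (ae_mono2 (sd_H sd) (sd_G sd) (fun z a b => conj a b))).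
  move=> z [a b] [eH eG] u0.
  have E : Phi z = (prim u2 (swp z), prim (fun z => rho (swp z) * u2 z) (swp z)).
    by rewrite -eH -eG.
  have := a u0; have := b u0; rewrite /= swpK -/(swp z) => b' a'.
  by split=> Sz; [apply: a'|apply: b']; move: Sz; rewrite E.
apply: (ae_mono2 (ae_mono2 v1 v2 (fun z a b => conj a b)) (ae_mono2 cover hor (fun z a b => conj a b))).
move=> z [a b] [cv hr] u0.
have [H1 H2] : (S1 (Phi z) -> rho z <= c) /\ (S2 (Phi z) -> c < rho z).
  case: u0 => u0; last exact: hr.
  by split; [exact: (a u0)|exact: (b u0)].
split=> // cz; apply: contrapT => nS2.
have nS1 : ~ S1 (Phi z) by move/H1; rewrite leNgt cz.
have [z1 z2] := cv (fun (H : (S1 `|` S2) (Phi z)) => match H with or_introl h => nS1 h | or_intror h => nS2 h end).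
by case: u0; rewrite ?z1 ?z2 eqxx.
Qed.

Section test.
Variables (C : R) (phi phix phiy : R * R -> R).
Hypothesis adm : admissible C phi phix phiy.
Let fl := flux_density u1 u2 phix phiy.
Let ifl : intg mu2 fl := flux_density_intg sd adm.

Lemma level_set_flux (B : set mR) : measurable B ->
  \int[mu2]_z (\1_B (rho z) * fl z) = 0.
Proof.
apply: (ray_lambda_zero (integral_additive (sd_rho sd) ifl)).
  rewrite -[RHS](borel_flux sd adm (@measurableT _ (mR * mR)%type)).
  by apply: Rint_eq => z; rewrite !indicT.
move=> q; have [S mS HS] := superlevel_sets (ratr q).
rewrite -[RHS](borel_flux sd adm mS).
apply: Rint_ae.
- apply: measurable_funM; last exact: intg_meas ifl.
  have mI : measurable_fun [set: mR] (\1_(`]ratr q, +oo[%classic) : mR -> R).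
    by apply: measurable_indic; exact: measurable_itv.
  exact: (measurableT_comp mI (sd_rho sd)).
- apply: measurable_funM; last exact: intg_meas ifl.
  have mI : measurable_fun [set: mR * mR] (\1_S : mR * mR -> R) by exact: measurable_indic.
  exact: (measurableT_comp mI mPhi).
apply: (ae_mono HS) => z Hz.
(* The level set is identified only where the field is nonzero; elsewhere the flux density is
   zero. *)
have [z1|z1] := eqVneq (u1 z) 0; last first.
  congr (_ * _); rewrite !indicE mem_setE in_itv/= andbT; congr (_%:R); congr nat_of_bool.
  by apply/idP/idP => [|]; rewrite inE => /Hz; apply; left.
have [z2|z2] := eqVneq (u2 (swp z)) 0.
  by rewrite /fl /flux_density z1 z2 !mul0r subrr !mulr0.
congr (_ * _); rewrite !indicE mem_setE in_itv/= andbT; congr (_%:R); congr nat_of_bool.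
by apply/idP/idP => [|]; rewrite inE => /Hz; apply; right.
Qed.

Theorem renormalized_flux (beta : R -> R) (B : R) :
  measurable_fun [set: mR] (beta : mR -> R) ->
  (forall s, `|s| <= L -> `|beta s| <= B) ->
  \int[mu2]_z (beta (rho z) * fl z) = 0.
Proof.
move=> mb bB.
(* The shift makes the function nonnegative, so that [Num.trunc] returns the index of its level; the
   added constant contributes nothing because [fl] has integral 0. *)
pose g z := beta (rho z) + B.
have g0 z : 0 <= g z.
  by rewrite /g -lerBlDr sub0r; have := bB _ (sd_rhoL sd z); rewrite ler_norml => /andP[].
have gB z : g z <= B + B.
  by rewrite /g lerD2r; have := bB _ (sd_rhoL sd z); rewrite ler_norml => /andP[].
have mg : measurable_fun [set: mR * mR] (g : mR * mR -> R).
  by apply: measurable_funD => //; exact: (measurableT_comp mb (sd_rho sd)).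
have Ifl : \int[mu2]_z fl z = 0.
  rewrite -[RHS](level_set_flux (@measurableT _ mR)).
  by apply: Rint_eq => z; rewrite indicT mul1r.
have igfl : intg mu2 (fun z => g z * fl z).
  have := intg_mulb (C := B + B) ifl mg (fun z => _).
  under eq_fun do rewrite mulrC; apply => z.
  by rewrite ger0_norm.
(* approximation of beta(rho) by functions with finitely many values *)
pose I n k : set mR := [set s | n.+1%:R * (beta s + B) >= k%:R /\ n.+1%:R * (beta s + B) < k.+1%:R].
have mI n k : measurable (I n k).
  have mgb : measurable_fun [set: mR] (fun s : mR => n.+1%:R * (beta s + B) : R).
    by apply: measurable_funM => //; exact: measurable_funD.
  have -> : I n k = (fun s : mR => n.+1%:R * (beta s + B) : R) @^-1` (`[k%:R, k.+1%:R[%classic).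
    by apply/seteqP; split => s /=; rewrite in_itv/=; [by move=> [-> ->]|by move=> /andP[]].
  by rewrite -[X in measurable X]setTI; apply: mgb => //; exact: measurable_itv.
have step n K : \int[mu2]_z (\sum_(k < K) (k%:R / n.+1%:R) * (\1_(I n k) (rho z) * fl z)) = 0 /\
    intg mu2 (fun z => \sum_(k < K) (k%:R / n.+1%:R) * (\1_(I n k) (rho z) * fl z)).
  have i1 k : intg mu2 (fun z => \1_(I n k) (rho z) * fl z).
    apply: (@intg_indic _ _ _ mu2 fl (rho @^-1` I n k)) => //.
    by rewrite -[X in measurable X]setTI; exact: (sd_rho sd) measurableT _ (mI n k).
  elim: K => [|K [IH1 IH2]].
    have E : (fun z => \sum_(k < 0) (k%:R / n.+1%:R) * (\1_(I n k) (rho z) * fl z)) = cst 0.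
      by apply/funext => z; rewrite big_ord0.
    by rewrite E; split; [exact: Rint_cst0|exact: intg0].
  have E : (fun z => \sum_(k < K.+1) (k%:R / n.+1%:R) * (\1_(I n k) (rho z) * fl z)) =
     fun z => \sum_(k < K) (k%:R / n.+1%:R) * (\1_(I n k) (rho z) * fl z)
       + (K%:R / n.+1%:R) * (\1_(I n K) (rho z) * fl z).
    by apply/funext => z; rewrite big_ord_recr.
  rewrite E; split; last by apply: intgD => //; exact: intgZ.
  by rewrite RintD//; [rewrite IH1 add0r RintZ// level_set_flux// mulr0|exact: intgZ].
have bound n : `|\int[mu2]_z (g z * fl z)| <= n.+1%:R^-1 * \int[mu2]_z `|fl z|.
  (* Enough levels of height 1 / (n + 1) to exceed the bound 2 B of [g], so that every point falls
     into one of them. *)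
  pose K := (Num.trunc (n.+1%:R * (B + B))).+1.
  have [s0 si] := step n K.
  rewrite -[\int[mu2]_z (g z * fl z)]subr0 -[X in _ - X]s0 -RintB//.
  have id_ : intg mu2 (fun z => g z * fl z -
    \sum_(k < K) (k%:R / n.+1%:R) * (\1_(I n k) (rho z) * fl z)) by exact: intgB.
  apply: (le_trans (Rint_norm_le id_)).
  rewrite -RintZ; last exact: intg_norm.
  apply: Rint_le; [exact: intg_norm|exact/intgZ/intg_norm|] => z.
  have ng0 : 0 <= n.+1%:R * g z by rewrite mulr_ge0.
  have /Num.Theory.trunc_itv/andP[t1 t2] := ng0.
  set k0 := Num.trunc (n.+1%:R * g z) in t1 t2.
  have k0K : (k0 < K)%N.
    rewrite -(ltr_nat R) (le_lt_trans t1)// (@le_lt_trans _ _ (n.+1%:R * (B + B)))//.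
      by rewrite ler_wpM2l.
    by have /Num.Theory.trunc_itv/andP[] : 0 <= n.+1%:R * (B + B) by exact: le_trans ng0 (ler_wpM2l _ (gB z)).
  have -> : \sum_(k < K) (k%:R / n.+1%:R) * (\1_(I n k) (rho z) * fl z) = k0%:R / n.+1%:R * fl z.
    rewrite (bigD1 (Ordinal k0K))//= big1 ?addr0.
      by rewrite indicE mem_set ?mul1r.
    move=> k; rewrite -val_eqE/= => kk0; rewrite indicE memNset ?mul0r ?mulr0// => -[k1 k2].
    move/negP: kk0; apply; rewrite eqn_leq -(ltnS k) -(ltnS k0) -(ltr_nat R) -(ltr_nat R k0).
    by rewrite (le_lt_trans k1 t2) (le_lt_trans t1 k2).
  rewrite -mulrBl normrM ler_wpM2r//.
  have n0 : (0 : R) < n.+1%:R by rewrite ltr0n.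
  have e1 : k0%:R / n.+1%:R <= g z by rewrite ler_pdivrMr// mulrC.
  have e2 : g z <= k0%:R / n.+1%:R + n.+1%:R^-1.
    by rewrite -[X in _ + X]mul1r -mulrDl ler_pdivlMr// mulrC natr1 ltW.
  by rewrite ger0_norm ?subr_ge0// lerBlDl.
have Igfl : \int[mu2]_z (g z * fl z) = 0.
  apply/eqP; rewrite -normr_eq0; apply/eqP/le_anti; rewrite normr_ge0 andbT.
  have c : n.+1%:R^-1 * \int[mu2]_z `|fl z| @[n --> \oo] --> (0 * \int[mu2]_z `|fl z| : R).
    by apply: cvgM; [exact: cvg_harmonic|exact: cvg_cst].
  rewrite mul0r in c.
  by apply: (ler_cvg_to (@cvg_cst _ _ _ \oo _) c); exact: nearW.
rewrite -[RHS]subr0 -{1}Igfl -(mulr0 B) -Ifl -RintZ// -RintB//; last exact: intgZ.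
by apply: Rint_eq => z; rewrite /g; ring.
Qed.

End test.
End renormalization.

(** * Smooth bump functions *)

Section smooth.
Context {R : realType}.
Notation mR := (measurableTypeR R).
Notation mu := (@lebesgue_measure R).

Fixpoint Ck (k : nat) (f : R -> R) : Prop :=
  if k is k'.+1 then exists2 f', forall x : R, is_derive x 1 f (f' x) & Ck k' f'
  else continuous f.

Lemma is_derive_continuous (f f' : R -> R) :
  (forall x : R, is_derive x 1 f (f' x)) -> continuous f.
Proof.
move=> df x; apply: differentiable_continuous; apply/derivable1_diffP.
exact: (@ex_derive _ _ _ _ _ _ _ (df x)).
Qed.

Lemma Ck_continuous k f : Ck k f -> continuous f.
Proof. by case: k => //= k [f' df _]; exact: is_derive_continuous df. Qed.

Lemma CkW k f : Ck k.+1 f -> Ck k f.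
Proof.
elim: k f => [|k IH] f [f' df cf']; first exact: is_derive_continuous df.
by exists f' => //; exact: IH.
Qed.

Lemma Ck_cst k (c : R) : Ck k (cst c).
Proof.
elim: k c => [|k IH] c /=; first by move=> x; exact: cvg_cst.
by exists (cst 0) => // x; exact: is_derive_cst.
Qed.

Lemma CkD k f g : Ck k f -> Ck k g -> Ck k (fun x => f x + g x).
Proof.
elim: k f g => [|k IH] f g /=.
  by move=> cf cg x; apply: cvgD; [exact: cf|exact: cg].
move=> [f' df cf] [g' dg cg]; exists (fun x => f' x + g' x); last exact: IH.
by move=> x; exact: is_deriveD.
Qed.

Lemma CkM k f g : Ck k f -> Ck k g -> Ck k (fun x => f x * g x).
Proof.
elim: k f g => [|k IH] f g.
  by move=> cf cg x; apply: cvgM; [exact: cf|exact: cg].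
move=> Cf Cg; have [f' df cf] := Cf; have [g' dg cg] := Cg.
exists (fun x => f' x * g x + f x * g' x); last first.
  by apply: CkD; apply: IH => //; exact: CkW.
move=> x; have := is_deriveM (df x) (dg x).
by move=> /is_derive_eq; apply; rewrite /GRing.scale/= addrC mulrC.
Qed.

Lemma CkB k f g : Ck k f -> Ck k g -> Ck k (fun x => f x - g x).
Proof.
move=> cf cg; have := CkD cf (CkM (Ck_cst k (-1)) cg).
by congr Ck; apply/funext => x; rewrite mulN1r.
Qed.

Lemma is_derive_affine (f : R -> R) (c d x l : R) : is_derive (c * x + d) 1 f l ->
  is_derive x 1 (fun x => f (c * x + d)) (l * c).
Proof.
move=> df.
have dg : is_derive x 1 (fun x : R => c * x + d) c.
  by apply: is_derive_eq; rewrite addr0 [LHS]mulr1.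
have := @is_derive1_comp _ f (fun x : R => c * x + d) x l c df dg.
exact.
Qed.

Lemma Ck_affine k f (c d : R) : Ck k f -> Ck k (fun x => f (c * x + d)).
Proof.
elim: k f => [|k IH] f /=.
  move=> cf x; apply: (@cvg_comp _ _ _ (fun x : R => c * x + d) f _ (nbhs (c * x + d))).
    by apply: cvgD; [apply: cvgM; [exact: cvg_cst|exact: cvg_id]|exact: cvg_cst].
  exact: cf.
move=> [f' df cf]; exists (fun x => f' (c * x + d) * c).
  by move=> x; exact: is_derive_affine.
by apply: CkM; [exact: IH|exact: Ck_cst].
Qed.

Section flat.
Implicit Type p : {poly R}.

(** The family is closed under differentiation: on t > 0 the derivative has the same form with the
    polynomial X^2 (p - p'). Smoothness of all orders then follows by one induction over all [p]. *)
Definition flat p (t : R) : R := if 0 < t then p.[t^-1] * expR (- t^-1) else 0.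

(** The inequality 1 + x <= exp x at x = y / n, raised to the power n. *)
Lemma exprn_le_expR n (y : R) : 0 <= y -> y ^+ n <= n%:R ^+ n * expR y.
Proof.
case: n => [|n] y0; first by rewrite !expr0 mul1r -expR0 ler_expR.
have n0 : (0 : R) < n.+1%:R by rewrite ltr0n.
have -> : expR y = expR (y / n.+1%:R) ^+ n.+1.
  by rewrite -expRM_natl -mulr_natl mulrCA divff ?mulr1// lt0r_neq0.
rewrite -exprMn; apply: lerXn2r; rewrite ?nnegrE ?mulr_ge0 ?expR_ge0//.
rewrite mulrC -ler_pdivrMr//.
by apply: le_trans (expR_ge1Dx _); rewrite lerDr.
Qed.

Lemma poly_le_expR p : exists2 C, 0 <= C & forall y, 0 <= y -> `|p.[y]| <= C * expR y.
Proof.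
exists (\sum_(i < size p) `|p`_i| * i%:R ^+ i) => [|y y0].
  by apply: sumr_ge0 => i _; rewrite mulr_ge0// exprn_ge0.
rewrite horner_coef mulr_suml; apply: (le_trans (ler_norm_sum _ _ _)).
apply: ler_sum => i _; rewrite normrM -mulrA ler_wpM2l//.
by rewrite ger0_norm ?exprn_ge0// exprn_le_expR.
Qed.

(** The exponential beats the polynomial X^2 p at 1/t, and the factor X^2 supplies the t^2. Such a
    bound gives derivative 0 at the origin, where the formula for t > 0 does not apply. *)
Lemma flat_quadratic p : exists C, forall t, `|flat p t| <= C * t ^+ 2.
Proof.
have [C C0 H] := poly_le_expR ('X^2 * p).
exists C => t; rewrite /flat; case: ifPn => [t0|_]; last first.
  by rewrite normr0 mulr_ge0// sqr_ge0.
have := H t^-1; rewrite invr_ge0 ltW// => /(_ isT).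
rewrite hornerM hornerXn normrM -(ler_pM2r (expR_gt0 (- t^-1))).
rewrite -[leRHS]mulrA -expRD subrr expR0 mulr1 => H1.
rewrite normrM [ `|expR _|]ger0_norm ?expR_ge0//.
rewrite -ler_pdivrMr ?exprn_gt0//; apply: le_trans H1.
have i0 : 0 <= t^-1 by rewrite invr_ge0 ltW.
by rewrite (ger0_norm (exprn_ge0 2 i0)) exprVn -[leRHS]mulrA [leRHS]mulrC.
Qed.

Lemma is_derive_quadratic (f : R -> R) (C : R) : (forall t, `|f t| <= C * t ^+ 2) ->
  is_derive (0 : R) 1 f 0.
Proof.
move=> H.
have f0 : f 0 = 0.
  by apply/eqP; rewrite -normr_le0 (le_trans (H 0))// expr0n/= mulr0.
have c : h^-1 *: ((f \o shift 0) (h *: 1) - f 0) @[h --> 0^'] --> (0 : R).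
  apply/cvgr0Pnorm_lt => e e0; near=> h.
  have h0 : h != 0 by near: h; exact: nbhs_dnbhs_neq.
  rewrite /= f0 addr0 subr0 /GRing.scale/= mulr1 normrM normfV mulrC.
  rewrite ltr_pdivrMr ?normr_gt0//; apply: (le_lt_trans (H h)).
  rewrite -real_normK ?num_real// expr2 mulrA ltr_pM2r ?normr_gt0//.
  apply: (@le_lt_trans _ _ ((`|C| + 1) * `|h|)).
    by rewrite ler_wpM2r// (le_trans (ler_norm C))// lerDl.
  rewrite mulrC -ltr_pdivlMr ?ltr_wpDl//.
  by near: h; apply: dnbhs0_lt; rewrite divr_gt0// ltr_wpDl.
by apply: DeriveDef; [exact: cvgP c|exact: cvg_lim c].
Unshelve. all: by end_near.
Qed.

Lemma is_derive_flat p (t : R) :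
  is_derive t 1 (flat p) (flat ('X^2 * (p - p^`())) t).
Proof.
have [t0|t0|->] := ltgtP t 0.
- have -> : flat ('X^2 * (p - p^`())) t = 0 by rewrite /flat ltNge (ltW t0).
  apply: (@near_eq_is_derive _ _ _ (cst 0)).
    by apply: filterS (lt_nbhsl t0) => s s0; rewrite /flat ltNge (ltW s0).
- have E : flat ('X^2 * (p - p^`())) t =
      p.[t^-1] *: (expR (- t^-1) * - (- t ^- 2 *: 1)) + expR (- t^-1) *: (p^`().[t^-1] * (- t ^- 2 *: 1)).
    by rewrite /flat t0 !hornerE /GRing.scale/= exprVn; ring.
  rewrite E; apply: (@near_eq_is_derive _ _ _ (fun s : R => p.[s^-1] * expR (- s^-1))).
    by apply: filterS (lt_nbhsr t0) => s s0; rewrite /flat s0.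
  have dV : is_derive t 1 (fun s : R => s^-1) (- t ^- 2 *: 1).
    by apply: (@is_deriveV _ id); rewrite gt_eqF.
  have d1 : is_derive t 1 (fun s : R => p.[s^-1]) (p^`().[t^-1] * (- t ^- 2 *: 1)).
    exact: (is_derive1_comp (is_derive_poly p _) dV).
  have d2 : is_derive t 1 (fun s : R => expR (- s^-1)) (expR (- t^-1) * - (- t ^- 2 *: 1)).
    exact: (is_derive1_comp (is_derive_expR _) (is_deriveN dV)).
  exact: (is_deriveM d1 d2).
- have [C H] := flat_quadratic p.
  have -> : flat ('X^2 * (p - p^`())) 0 = 0 by rewrite /flat ltxx.
  exact: is_derive_quadratic H.
Qed.

Lemma Ck_flat k p : Ck k (flat p).
Proof.
elim: k p => [|k IH] p; last first.
  by exists (flat ('X^2 * (p - p^`()))) => // t; exact: is_derive_flat.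
exact: is_derive_continuous (is_derive_flat p).
Qed.

End flat.

Definition bump (p q : R) (n : nat) (t : R) : R :=
  flat 1 (n.+1%:R * (t - p)) * flat 1 (n.+1%:R * (q - t)).

Lemma flat1_ge0 (t : R) : 0 <= flat 1 t.
Proof. by rewrite /flat; case: ifP => // _; rewrite hornerC mul1r expR_ge0. Qed.

Lemma flat1_le1 (t : R) : flat 1 t <= 1.
Proof.
rewrite /flat; case: ifP => // t0; rewrite hornerC mul1r -expR0 ler_expR.
by rewrite oppr_le0 invr_ge0 ltW.
Qed.

Lemma flat1_cvg (x : R) : flat 1 (n.+1%:R * x) @[n --> \oo] --> ((0 < x)%R%:R : R).
Proof.
rewrite /flat; under eq_fun do rewrite pmulr_rgt0//.
case: ltP => [x0|_] /=; last exact: cvg_cst.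
under eq_fun do rewrite hornerC mul1r invfM.
have c : - (n.+1%:R^-1 * x^-1) @[n --> \oo] --> (0 : R).
  rewrite -[X in _ --> X]oppr0 -(mul0r x^-1).
  by apply: cvgN; apply: cvgM; [exact: cvg_harmonic|exact: cvg_cst].
have := cvg_comp _ _ c (@continuous_expR R 0); rewrite expR0; exact.
Qed.

Lemma Ck_bump k p q n : Ck k (bump p q n).
Proof.
have F c d : Ck k (fun t : R => flat 1 (c * t + d)) by apply: Ck_affine; exact: Ck_flat.
have := CkM (F n.+1%:R (- (n.+1%:R * p))) (F (- n.+1%:R) (n.+1%:R * q)).
congr Ck; apply/funext => t; rewrite /bump; congr (flat 1 _ * flat 1 _); ring.
Qed.

Lemma bump_ge0 p q n t : 0 <= bump p q n t.
Proof. by rewrite mulr_ge0 ?flat1_ge0. Qed.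

Lemma bump_le p q n t : bump p q n t <= \1_(`]p, q[%classic) t.
Proof.
rewrite indicE mem_setE in_itv/=; case: (boolP (p < t < q)) => /= [_|].
  by rewrite -[leRHS]mulr1 ler_pM ?flat1_ge0 ?flat1_le1.
rewrite negb_and -!leNgt /bump /flat !pmulr_rgt0// !subr_gt0 => /orP[h|h].
  by rewrite ltNge h/= mul0r.
by rewrite [t < q]ltNge h/= mulr0.
Qed.

Lemma bump_norm_le p q n t : `|bump p q n t| <= \1_(`]p, q[%classic) t.
Proof. by rewrite ger0_norm ?bump_ge0 ?bump_le. Qed.

Lemma bump_cvg p q t : bump p q n t @[n --> \oo] --> (\1_(`]p, q[%classic) t : R).
Proof.
have -> : \1_(`]p, q[%classic) t = (0 < t - p)%R%:R * (0 < q - t)%R%:R :> R.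
  by rewrite indicE mem_setE in_itv/= !subr_gt0 -natrM mulnb.
by apply: cvgM; exact: flat1_cvg.
Qed.

Lemma measurable_continuous (f : R -> R) : continuous f ->
  measurable_fun [set: mR] (f : mR -> R).
Proof. exact: continuous_measurable_fun. Qed.

Lemma bump_intg p q n : intg mu (bump p q n).
Proof.
apply: (@intg_le _ mR R mu _ (fun t => \1_(`]p, q[%classic) t)).
- exact: measurable_continuous (Ck_continuous (Ck_bump 0 p q n)).
- exact: bump_norm_le.
- exact: itvoo_intg.
Qed.

Lemma prim1_is_derive (a : R -> R) (x : R) : intg mu a -> continuous a ->
  is_derive x 1 (prim1 a) (a x).
Proof.
move=> ia ca.
have xx : x < x + 1 by rewrite ltrDl.
have ix : mu.-integrable `]-oo, (x + 1)] (EFin \o a).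
  exact: (integrableS (E := setT)).
have [dF F'E] := @continuous_FTC1 R a -oo%O x (x + 1) xx ix (ltNyr _) (ca x).
by split; [exact: dF|rewrite -derive1E].
Qed.

Lemma Ck_prim1 k a : intg mu a -> Ck k a -> Ck k.+1 (prim1 a).
Proof.
move=> ia ca; exists a => // x.
by apply: prim1_is_derive => //; exact: Ck_continuous ca.
Qed.

(** A primitive of a bump becomes compactly supported, even when the bump has nonzero integral,
    after subtracting its translate. The derivative acquires a second bump, which a large [T] moves
    to the left of the support of the field. *)
Definition two_sided_prim (a : R -> R) (T x : R) : R := prim1 a x - prim1 a (x + T).

Lemma Ck_two_sided_prim k a T : intg mu a -> (forall j, Ck j a) ->
  Ck k (two_sided_prim a T).
Proof.
move=> ia ca; have cp : Ck k (prim1 a) by apply: CkW; exact: Ck_prim1.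
have := CkB cp (Ck_affine 1 T cp); congr Ck; apply/funext => x.
by rewrite mul1r.
Qed.

Lemma is_derive_two_sided_prim (a : R -> R) (T x : R) : intg mu a -> continuous a ->
  is_derive x 1 (two_sided_prim a T) (a x - a (x + T)).
Proof.
move=> ia ca; have d y := prim1_is_derive y ia ca.
have dT : is_derive x 1 (fun x => prim1 a (1 * x + T)) (a (1 * x + T) * 1).
  by apply: is_derive_affine; exact: d.
have := is_deriveB (d x) dT; rewrite mulr1 mul1r => H.
have -> // : two_sided_prim a T = prim1 a - (fun x => prim1 a (1 * x + T)).
by apply/funext => y; rewrite /two_sided_prim !fctE mul1r.
Qed.

Lemma prim1_eq0 (a : R -> R) p x : (forall t, t <= p -> a t = 0) -> x <= p -> prim1 a x = 0.
Proof.
move=> a0 xp; rewrite /prim1 Rint_in -[RHS](@Rint_cst0 _ mR R mu).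
apply: Rint_eq => t; rewrite indicE mem_setE in_itv/=.
by case: leP => [tx|]; rewrite ?mul0r// a0 ?mulr0// (le_trans tx).
Qed.

Lemma prim1_eq_total (a : R -> R) q x : (forall t, q <= t -> a t = 0) -> q <= x ->
  prim1 a x = \int[mu]_t a t.
Proof.
move=> a0 qx; rewrite /prim1 Rint_in; apply: Rint_eq => t; rewrite indicE mem_setE in_itv/=.
by case: leP => [tx|xt]; rewrite ?mul1r// mul0r a0// (le_trans qx)// ltW.
Qed.

Lemma two_sided_prim_support (a : R -> R) p q T x : 0 <= T ->
  (forall t, t <= p -> a t = 0) -> (forall t, q <= t -> a t = 0) ->
  two_sided_prim a T x != 0 -> p - T <= x <= q.
Proof.
move=> T0 ap aq; apply: contra_neqT; rewrite negb_and -!ltNge /two_sided_prim => /orP[xp|qx].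
  rewrite (prim1_eq0 ap) ?(prim1_eq0 (x := x + T) ap) ?subrr//.
    by rewrite -lerBrDr ltW.
  by rewrite ltW// (lt_le_trans xp)// lerBlDr lerDl.
by rewrite !(prim1_eq_total aq) ?subrr// ltW// (lt_le_trans qx)// lerDl.
Qed.

Lemma is_derive_slice1 (F : R * R -> R) (z : R * R) (l : R) :
  is_derive z.1 1 (fun x => F (x, z.2)) l <-> is_derive z ((1, 0) : R * R) F l.
Proof.
have E : (fun h : R => h^-1 *: ((F \o shift z) (h *: ((1, 0) : R * R)) - F z)) =
    (fun h : R => h^-1 *: (((fun x => F (x, z.2)) \o shift z.1) (h *: (1 : R)) - F (z.1, z.2))).
  apply/funext => h; case: z => x y; congr (_ *: (F _ - _)).
  by congr pair; rewrite [X in X + _]scaler0 add0r.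
by split=> -[d e]; split; move: d e; rewrite /derivable /derive E.
Qed.

Lemma is_derive_slice2 (F : R * R -> R) (z : R * R) (l : R) :
  is_derive z.2 1 (fun y => F (z.1, y)) l <-> is_derive z ((0, 1) : R * R) F l.
Proof.
have E : (fun h : R => h^-1 *: ((F \o shift z) (h *: ((0, 1) : R * R)) - F z)) =
    (fun h : R => h^-1 *: (((fun y => F (z.1, y)) \o shift z.2) (h *: (1 : R)) - F (z.1, z.2))).
  apply/funext => h; case: z => x y; congr (_ *: (F _ - _)).
  by congr pair; rewrite [X in X + _]scaler0 add0r.
by split=> -[d e]; split; move: d e; rewrite /derivable /derive E.
Qed.

Lemma class_C_continuous k (F : R * R -> R) : class_C k F -> continuous F.
Proof. by case: k => [|k] []. Qed.

Lemma is_derive_tensor1 (f f' g : R -> R) z : (forall x : R, is_derive x 1 f (f' x)) ->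
  is_derive z ((1, 0) : R * R) (fun z => f z.1 * g z.2) (f' z.1 * g z.2).
Proof.
move=> df; apply/is_derive_slice1 => /=.
have -> : (fun x => f x * g z.2) = (g z.2) \*: f by apply/funext => x; rewrite /= mulrC.
by apply: is_derive_eq; rewrite /GRing.scale/= mulrC.
Qed.

Lemma is_derive_tensor2 (f g g' : R -> R) z : (forall x : R, is_derive x 1 g (g' x)) ->
  is_derive z ((0, 1) : R * R) (fun z => f z.1 * g z.2) (f z.1 * g' z.2).
Proof. by move=> dg; apply/is_derive_slice2 => /=; exact: is_deriveZ. Qed.

Lemma partial1_tensor (f f' g : R -> R) : (forall x : R, is_derive x 1 f (f' x)) ->
  partial1 (fun z => f z.1 * g z.2) = fun z => f' z.1 * g z.2.
Proof.
move=> df; apply/funext => z; rewrite /partial1.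
by have d := is_derive_tensor1 g z df; exact: derive_val.
Qed.

Lemma partial2_tensor (f g g' : R -> R) : (forall x : R, is_derive x 1 g (g' x)) ->
  partial2 (fun z => f z.1 * g z.2) = fun z => f z.1 * g' z.2.
Proof.
move=> dg; apply/funext => z; rewrite /partial2.
by have d := is_derive_tensor2 f z dg; exact: derive_val.
Qed.

Lemma class_C_tensor k f g : Ck k f -> Ck k g -> class_C k (fun z => f z.1 * g z.2).
Proof.
elim: k f g => [|k IH] f g.
  move=> cf cg; split=> // z.
  by apply: cvgM; [apply: continuous_comp; [exact: cvg_fst|exact: cf]
                  |apply: continuous_comp; [exact: cvg_snd|exact: cg]].
move=> Cf Cg; have [f' df cf] := Cf; have [g' dg cg] := Cg.
split; first exact: class_C_continuous (IH _ _ (CkW Cf) (CkW Cg)).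
split.
- by move=> z; have d := is_derive_tensor1 g z df; exact: ex_derive.
- by move=> z; have d := is_derive_tensor2 f z dg; exact: ex_derive.
- by rewrite (partial1_tensor _ df); apply: IH => //; exact: CkW.
- by rewrite (partial2_tensor _ dg); apply: IH => //; exact: CkW.
Qed.

Lemma test_function_tensor f g (p q : R) : (forall k, Ck k f) -> (forall k, Ck k g) ->
  (forall x, f x != 0 -> p <= x <= q) -> (forall y, g y != 0 -> p <= y <= q) ->
  test_function (fun z => f z.1 * g z.2).
Proof.
move=> cf cg sf sg; split; first by move=> k; exact: class_C_tensor.
have cb : compact (`[p, q]%classic `*` `[p, q]%classic : set (R * R)).
  by apply: compact_setX; exact: segment_compact.
apply: (subclosed_compact (@closed_closure _ _) cb).
have clb : closed (`[p, q]%classic `*` `[p, q]%classic : set (R * R)).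
  by apply: compact_closed => //; exact: norm_hausdorff.
rewrite closureE => z; apply; split=> // y /=; rewrite mulf_eq0 negb_or => /andP[f0 g0].
by split; rewrite /= in_itv/=; [exact: sf|exact: sg].
Qed.

End smooth.

(** * Existence of the stream function *)

Section poincare.
Context {R : realType}.
Notation mR := (measurableTypeR R).
Notation mu := (@lebesgue_measure R).
Notation mu2 := (lebesgue2 R).

Lemma tensor_intg (g b : R -> R) : intg mu g -> intg mu b ->
  intg mu2 (fun z => g z.1 * b z.2).
Proof.
move=> ig ib; apply: intg_tonelli.
- apply: measurable_funM.
    exact: (measurableT_comp (intg_meas ig) measurable_fst).
  exact: (measurableT_comp (intg_meas ib) measurable_snd).
- by apply: aeW => x; exact: (intgZ (g x) ib).
- have := intgZ (\int[mu]_y `|b y|) (intg_norm ig); congr intg; apply/funext => x /=.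
  rewrite mulrC -RintZ; last exact: intg_norm.
  by apply: Rint_eq => y; rewrite normrM.
Qed.

Lemma Rint_swap (f : mR * mR -> R) : intg mu2 f ->
  \int[mu]_x \int[mu]_y f (x, y) = \int[mu]_y \int[mu]_x f (x, y).
Proof.
move=> fi; have [_ <-] := Rint_fubini fi.
rewrite -(mpres_Rint swap_mpres (intg_meas fi)).
by have [_ ->] := Rint_fubini (mpres_intg swap_mpres fi).
Qed.

(* the primitives may be exchanged because [two_sided_prim b T] equals
   [- \int_(y, +oo) b] on the support of [g] *)
Lemma prim1_parts (g b : R -> R) (M N T : R) : intg mu g -> intg mu b ->
  (forall y, M < `|y| -> g y = 0) -> (forall t, N <= t -> b t = 0) -> N + M <= T ->
  \int[mu]_y (g y * two_sided_prim b T y) = - \int[mu]_t (prim1 g t * b t).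
Proof.
move=> ig ib g0 b0 NMT.
pose f (z : R * R) := \1_[set z : mR * mR | (z.1 : R) < z.2] z * (g z.1 * b z.2).
have mL : measurable [set z : mR * mR | (z.1 : R) < z.2].
  have -> : [set z : mR * mR | (z.1 : R) < z.2] = ~` [set z : mR * mR | (z.2 : R) <= z.1].
    by apply/seteqP; split => z /=; rewrite ltNge; move/negP.
  apply: measurableC; rewrite -[X in measurable X]setTI.
  by apply: measurable_fun_le.
have fi : intg mu2 f by apply: intg_indic => //; exact: tensor_intg.
have I1 y : g y * two_sided_prim b T y = - \int[mu]_t f (y, t).
  have E : \int[mu]_t f (y, t) = g y * \int[mu]_t (\1_(`]y, +oo[%classic) t * b t).
    rewrite -RintZ; last by apply: intg_indic => //; exact: measurable_itv.
    apply: Rint_eq => t; rewrite /f mulrCA; congr (_ * (_ * _)).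
    by rewrite !indicE !mem_setE/= in_itv/= andbT.
  rewrite E; have [My|yM] := ltP M `|y|; first by rewrite g0// !mul0r oppr0.
  rewrite -mulrN; congr (_ * _); rewrite /two_sided_prim.
  rewrite [X in _ - X](prim1_eq_total b0); last first.
    by move: yM; rewrite ler_norml => /andP[? _]; lra.
  suff -> : \int[mu]_t b t = prim1 b y + \int[mu]_t (\1_(`]y, +oo[%classic) t * b t).
    by rewrite opprD addrA subrr add0r.
  rewrite /prim1 [X in _ = X + _]Rint_in -RintD; [|by apply: intg_indic => //; exact: measurable_itv..].
  apply: Rint_eq => t; rewrite -mulrDl !indicE !mem_setE !in_itv/= andbT.
  by case: leP => _; rewrite ?addr0 ?add0r mul1r.
have I2 t : \int[mu]_y f (y, t) = prim1 g t * b t.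
  rewrite /prim1 [X in _ = X * _]Rint_in mulrC -RintZ; last by apply: intg_indic => //; exact: measurable_itv.
  have mf : measurable_fun [set: mR] (fun y : mR => f (y, t)).
    exact: (measurableT_comp (intg_meas fi) (measurable_pair2 t)).
  apply: Rint_ae => //.
    apply: measurable_funM => //; apply: intg_meas.
    by apply: (intg_indic (m := mu)) => //; exact: measurable_itv.
  have ae_t : {ae mu, forall y : mR, (y : R) != t}.
    exists [set t]; split; first exact: measurable_set1.
      exact: lebesgue_measure_set1.
    by move=> y /=; apply: contra_notP => /eqP.
  apply: (ae_mono ae_t) => y yt; rewrite /f [RHS]mulrC -[RHS]mulrA; congr (_ * _).
  rewrite !indicE [in RHS]mem_setE in_itv/=.
  have -> : ((y, t) \in [set z : mR * mR | (z.1 : R) < z.2]) = ((y : R) < t).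
    by apply/idP/idP; rewrite inE.
  by rewrite lt_neqAle yt.
transitivity (\int[mu]_y (- \int[mu]_t f (y, t))); first exact: Rint_eq.
rewrite RintN; last by have [] := Rint_fubini fi.
rewrite (Rint_swap fi); congr (- _); apply: Rint_eq => t; exact: I2.
Qed.

Lemma prim_parts (u : R * R -> R) (a b : R -> R) (M N T : R) : regular_slices u M ->
  measurable_fun [set: mR] (a : mR -> R) -> (forall x, `|a x| <= 1) ->
  intg mu b -> (forall x, `|b x| <= 1) -> (forall x, N <= `|x| -> b x = 0) -> N + M <= T ->
  intg mu2 (fun z => u z * (a z.1 * two_sided_prim b T z.2)) /\
  intg mu2 (fun z => prim u z * (a z.1 * b z.2)) /\
  \int[mu2]_z (u z * (a z.1 * two_sided_prim b T z.2)) =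
  - \int[mu2]_z (prim u z * (a z.1 * b z.2)).
Proof.
move=> su ma a1 ib b1 b0 NMT.
have [mu_ u0 _ _] := su.
have mB : measurable_fun [set: mR] (two_sided_prim b T : mR -> R).
  apply: measurable_funB; first exact: measurable_prim1.
  exact: (measurableT_comp (measurable_prim1 ib) (shift1_mpres T).1).
have Bb y : `|two_sided_prim b T y| <= \int[mu]_t `|b t| + \int[mu]_t `|b t|.
  by rewrite (le_trans (ler_normB _ _))// lerD//; exact: prim1_bound.
have i1 : intg mu2 (fun z => u z * (a z.1 * two_sided_prim b T z.2)).
  apply: (intg_mulb (C := 1 * (\int[mu]_t `|b t| + \int[mu]_t `|b t|))).
  - exact: regular_intg su.
  - apply: measurable_funM; first exact: (measurableT_comp ma measurable_fst).
    exact: (measurableT_comp mB measurable_snd).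
  - by move=> z; rewrite normrM ler_pM.
have i2 : intg mu2 (fun z => prim u z * (a z.1 * b z.2)).
  have := @intg_mulb _ _ _ mu2 _ (fun z => a z.1 * b z.2) 1 (prim_strip_intg su N).
  have E : (fun z => \1_(itvM N) z.2 * prim u z * (a z.1 * b z.2)) =
      fun z => prim u z * (a z.1 * b z.2).
    apply/funext => z; have [bz|bz] := eqVneq (b z.2) 0; first by rewrite bz !mulr0.
    rewrite in_itvM ?mul1r// leNgt; apply: contra bz => /ltW Nz.
    by rewrite b0.
  rewrite E; apply.
  - apply: measurable_funM; first exact: (measurableT_comp ma measurable_fst).
    exact: (measurableT_comp (intg_meas ib) measurable_snd).
  - by move=> z; rewrite normrM -[leRHS]mulr1 ler_pM.
split=> //; split=> //.
have [_ ->] := Rint_fubini i1; have [j ->] := Rint_fubini i2.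
rewrite -RintN//; apply: Rint_eq => x /=.
transitivity (a x * \int[mu]_y (u (x, y) * two_sided_prim b T y)).
  rewrite -RintZ; first by apply: Rint_eq => y; rewrite mulrCA.
  apply: (intg_mulb (C := \int[mu]_t `|b t| + \int[mu]_t `|b t|)).
  - exact: (regular_slice su x).
  - exact: mB.
  - exact: Bb.
rewrite (@prim1_parts _ _ M N T (regular_slice su x) ib)//; last 2 first.
- by move=> y My; apply: u0; right.
- by move=> t Nt; apply: b0; rewrite (le_trans Nt)// ler_norm.
rewrite mulrN; congr (- _).
rewrite -RintZ; first by apply: Rint_eq => y; rewrite mulrCA.
have pb y := prim1_bound y (regular_slice su x).
have := intg_mulb ib (measurable_prim1 (regular_slice su x)) pb.
by congr intg; apply/funext => y; rewrite mulrC.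
Qed.

Section stream_function.
Variables (u1 u2 : R * R -> R) (M : R).
Hypothesis (su1 : regular_slices u1 M) (su2 : regular_slices u2 M).

(** The test function is A(x) B(y), where A and B have derivatives a and b on the support of the
    field. Moving B onto [u1] and A onto [u2] by parts turns the vanishing divergence into equality
    of the two primitives against a(x) b(y). *)
Lemma poincare_test (a b : R -> R) (N : R) :
  div_free (fun z => (u1 z, - u2 (swp z))) ->
  (forall k, Ck k a) -> (forall k, Ck k b) -> intg mu a -> intg mu b ->
  (forall x, `|a x| <= 1) -> (forall x, `|b x| <= 1) ->
  (forall x, N <= `|x| -> a x = 0) -> (forall x, N <= `|x| -> b x = 0) ->
  intg mu2 (fun z => prim u1 z * (a z.1 * b z.2)) /\
  intg mu2 (fun z => prim u2 (swp z) * (a z.1 * b z.2)) /\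
  \int[mu2]_z (prim u1 z * (a z.1 * b z.2)) =
  \int[mu2]_z (prim u2 (swp z) * (a z.1 * b z.2)).
Proof.
move=> dv ca cb ia ib a1 b1 a0 b0.
pose T := Num.max 0 (N + M).
have NMT : N + M <= T by rewrite le_max lexx orbT.
have T0 : 0 <= T by rewrite le_max lexx.
pose A := two_sided_prim a T; pose B := two_sided_prim b T.
have dA (x : R) : is_derive x 1 A (a x - a (x + T)).
  by apply: is_derive_two_sided_prim => //; exact: Ck_continuous (ca 0).
have dB (x : R) : is_derive x 1 B (b x - b (x + T)).
  by apply: is_derive_two_sided_prim => //; exact: Ck_continuous (cb 0).
have supp (c : R -> R) : (forall x, N <= `|x| -> c x = 0) ->
    forall x, two_sided_prim c T x != 0 -> - N - T <= x <= N.
  move=> c0 x; apply: two_sided_prim_support => // t h; apply: c0.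
    by rewrite -normrN (le_trans _ (ler_norm _))// lerNr.
  by rewrite (le_trans h)// ler_norm.
have tf : test_function (fun z => A z.1 * B z.2).
  apply: (@test_function_tensor _ _ _ (- N - T) N).
  - by move=> k; exact: Ck_two_sided_prim.
  - by move=> k; exact: Ck_two_sided_prim.
  - exact: supp.
  - exact: supp.
have [mu1 z1 _ _] := su1; have [mu2_ z2 _ _] := su2.
have [i1 [j1 E1]] := prim_parts su1 (intg_meas ia) a1 ib b1 b0 NMT.
have [i2 [j2 E2]] := prim_parts su2 (intg_meas ib) b1 ia a1 a0 NMT.
have i2' : intg mu2 (fun z => u2 (swp z) * (b z.2 * two_sided_prim a T z.1)).
  exact: (mpres_intg swap_mpres i2).
have j2' : intg mu2 (fun z => prim u2 (swp z) * (a z.1 * b z.2)).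
  have := mpres_intg swap_mpres j2; congr intg; apply/funext => z /=.
  by rewrite [X in _ = _ * X]mulrC.
split; first exact: j1.
split; first exact: j2'.
(* For |x| <= M the point x + T is at least N, so the translated bumps in the derivatives are
   invisible to the field. *)
have shift0 (c : R -> R) x : (forall x, N <= `|x| -> c x = 0) -> `|x| <= M -> c (x + T) = 0.
  move=> c0; rewrite ler_norml => /andP[x1 _]; apply: c0.
  apply: (le_trans _ (ler_norm _)); apply: le_trans (lerD x1 NMT).
  by rewrite addrCA addNr addr0.
have := dv _ tf.
rewrite (partial1_tensor B dA) (partial2_tensor A dB) /=.
have -> : (fun z : R * R => (u1 z * ((a z.1 - a (z.1 + T)) * B z.2) +
     - u2 (swp z) * (A z.1 * (b z.2 - b (z.2 + T))))%:E) =
   (fun z : R * R => (u1 z * (a z.1 * B z.2) - u2 (swp z) * (b z.2 * A z.1))%:E).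
  apply/funext => z; congr (_%:E).
  have [zM|] := boolP ((`|z.1| <= M) && (`|z.2| <= M)).
    by have /andP[h1 h2] := zM; rewrite (shift0 a)// (shift0 b)// !subr0 mulNr [b z.2 * _]mulrC.
  rewrite negb_and -!ltNge => /orP h.
  have -> : u1 z = 0 by exact: z1.
  have -> : u2 (swp z) = 0 by apply: z2; case: h; [right|left].
  by rewrite oppr0 !mul0r subr0 addr0.
rewrite (intgE (intgB i1 i2')) => /(congr1 fine) /=.
rewrite (RintB i1 i2') => /subr0_eq E.
have {}E : \int[mu2]_z (u1 z * (a z.1 * B z.2)) = \int[mu2]_z (u2 z * (b z.1 * A z.2)).
  rewrite E; exact: (mpres_Rint swap_mpres (intg_meas i2)).
have {}E := etrans (esym E1) (etrans E E2).
rewrite (oppr_inj E) -(mpres_Rint swap_mpres (intg_meas j2)).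
by apply: Rint_eq => z /=; rewrite [b _ * _]mulrC.
Qed.

Let D z := prim u1 z - prim u2 (swp z).

Let mD : measurable_fun [set: mR * mR] (D : mR * mR -> R).
Proof.
apply: measurable_funB; first exact: measurable_prim su1.
exact: (measurable_swp (measurable_prim su2)).
Qed.

Let box_D (N : R) : intg mu2 (fun z => \1_(itvM N) z.1 * \1_(itvM N) z.2 * D z).
Proof.
have i1 := prim_strip_intg su1 N.
have i2 := mpres_intg swap_mpres (prim_strip_intg su2 N).
have bd1 (z : R * R) : `|\1_(itvM N) z.1 : R| <= 1 by exact: indic_norm1.
have bd2 (z : R * R) : `|\1_(itvM N) z.2 : R| <= 1 by exact: indic_norm1.
have := intgB (intg_mulb i1 (measurable_itvM1 N) bd1) (intg_mulb i2 (measurable_itvM2 N) bd2).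
by congr intg; apply/funext => z; rewrite /D /swp /=; ring.
Qed.

Lemma poincare_rect (p q p' q' : R) : div_free (fun z => (u1 z, - u2 (swp z))) ->
  \int[mu2]_z (\1_(`]p, q[%classic) z.1 * \1_(`]p', q'[%classic) z.2 * D z) = 0.
Proof.
move=> dv.
pose N := `|p| + `|q| + (`|p'| + `|q'|).
have [Np Nq Np' Nq'] : [/\ `|p| <= N, `|q| <= N, `|p'| <= N & `|q'| <= N].
  have := normr_ge0 p; have := normr_ge0 q; have := normr_ge0 p'; have := normr_ge0 q'.
  by rewrite /N; split; lra.
have b0 (r s : R) n x : `|r| <= N -> `|s| <= N -> N <= `|x| -> bump r s n x = 0.
  move=> rN sN Nx; apply/eqP; rewrite -normr_le0 (le_trans (bump_norm_le _ _ _ _))//.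
  rewrite indicE mem_setE in_itv/=; case: (boolP (r < x < s)) => // /andP[rx xs].
  exfalso; move: rN sN Nx; rewrite !ler_norml => /andP[r1 r2] /andP[s1 s2].
  by apply/negP; rewrite -ltNge ltr_norml; apply/andP; split; lra.
have b1 (r s : R) n x : `|bump r s n x| <= 1.
  by rewrite (le_trans (bump_norm_le _ _ _ _))// (le_trans (ler_norm _))// indic_norm1.
pose f n z := bump p q n z.1 * bump p' q' n z.2 * D z.
have mb (r s : R) n : measurable_fun [set: mR] (bump r s n : mR -> R).
  exact: intg_meas (bump_intg r s n).
have mbb n : measurable_fun [set: mR * mR] (fun z : mR * mR => bump p q n z.1 * bump p' q' n z.2 : R).
  apply: measurable_funM; first exact: (measurableT_comp (mb p q n) measurable_fst).
  exact: (measurableT_comp (mb p' q' n) measurable_snd).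
have mi (r s : R) : measurable_fun [set: mR] (\1_(`]r, s[%classic) : mR -> R).
  exact: intg_meas (itvoo_intg r s).
pose F z := \1_(`]p, q[%classic) z.1 * \1_(`]p', q'[%classic) z.2 * D z.
have mF : measurable_fun [set: mR * mR] (F : mR * mR -> R).
  apply: measurable_funM => //; apply: measurable_funM.
    exact: (measurableT_comp (mi p q) measurable_fst).
  exact: (measurableT_comp (mi p' q') measurable_snd).
have [_ H] : intg mu2 F /\ \int[mu2]_z f n z @[n --> \oo] --> \int[mu2]_z F z.
  apply: (dominated_cvg _ mF _ (intg_norm (box_D N))).
  - by move=> n; exact: (measurable_funM (mbb n) mD).
  - apply: aeW => z; apply: cvgM; last exact: cvg_cst.
    by apply: cvgM; exact: bump_cvg.
  - apply: aeW => z n; rewrite /f 2!normrM (normrM _ (D z)) (normrM (\1_(itvM N) z.1)).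
    have [h1|h1] := leP N `|z.1|; first by rewrite (b0 p q)// normr0 !mul0r !mulr_ge0.
    have [h2|h2] := leP N `|z.2|; first by rewrite (b0 p' q')// normr0 mulr0 mul0r !mulr_ge0.
    by rewrite (in_itvM (ltW h1)) (in_itvM (ltW h2)) normr1 !mul1r ler_piMl// mulr_ile1.
have f0 n : \int[mu2]_z f n z = 0.
  have [i1 [i2 E]] := poincare_test dv (fun k => Ck_bump k p q n) (fun k => Ck_bump k p' q' n)
    (bump_intg p q n) (bump_intg p' q' n) (b1 _ _ _) (b1 _ _ _)
    (fun x => b0 p q n x Np Nq) (fun x => b0 p' q' n x Np' Nq').
  rewrite -[RHS](subrr (\int[mu2]_z (prim u2 (swp z) * (bump p q n z.1 * bump p' q' n z.2)))).
  by rewrite -{1}E -RintB//; apply: Rint_eq => z; rewrite /f /D; ring.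
have E0 : (fun n => \int[mu2]_z f n z) = cst 0 by apply/funext => n; exact: f0.
rewrite E0 in H.
exact: (cvg_unique (@Rhausdorff R) H (cvg_cst _)).
Qed.

Theorem poincare : div_free (fun z => (u1 z, - u2 (swp z))) ->
  {ae mu2, forall z : mR * mR, prim u1 z = prim u2 (swp z)}.
Proof.
move=> dv.
pose I n : set mR := `]- (n%:R : R), n%:R[%classic.
have II n o : exists p q : R, oray o `&` I n = `]p, q[%classic.
  case: o => [r|]; last by exists (- n%:R), n%:R; rewrite setTI.
  exists (Num.max (ratr r) (- n%:R)), n%:R.
  apply/seteqP; split => x; rewrite /I /= !in_itv/= andbT gt_max.
    by move=> [-> /andP[-> ->]].
  by move=> /andP[/andP[-> ->] ->].
have mI n : measurable (I n) by exact: measurable_itv.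
have H n : {ae mu2, forall z : mR * mR, \1_(I n) z.1 * \1_(I n) z.2 * D z = 0}.
  have fi : intg mu2 (fun z => \1_(I n) z.1 * \1_(I n) z.2 * D z).
    have := intg_indic (A := I n `*` I n) (measurableX (mI n) (mI n)) (box_D n%:R).
    have hI (x : R) : \1_(I n) x * \1_(itvM n%:R) x = \1_(I n) x :> R.
      rewrite [\1_(I n) x]indicE; have [|_] := boolP (x \in I n); last by rewrite mul0r.
      by rewrite inE /I/= in_itv/= -ltr_norml => /ltW xn; rewrite in_itvM// mulr1.
    congr intg; apply/funext => z.
    transitivity ((\1_(I n) z.1 * \1_(itvM n%:R) z.1) * (\1_(I n) z.2 * \1_(itvM n%:R) z.2) * D z).
      by rewrite [\1_(I n `*` I n) z]indicE in_setX -mulnb natrM -!indicE; ring.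
    by rewrite !hI.
  apply: Rint_sets0 => //.
  apply: (quadrant_lambda_zero (integral_additive (@measurable_id _ _ setT) fi)) => o1 o2.
  have [p [q E1]] := II n o1; have [p' [q' E2]] := II n o2.
  rewrite -[RHS](poincare_rect p q p' q' dv) -E1 -E2; apply: Rint_eq => z.
  by rewrite !indicE in_setX !in_setI -!mulnb !natrM; ring.
apply: (ae_mono (ae_countable H)) => z Hz.
have := Hz (Num.trunc (`|z.1| + `|z.2|)).+1.
have zI (x : R) : `|x| <= `|z.1| + `|z.2| -> x \in I (Num.trunc (`|z.1| + `|z.2|)).+1.
  move=> h; rewrite inE /I/= in_itv/= -ltr_norml (le_lt_trans h)//.
  by have /Num.Theory.trunc_itv/andP[] : 0 <= `|z.1| + `|z.2| by exact: addr_ge0.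
rewrite !indicE !zI ?lerDl ?lerDr// !mul1r => /eqP; rewrite subr_eq0 => /eqP.
exact.
Qed.

End stream_function.
End poincare.

(** * The chain rule for p at least 2 *)

Section test_functions.
Context {R : realType}.
Notation mR := (measurableTypeR R).
Notation mu := (@lebesgue_measure R).
Notation mu2 := (lebesgue2 R).
Implicit Types (phi F : R * R -> R) (K : set (R * R)).

Lemma compact_box K : compact K -> exists M, forall z, K z -> `|z.1| <= M /\ `|z.2| <= M.
Proof.
move=> /compact_bounded[M [_ HM]]; exists (M + 1) => z Kz.
have h : `|z| <= M + 1 by apply: HM => //; rewrite ltrDl.
by split; apply: le_trans h; rewrite prod_normE le_max lexx ?orbT.
Qed.

Lemma compact_support_bounded F K : continuous F -> compact K ->
  (forall z, ~ K z -> F z = 0) -> exists2 C : R, 0 <= C & forall z, `|F z| <= C.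
Proof.
move=> cF cK F0.
have /compact_bounded[M [_ HM]] : compact (F @` K).
  by apply: continuous_compact => //; apply: continuous_subspaceT.
exists (`|M| + 1) => [|z]; first by rewrite addr_ge0.
have [Kz|/F0 ->] := pselect (K z); last by rewrite normr0 addr_ge0.
apply: HM; last by exists z.
by rewrite (le_lt_trans (ler_norm M))// ltrDl.
Qed.

Lemma derive_out (phi : R * R -> R) (w z : R * R) :
  ~ closure [set x | phi x != 0] z -> 'D_w phi z = 0.
Proof.
move=> nz.
have nz0 : \forall x \near z, phi x = cst 0 x.
  have := @closed_closure _ [set x | phi x != 0].
  rewrite -openC => /(_ z nz); apply: filterS => x nx.
  apply/eqP; rewrite -[_ == _]negbK; apply/negP => x0; apply: nx.
  exact: subset_closure.
by rewrite (near_eq_derive _ nz0) derive_cst.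
Qed.

Lemma test_function_regular phi : test_function phi ->
  [/\ forall x y : R, is_derive x 1 (fun x => phi (x, y)) (partial1 phi (x, y)),
      forall x y : R, is_derive y 1 (fun y => phi (x, y)) (partial2 phi (x, y)),
      continuous phi, continuous (partial1 phi) & continuous (partial2 phi)].
Proof.
move=> [Ck_phi _]; have [cphi [d1 d2 [c1 _] [c2 _]]] := Ck_phi 1; split=> //.
- by move=> x y; apply/(is_derive_slice1 phi (x, y)); split.
- by move=> x y; apply/(is_derive_slice2 phi (x, y)); split.
Qed.

Lemma test_function_bounded phi : test_function phi -> exists2 C : R, 0 <= C &
  forall z, [/\ `|phi z| <= C, `|partial1 phi z| <= C & `|partial2 phi z| <= C].
Proof.
move=> tf; have [_ _ cphi c1 c2] := test_function_regular tf; have [_ cK] := tf.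
have out w z : ~ closure [set x | phi x != 0] z -> 'D_w phi z = 0 by exact: derive_out.
have [C0 C00 B0] : exists2 C : R, 0 <= C & forall z, `|phi z| <= C.
  apply: (compact_support_bounded cphi cK) => z nz.
  by apply/eqP; rewrite -[_ == _]negbK; apply/negP => z0; apply/nz/subset_closure.
have [C1 C10 B1] := compact_support_bounded c1 cK (out _).
have [C2 C20 B2] := compact_support_bounded c2 cK (out _).
exists (C0 + C1 + C2); first by rewrite !addr_ge0.
move=> z; split.
- by rewrite (le_trans (B0 z))// -addrA lerDl addr_ge0.
- by rewrite (le_trans (B1 z))// addrAC lerDr addr_ge0.
- by rewrite (le_trans (B2 z))// lerDr addr_ge0.
Qed.

Lemma test_function_admissible phi : test_function phi ->
  exists C, admissible C phi (partial1 phi) (partial2 phi).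
Proof.
move=> tf; have [e1 e2 cphi c1 c2] := test_function_regular tf.
have [C C0 B] := test_function_bounded tf; exists C.
have lip (f f' : R -> R) : (forall x : R, is_derive x 1 f (f' x)) ->
    (forall x, `|f' x| <= C) -> forall x y, `|f y - f x| <= C * `|y - x|.
  move=> df bf x y; wlog xy : x y / x <= y.
    by move=> W; have [xy|/ltW yx] := leP x y; [exact: W|rewrite distrC (distrC y); exact: W].
  have cf : {within `[x, y], continuous f}.
    by apply: continuous_subspaceT; exact: is_derive_continuous df.
  have [c _ ->] := MVT_segment xy (fun x _ => df x) cf.
  by rewrite normrM ler_wpM2r.
have mphi := continuous2_measurable cphi.
have m1 := continuous2_measurable c1.
have m2 := continuous2_measurable c2.
split; split.
- exact: mphi.
- exact: m2.
- by move=> z; have [] := B z.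
- move=> x y y'; apply: (lip (fun y => phi (x, y)) _ (e2 x)) => t.
  by have [] := B (x, t).
- by apply: aeW => -[x y]; exact: e2.
- exact: measurable_swp mphi.
- exact: measurable_swp m1.
- by move=> z; have [] := B (swp z).
- move=> x y y'; apply: (lip (fun y => phi (y, x)) _ (e1 ^~ x)) => t.
  by have [] := B (t, x).
- by apply: aeW => -[x y]; exact: e1.
Qed.

Lemma div_free_ae (w w' : R * R -> R * R) :
  measurable_fun [set: mR * mR] (fun z : mR * mR => (w z).1 : R) ->
  measurable_fun [set: mR * mR] (fun z : mR * mR => (w z).2 : R) ->
  measurable_fun [set: mR * mR] (fun z : mR * mR => (w' z).1 : R) ->
  measurable_fun [set: mR * mR] (fun z : mR * mR => (w' z).2 : R) ->
  {ae mu2, forall z : mR * mR, w z = w' z} -> div_free w -> div_free w'.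
Proof.
move=> m1 m2 m1' m2' ww dw phi tf; rewrite -[RHS](dw phi tf).
have [_ [_ _ [c1 _] [c2 _]]] := tf.1 1.
have p1 := continuous2_measurable c1; have p2 := continuous2_measurable c2.
apply: ae_eq_integral => //.
- apply/measurable_EFinP.
  exact: (measurable_funD (measurable_funM m1' p1) (measurable_funM m2' p2)).
- apply/measurable_EFinP.
  exact: (measurable_funD (measurable_funM m1 p1) (measurable_funM m2 p2)).
- by apply: (ae_mono ww) => z -> _.
Qed.

End test_functions.

(** * Reduction of an arbitrary field to regular representatives *)

Section reduction.
Context {R : realType}.
Notation mR := (measurableTypeR R).
Notation mu := (@lebesgue_measure R).
Notation mu2 := (lebesgue2 R).

Lemma Lfun_measurable (p : \bar R) (f : mR * mR -> R) : f \in Lfun mu2 p ->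
  measurable_fun [set: mR * mR] f.
Proof. by rewrite inE => /andP[/[!inE]/=]. Qed.

Lemma Lfun_infty_bound (f : mR * mR -> R) : f \in Lfun mu2 +oo%E ->
  exists L, {ae mu2, forall z, `|f z| <= L}.
Proof.
rewrite inE => /andP[_]; rewrite inE/= /finite_norm unlock.
case: ifPn => [_|]; last first.
  rewrite -leNgt => mT _; exists 0.
  have T0 : mu2 setT = 0%E by apply/eqP; rewrite eq_le mT measure_ge0.
  by exists setT; split.
move=> lt.
have [r lr] : exists r : R, (ess_sup mu2 (abse \o (EFin \o f)) <= r%:E)%E.
  move: lt; case: (ess_sup _ _) => [r| |] // _; first by exists r.
  by exists 0; rewrite leNye.
exists r; have /ess_supP := lr; apply: filterS.
by move=> z /=; rewrite lee_fin.
Qed.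

Definition boxI (M : R) (z : R * R) : R := \1_(itvM M) z.1 * \1_(itvM M) z.2.

Lemma boxI_ge0 M z : 0 <= boxI M z.
Proof. by rewrite /boxI !indicE mulr_ge0. Qed.

Lemma boxI_norm M z : `|boxI M z| <= 1.
Proof. by rewrite /boxI normrM mulr_ile1// indic_norm1. Qed.

Lemma measurable_boxI M : measurable_fun [set: mR * mR] (boxI M : mR * mR -> R).
Proof. by apply: measurable_funM; [exact: measurable_itvM1|exact: measurable_itvM2]. Qed.

Lemma boxI_sqr M z : boxI M z ^+ 2 = boxI M z.
Proof. by rewrite /boxI exprMn !indicE -!natrX; do 2 case: (_ \in _). Qed.

(** On the box f^2 is at most 1 + |f|^r for a finite exponent r >= 2, and at most the square of an
    essential bound for the infinite one. The proof of [crp_of_ge2] uses p >= 2 only through this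
    lemma. *)
Lemma Lfun_sqr_box (p : \bar R) (f : mR * mR -> R) M : (2%:E <= p)%E -> f \in Lfun mu2 p ->
  intg mu2 (fun z => boxI M z * f z ^+ 2).
Proof.
move=> p2 fp; have mf := Lfun_measurable fp.
have mg : measurable_fun [set: mR * mR] (fun z : mR * mR => boxI M z * f z ^+ 2).
  by apply: measurable_funM; [exact: measurable_boxI|exact: measurable_funX].
case: p p2 fp => [r| |] //; last first.
  move=> _ /Lfun_infty_bound[L fL].
  apply: (intg_le_ae mg _ (intgZ (L ^+ 2) (box_intg M))).
  apply: (ae_mono fL) => z h; rewrite normrM (ger0_norm (boxI_ge0 _ _)) ger0_norm ?sqr_ge0//.
  rewrite mulrC ler_wpM2r ?boxI_ge0// -real_normK ?num_real//.
  by rewrite lerXn2r// nnegrE (le_trans _ h).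
rewrite lee_fin => r2 fr.
have r1 : 1 <= r by rewrite (le_trans _ r2)// ler1n.
have ir := Lfun_integrable r1 fr.
apply: (intg_le mg _ (intgD (box_intg M) ir)) => z.
rewrite normrM (ger0_norm (boxI_ge0 _ _)) (ger0_norm (sqr_ge0 _)).
have b1 : boxI M z <= 1 by rewrite (le_trans (ler_norm _))// boxI_norm.
have [f1|f1] := leP `|f z| 1.
  have f2 : f z ^+ 2 <= 1 by rewrite -real_normK ?num_real// exprn_ile1.
  rewrite -[leLHS]addr0 lerD ?powR_ge0// -[leRHS]mulr1 ler_wpM2l//.
  exact: boxI_ge0.
rewrite -[leLHS]add0r lerD ?boxI_ge0//.
apply: (@le_trans _ _ (f z ^+ 2)); first by rewrite ler_piMl// sqr_ge0.
rewrite -real_normK ?num_real// -powR_mulrn//.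
by rewrite ler_powR// ltW.
Qed.

(** Almost every vertical slice is square integrable. Putting the function to 0 over the null set of
    bad abscissae makes every slice so, and primitives can then be taken on all vertical lines. The
    bound M + 1 is the reach of the cutoff [boxI M]. *)
Lemma regularize (f : mR * mR -> R) M : measurable_fun [set: mR * mR] f ->
  intg mu2 (fun z => boxI M z * f z ^+ 2) ->
  {ae mu2, forall z : mR * mR, M < `|z.1 : R| \/ M < `|z.2 : R| -> f z = 0} ->
  exists2 u, regular_slices u (M + 1) & {ae mu2, forall z : mR * mR, u z = f z}.
Proof.
move=> mf i2 f0.
have [A [mA A0 PA]] := intg_slices i2.
pose u (z : mR * mR) := \1_(~` A) z.1 * (boxI M z * f z).
have mA1 : measurable_fun [set: mR * mR] (fun z : mR * mR => \1_(~` A) z.1 : R).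
  have mI : measurable_fun [set: mR] (\1_(~` A) : mR -> R).
    by apply: measurable_indic; exact: measurableC.
  exact: (measurableT_comp mI measurable_fst).
have mu_ : measurable_fun [set: mR * mR] (u : mR * mR -> R).
  apply: measurable_funM => //; apply: measurable_funM => //; exact: measurable_boxI.
have usq z : u z ^+ 2 = \1_(~` A) z.1 * (boxI M z * f z ^+ 2).
  rewrite /u exprMn (exprMn _ (boxI M z)) boxI_sqr; congr (_ * _).
  by rewrite indicE -natrX; case: (_ \in _).
exists u.
  split=> //.
  - have out (x : R) : M + 1 < `|x| -> \1_(itvM M) x = 0 :> R.
      move=> Mx; rewrite indicE mem_setE in_itv/=.
      have -> // : (- M - 1 < x <= M + 1) = false.
      apply/negP => /andP[x1 x2].
      by move: Mx; apply/negP; rewrite -leNgt ler_norml x2 andbT opprD ltW.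
    by move=> z [] /out h; rewrite /u /boxI h ?(mul0r, mulr0).
  - move=> x; under eq_fun do rewrite usq.
    have [Ax|nAx] := pselect (A x).
      have -> : (fun y => \1_(~` A) (x, y).1 * (boxI M (x, y) * f (x, y) ^+ 2)) = cst 0.
        by apply/funext => y; rewrite indicE memNset ?mul0r//=.
      exact: intg0.
    have ix : intg mu (fun y => boxI M (x, y) * f (x, y) ^+ 2).
      by apply: contrapT => h; apply: nAx; apply: PA.
    exact: (intgZ (\1_(~` A) x) ix).
  - under eq_fun do rewrite usq.
    apply: (@intg_le _ _ _ mu2 _ (fun z => `|boxI M z * f z ^+ 2|)).
    + apply: measurable_funM => //; exact: (intg_meas i2).
    + by move=> z; rewrite normrM ler_piMl// indic_norm1.
    + exact: intg_norm.
have aeA : {ae mu2, forall z : mR * mR, ~ A z.1}.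
  apply: (mpres_ae swap_mpres (P := fun z : mR * mR => ~ A z.2)).
  apply: (@ae_snd _ (fun x => ~ A x)).
  by exists A; split=> // x /= /contrapT.
apply: (ae_mono2 aeA f0) => z Az fz; rewrite /u indicE mem_set// mul1r.
have [/andP[z1 z2]|] := boolP ((`|z.1 : R| <= M) && (`|z.2 : R| <= M)).
  by rewrite /boxI !in_itvM// !mul1r.
by rewrite negb_and -!ltNge => /orP /fz ->; rewrite mulr0.
Qed.

Theorem crp_of_ge2 (p : \bar R) (v : R * R -> R * R) : (2%:E <= p)%E ->
  Lp_field p v -> compactly_supported v -> div_free v -> CRP_infty v.
Proof.
move=> p2 [v1p v2p] [K cK v0] dv rho beta rhoL [dbeta _] drv.
have m1 : measurable_fun [set: mR * mR] (fun z : mR * mR => (v z).1 : R) := Lfun_measurable v1p.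
have m2 : measurable_fun [set: mR * mR] (fun z : mR * mR => (v z).2 : R) := Lfun_measurable v2p.
have mrho := Lfun_measurable rhoL.
have [M KM] := compact_box cK.
have vM : {ae mu2, forall z : mR * mR, M < `|z.1 : R| \/ M < `|z.2 : R| -> v z = 0}.
  apply: (ae_mono v0) => z vz zM; apply: vz => /KM[z1 z2].
  by case: zM; apply/negP; rewrite -leNgt.
have [u1 su1 e1] : exists2 u, regular_slices u (M + 1) &
    {ae mu2, forall z : mR * mR, u z = (v z).1}.
  apply: (regularize m1 (Lfun_sqr_box M p2 v1p)).
  by apply: (ae_mono vM) => z h /h ->.
(* The sign and the swap are chosen so that the horizontal primitive of -v.2 is the same stream
   function as the vertical primitive of v.1. *)
have [u2 su2 e2] : exists2 u, regular_slices u (M + 1) &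
    {ae mu2, forall z : mR * mR, u z = - (v (swp z)).2}.
  apply: (regularize (f := fun z => - (v (swp z)).2)).
  - by apply: measurable_funN; exact: (measurable_swp m2).
  - have := mpres_intg swap_mpres (Lfun_sqr_box M p2 v2p).
    congr intg; apply/funext => z /=; rewrite sqrrN; congr (_ * _).
    by rewrite /boxI /= mulrC.
  - apply: (ae_mono (mpres_ae swap_mpres vM)) => z h zM.
    by rewrite /swp h ?oppr0//; case: zM; [right|left].
have [L0 rL0] := Lfun_infty_bound rhoL.
(* An essential bound becomes a bound at every point once [rho] is set to 0 off [A]; the absolute
   value makes the bound nonnegative, so the value 0 respects it. *)
pose L := `|L0|; pose A := [set z : mR * mR | `|rho z| <= L].
pose r z := \1_A z * rho z.
have mA : measurable A.
  rewrite -[X in measurable X]setTI; apply: measurable_fun_le => //.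
  exact: measurableT_comp.
have mr : measurable_fun [set: mR * mR] (r : mR * mR -> R).
  by apply: measurable_funM => //; exact: measurable_indic.
have rL z : `|r z| <= L.
  rewrite /r indicE; have [Az|nAz] := pselect (A z); first by rewrite mem_set// mul1r.
  by rewrite memNset// mul0r normr0 normr_ge0.
have er : {ae mu2, forall z : mR * mR, r z = rho z}.
  apply: (ae_mono rL0) => z h; rewrite /r indicE mem_set ?mul1r//.
  by rewrite /A/= (le_trans h)// ler_norm.
have e2' : {ae mu2, forall z : mR * mR, - u2 (swp z) = (v z).2}.
  by apply: (ae_mono (mpres_ae swap_mpres e2)) => z h; rewrite /swp h /swp opprK; case: z h.
have [mu1 _ _ _] := su1; have [mu2_ _ _ _] := su2.
have mu2' := measurable_swp mu2_.
have sw1 := regular_slicesM su1 mr rL.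
have sw2 := regular_slicesM su2 (measurable_swp mr) (fun z => rL (swp z)).
have [mw1 _ _ _] := sw1; have [mw2 _ _ _] := sw2.
have sd : stream_data u1 u2 r (M + 1) L.
  split=> //.
  - apply: (poincare su1 su2).
    have mN : measurable_fun [set: mR * mR] (fun z : mR * mR => - u2 (swp z) : R).
      exact: measurable_funN mu2'.
    apply: (@div_free_ae R v (fun z => (u1 z, - u2 (swp z))) m1 m2 mu1 mN _ dv).
    apply: (ae_mono2 e1 e2') => z h1 h2; rewrite h1 h2; exact: surjective_pairing.
  - apply: (poincare sw1 sw2).
    have mN : measurable_fun [set: mR * mR] (fun z : mR * mR => - (r (swp (swp z)) * u2 (swp z)) : R).
      exact: measurable_funN (measurable_swp mw2).
    apply: (@div_free_ae R (fun z => rho z *: v z)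
      (fun z => (r z * u1 z, - (r (swp (swp z)) * u2 (swp z))))
      (measurable_funM mrho m1) (measurable_funM mrho m2) mw1 mN _ drv).
    apply: (ae_mono2 (ae_mono2 e1 e2' (fun z a b => conj a b)) er) => z [h1 h2] hr.
    by rewrite swpK -mulrN h1 h2 hr.
have cbeta : continuous beta.
  by move=> t; apply/differentiable_continuous/derivable1_diffP; exact: dbeta.
have mbeta := measurable_continuous cbeta.
have [B bB] : exists B, forall s, `|s| <= L -> `|beta s| <= B.
  have /compact_bounded[B [_ HB]] : compact (beta @` `[- L, L]%classic).
    apply: continuous_compact; last exact: segment_compact.
    exact: continuous_subspaceT.
  exists (`|B| + 1) => s sL; apply: HB.
    by rewrite (le_lt_trans (ler_norm B))// ltrDl.
  by exists s => //=; rewrite in_itv/= -ler_norml.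
move=> phi tf; have [C adm] := test_function_admissible tf.
have [_ [_ _ [c1 _] [c2 _]]] := tf.1 1.
have p1 := continuous2_measurable c1; have p2' := continuous2_measurable c2.
pose fl := flux_density u1 u2 (partial1 phi) (partial2 phi).
have mbr : measurable_fun [set: mR * mR] (fun z : mR * mR => beta (r z) : R).
  exact: (measurableT_comp mbeta mr).
have mbrho : measurable_fun [set: mR * mR] (fun z : mR * mR => beta (rho z) : R).
  exact: (measurableT_comp mbeta mrho).
have ifl := flux_density_intg sd adm.
have i : intg mu2 (fun z => beta (r z) * fl z).
  have := intg_mulb ifl mbr (fun z => bB _ (rL z)).
  by congr intg; apply/funext => z; rewrite mulrC.
rewrite -[0%E]/((0 : R)%:E) -(renormalized_flux sd adm mbeta bB) -(intgE i).
apply: ae_eq_integral => //.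
- apply/measurable_EFinP; apply: measurable_funD.
    exact: (measurable_funM (measurable_funM mbrho m1) p1).
  exact: (measurable_funM (measurable_funM mbrho m2) p2').
- by apply/measurable_EFinP; exact: intg_meas i.
apply: (ae_mono2 (ae_mono2 e1 e2' (fun z a b => conj a b)) er) => z [h1 h2] hr _ /=.
congr (_%:E); rewrite /fl /flux_density hr h1 -mulNr h2 /GRing.scale/= /GRing.scale/=; ring.
Qed.

End reduction.

(** * Failure of the chain rule for p less than 2 *)

Section calculus.
Context {R : realType}.
Notation mR := (measurableTypeR R).
Notation mu := (@lebesgue_measure R).

Lemma Rint_scale_ge0 (c : R) (g : R -> R) : 0 < c ->
  measurable_fun [set: mR] (g : mR -> R) -> (forall x, 0 <= g x) ->
  (c%:E * \int[mu]_x (g (c * x))%:E = \int[mu]_x (g x)%:E)%E.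
Proof.
move=> c0 mg g0.
have mS : measurable_fun [set: mR] (fun x : mR => c * x : mR).
  by apply: (@measurable_funM _ mR R setT (cst c) id).
pose nu : {measure set mR -> \bar R} :=
  measure_function_pushforward__canonical__measure_function_Measure mu mS.
pose nuc : {measure set mR -> \bar R} := mscale (NngNum (ltW c0)) nu.
have E A : measurable A -> mu A = nuc A.
  apply: lebesgue_measure_unique => _ [[x y] _ <-].
  rewrite /nuc /= /mscale /= /pushforward.
  have -> : (fun x : mR => c * x : mR) @^-1` `]x, y]%classic = `]x / c, y / c]%classic.
    by apply/seteqP; split => z /=; rewrite !in_itv/= ltr_pdivrMr// ler_pdivlMr// mulrC.
  rewrite !lebesgue_measure_itv/= !lte_fin ltr_pM2r ?invr_gt0//.
  case: ifP => _; last by rewrite mule0.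
  by rewrite -!EFinB -EFinM -mulrBl mulrC divfK// gt_eqF.
have mg' : measurable_fun [set: mR] (EFin \o g) by exact/measurable_EFinP.
have g0' x : setT x -> (0 <= (EFin \o g) x)%E by rewrite lee_fin.
have K1 : (\int[nuc]_x (g x)%:E = \int[mu]_x (g x)%:E)%E.
  by apply: eq_measure_integral => A mA _; rewrite -E.
have K2 : (\int[nuc]_x (g x)%:E = c%:E * \int[nu]_x (g x)%:E)%E.
  exact: (@ge0_integral_mscale _ _ _ nu setT measurableT (NngNum (ltW c0)) _ mg' g0').
have K3 : (\int[nu]_x (g x)%:E = \int[mu]_x (g (c * x))%:E)%E.
  have := @ge0_integral_pushforward _ _ mR mR R _ mS mu setT _ measurableT mg' (fun x _ => g0' x I).
  by rewrite preimage_setT.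
by rewrite -K1 K2 K3.
Qed.

Lemma Rint_scale (c : R) (g : R -> R) : 0 < c -> intg mu g ->
  intg mu (fun x => g (c * x)) /\ \int[mu]_x g (c * x) = c^-1 * \int[mu]_x g x.
Proof.
move=> c0 ig.
have pos (h : R -> R) : intg mu h -> (forall x, 0 <= h x) ->
    intg mu (fun x => h (c * x)) /\ c * \int[mu]_x h (c * x) = \int[mu]_x h x.
  move=> ih h0; have mh := intg_meas ih.
  have E := Rint_scale_ge0 c0 mh h0.
  have mS : measurable_fun [set: mR] (fun x : mR => c * x : mR).
    by apply: (@measurable_funM _ mR R setT (cst c) id).
  have ihc : intg mu (fun x => h (c * x)).
    apply/integrableP; split; first by apply/measurable_EFinP; exact: (measurableT_comp mh mS).
    under eq_integral do rewrite /= ger0_norm//.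
    have /integrableP[_] := ih; under eq_integral do rewrite /= ger0_norm//.
    rewrite -E; case: (\int[mu]_x _)%E => [r| |] //=; rewrite ?ltry//.
    by rewrite gt0_muley ?lte_fin.
  by split=> //; apply: EFin_inj; rewrite EFinM -!intgE.
have in_ := intg_norm ig.
have [i1 E1] := pos _ in_ (fun x => normr_ge0 _).
have h0 x : 0 <= `|g x| - g x by rewrite subr_ge0 ler_norm.
have [i2 E2] := pos _ (intgB in_ ig) h0.
split.
  by have := intgB i1 i2; congr intg; apply/funext => x; ring.
have E : \int[mu]_x g (c * x) = \int[mu]_x `|g (c * x)| - \int[mu]_x (`|g (c * x)| - g (c * x)).
  by rewrite -RintB//; apply: Rint_eq => x; ring.
have {}E1 : \int[mu]_x `|g (c * x)| = c^-1 * \int[mu]_x `|g x| by rewrite -E1 mulKf// gt_eqF.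
have {}E2 : \int[mu]_x (`|g (c * x)| - g (c * x)) = c^-1 * \int[mu]_x (`|g x| - g x).
  by rewrite -E2 mulKf// gt_eqF.
rewrite E E1 E2 RintB//; ring.
Qed.

Lemma Rint_derivative (F f : R -> R) (a b : R) : a < b ->
  (forall x : R, a <= x <= b -> is_derive x 1 F (f x)) ->
  (forall x : R, a <= x <= b -> {for x, continuous f}) ->
  (\int[mu]_(x in `[a, b]) (f x)%:E = (F b - F a)%:E)%E.
Proof.
move=> ab dF cf.
have cF x : a <= x <= b -> {for x, continuous F}.
  move=> xab; apply: differentiable_continuous; apply/derivable1_diffP.
  exact: (@ex_derive _ _ _ _ _ _ _ (dF x xab)).
rewrite (@continuous_FTC2 _ f F)//.
- apply: continuous_in_subspaceT => x; rewrite inE/= in_itv/=; exact: cf.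
- split.
  + move=> x; rewrite in_itv/= => /andP[ax xb].
    by apply: (@ex_derive _ _ _ _ _ _ _ (dF x _)); rewrite !ltW.
  + by apply: cvg_at_right_filter; apply: cF; rewrite lexx ltW.
  + by apply: cvg_at_left_filter; apply: cF; rewrite lexx ltW.
- move=> x; rewrite in_itv/= => /andP[ax xb]; rewrite derive1E.
  by apply: (@derive_val _ _ _ _ _ _ _ (dF x _)); rewrite !ltW.
Qed.

(** The integrals over the intervals from [e n] to 1 - [e n] are increments of [F], at most 2 C, and
    monotone convergence passes to the open interval. Since [e n] is at most 1/3 these intervals
    never degenerate. *)
Lemma improper_intg (f F : R -> R) (C : R) : measurable_fun [set: mR] (f : mR -> R) ->
  (forall x : R, 0 < x < 1 -> 0 <= f x) ->
  (forall x : R, 0 < x < 1 -> is_derive x 1 F (f x)) ->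
  (forall x : R, 0 < x < 1 -> {for x, continuous f}) ->
  (forall x : R, 0 < x < 1 -> `|F x| <= C) ->
  intg mu (fun x => \1_(`]0, 1[) x * f x).
Proof.
move=> mf f0 dF cf FC.
pose e (n : nat) : R := n.+3%:R^-1.
have e0 n : 0 < e n by rewrite invr_gt0 ltr0n.
have e3 n : e n <= 3^-1.
  by rewrite lef_pV2 ?posrE ?ltr0n// ler_nat.
pose A n : set mR := `[e n, 1 - e n]%classic.
have eA n (x : R) : e n <= x <= 1 - e n -> 0 < x < 1.
  by move=> /andP[x1 x2]; have := e0 n => h; apply/andP; split; lra.
have nA : nondecreasing_seq A.
  move=> m n mn; apply/subsetPset => x; rewrite /A/= !in_itv/= => /andP[x1 x2].
  have : e n <= e m by rewrite lef_pV2 ?posrE ?ltr0n// ler_nat !ltnS.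
  by move=> h; apply/andP; split; lra.
have UA : \bigcup_n A n = (`]0, 1[%classic : set mR).
  apply/seteqP; split => x /=.
    by move=> [n _]; rewrite /A/= !in_itv/=; exact: eA.
  rewrite in_itv/= => /andP[x0 x1].
  have y0 : 0 < 1 - x by rewrite subr_gt0.
  have [n _ H] : \forall n \near \oo, n.+1%:R^-1 < Num.min x (1 - x).
    have m0 : 0 < Num.min x (1 - x) by rewrite lt_min x0.
    exact: (near_infty_natSinv_lt (PosNum m0)).
  exists n => //; rewrite /A/= in_itv/= /e.
  have : n.+3%:R^-1 < Num.min x (1 - x) by apply: H => /=; rewrite -addn2 leq_addr.
  by rewrite lt_min => /andP[h1 h2]; rewrite (ltW h1)/= lerBrDr -lerBrDl ltW.
have bd n : (\int[mu]_(x in A n) (f x)%:E <= (C + C)%:E)%E.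
  have en : e n < 1 - e n by have := e3 n; lra.
  have I : (\int[mu]_(x in A n) (f x)%:E = (F (1 - e n) - F (e n))%:E)%E.
    by apply: Rint_derivative => // x /eA; [exact: dF|exact: cf].
  rewrite I lee_fin (le_trans (ler_norm _))// (le_trans (ler_normB _ _))// lerD//.
    by apply: FC; apply: (eA n); rewrite lexx andbT ltW.
  by apply: FC; apply: (eA n); rewrite lexx ltW.
have mA n : measurable (A n) by exact: measurable_itv.
have mI : measurable (`]0, 1[%classic : set mR) by exact: measurable_itv.
have cv : (\int[mu]_(x in A n) (f x)%:E @[n --> \oo] --> \int[mu]_(x in \bigcup_n A n) (f x)%:E)%E.
  apply: ge0_nondecreasing_set_cvg_integral => //.
  - by move=> n; apply/measurable_EFinP; exact: measurable_funTS.
  - by move=> n x; rewrite lee_fin /A/= in_itv/= => /eA; exact: f0.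
have lim : (\int[mu]_(x in `]0%R, 1%R[) (f x)%:E <= (C + C)%:E)%E.
  rewrite -UA -(cvg_lim (@ereal_hausdorff R) cv).
  by apply: lime_le; [apply/cvg_ex; eexists; exact: cv|exact: nearW].
apply/integrableP; split.
  have mI1 : measurable_fun [set: mR] (\1_(`]0, 1[%classic) : mR -> R).
    exact: measurable_indic.
  by apply/measurable_EFinP; apply: measurable_funM.
rewrite (_ : (\int[mu]_x _ = \int[mu]_(x in `]0%R, 1%R[) (f x)%:E)%E); last first.
  rewrite [RHS]integral_mkcond; apply: eq_integral => x _.
  rewrite /= patchE indicE mem_setE in_itv/=.
  case: (boolP (0 < x < 1)) => x01 /=; last by rewrite mul0r normr0.
  by rewrite mul1r ger0_norm// f0.
exact: le_lt_trans lim (ltry _).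
Qed.

Lemma powR_ends_intg (r : R) : 0 <= r < 1 ->
  intg mu (fun x => \1_(`]0, 1[) x * (x `^ (- r) + (1 - x) `^ (- r))).
Proof.
move=> /andP[r0 r1].
have s0 : 0 < 1 - r by rewrite subr_gt0.
have er : 1 - r - 1 = - r by ring.
have dp (t : R) : 0 < t -> is_derive t 1 (fun t : R => t `^ (1 - r)) ((1 - r) * t `^ (- r)).
  by move=> t0; have := is_derive1_powR (1 - r) t0; rewrite er.
have cp (t : R) : 0 < t -> {for t, continuous (fun t : R => t `^ (- r))}.
  move=> t0; apply: differentiable_continuous; apply/derivable1_diffP.
  by apply: derivable_powR; rewrite in_itv/= andbT.
have mp : measurable_fun [set: mR] ((fun t : R => t `^ (- r)) : mR -> R) := measurable_powR (- r).
have mS : measurable_fun [set: mR] (fun x : mR => 1 - x : mR).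
  by apply: (@measurable_funB _ mR R setT (cst 1) id).
apply: (@improper_intg _
  (fun x => (1 - r)^-1 * (x `^ (1 - r)) - (1 - r)^-1 * ((-1 * x + 1) `^ (1 - r)))
  ((1 - r)^-1 + (1 - r)^-1)).
- by apply: measurable_funD => //; exact: (measurableT_comp mp mS).
- by move=> x _; rewrite addr_ge0 ?powR_ge0.
- move=> x /andP[x0 x1].
  have y0 : 0 < -1 * x + 1 by rewrite mulN1r addrC subr_gt0.
  have d1 : is_derive x 1 (fun x : R => (1 - r)^-1 * (x `^ (1 - r))) (x `^ (- r)).
    have := is_deriveZ (1 - r)^-1 (dp x x0).
    by rewrite /GRing.scale/= mulKf// gt_eqF.
  have d2 : is_derive x 1 (fun x : R => (1 - r)^-1 * ((-1 * x + 1) `^ (1 - r)))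
      (- (1 - x) `^ (- r)).
    have := is_deriveZ (1 - r)^-1 (is_derive_affine (dp _ y0)).
    by rewrite /GRing.scale/= mulrA mulKf ?gt_eqF// mulrN1 mulN1r [- x + 1]addrC.
  have := is_deriveB d1 d2; rewrite opprK; exact.
- move=> x /andP[x0 x1].
  have y0 : 0 < 1 - x by rewrite subr_gt0.
  apply: cvgD; first exact: cp.
  apply: (@cvg_comp _ _ _ (fun x : R => 1 - x) (fun t : R => t `^ (- r)) _ (nbhs (1 - x))).
    by apply: cvgB; [exact: cvg_cst|exact: cvg_id].
  exact: cp.
- move=> x /andP[x0 x1]; rewrite (le_trans (ler_normB _ _))//.
  have le1 (t : R) : 0 < t <= 1 -> `|(1 - r)^-1 * (t `^ (1 - r))| <= (1 - r)^-1.
    move=> /andP[t0 t1]; have i0 : 0 <= (1 - r)^-1 by rewrite invr_ge0 ltW.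
    rewrite normrM (ger0_norm (powR_ge0 _ _)) (ger0_norm i0) ler_piMr// -[leRHS](powRr0 t).
    by apply: ger_powR; rewrite ?t0 ?t1// ltW.
  by apply: lerD; apply: le1; apply/andP; split; lra.
Qed.

(** One of x and 1 - x is at least 1/2, and its power -r is at most 2 because r < 1. *)
Lemma powR_parabola_le (x r : R) : 0 < x < 1 -> 0 <= r < 1 ->
  (x * (1 - x)) `^ (- r) <= 2 * (x `^ (- r) + (1 - x) `^ (- r)).
Proof.
move=> /andP[x0 x1] /andP[r0 r1].
have y0 : 0 < 1 - x by rewrite subr_gt0.
have le2 (t : R) : 2^-1 <= t -> t <= 1 -> t `^ (- r) <= 2.
  move=> t2 t1; have t0 : 0 < t by rewrite (lt_le_trans _ t2)// invr_gt0.
  apply: (@le_trans _ _ (t `^ (-1))).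
    by apply: ger_powR; rewrite ?t0// lerN2 ltW.
  by rewrite (powR_inv1 (ltW t0)) -[leRHS]invrK lef_pV2 ?posrE// invr_gt0.
have px := powR_ge0 x (- r); have py := powR_ge0 (1 - x) (- r).
rewrite powRM; [|exact: ltW..].
have [xh|xh] := leP x 2^-1.
  have h : (1 - x) `^ (- r) <= 2 by apply: le2; lra.
  have := ler_wpM2l px h; rewrite mulrDr mulrC => hh; apply: (le_trans hh); lra.
have h : x `^ (- r) <= 2 by apply: le2; lra.
have := ler_wpM2r py h; rewrite mulrDr => hh; apply: (le_trans hh); lra.
Qed.

Lemma MVT_between (f f' : R -> R) (x h : R) : (forall x : R, is_derive x 1 f (f' x)) ->
  exists2 xi, `|xi - x| <= `|h| & f (x + h) - f x = f' xi * h.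
Proof.
move=> df; have cf a b : {within `[a, b], continuous f}.
  by apply: continuous_subspaceT; exact: is_derive_continuous df.
have [h0|/ltW h0] := leP 0 h.
  have xh : x <= x + h by rewrite lerDl.
  have [c] := @MVT_segment R f f' x (x + h) xh (fun x _ => df x) (cf _ _).
  rewrite in_itv/= => /andP[c1 c2] E; exists c; last by rewrite E addrAC subrr add0r.
  by rewrite (ger0_norm h0) ger0_norm ?subr_ge0// lerBlDl.
have xh : x + h <= x by rewrite gerDl.
have [c] := @MVT_segment R f f' (x + h) x xh (fun x _ => df x) (cf _ _).
rewrite in_itv/= => /andP[c1 c2] E; exists c.
  by rewrite (ler0_norm h0) ler0_norm ?subr_le0// lerN2 lerBrDl.
by rewrite -opprB E -mulrN; congr (_ * _); ring.
Qed.

(** The increment is split into a vertical one at fixed abscissa, where the one-variable chain rule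
    applies, and a horizontal one, which the mean value theorem and the continuity of [phix]
    control. *)
Lemma chain_rule2 (phi phix phiy : R * R -> R) (c : R -> R) (x c' : R) :
  (forall x y : R, is_derive x 1 (fun x => phi (x, y)) (phix (x, y))) ->
  (forall x y : R, is_derive y 1 (fun y => phi (x, y)) (phiy (x, y))) ->
  continuous phix -> is_derive x 1 c c' ->
  is_derive x 1 (fun x => phi (x, c x)) (phix (x, c x) + phiy (x, c x) * c').
Proof.
move=> dx dy cx dc.
have d2 : is_derive x 1 (fun t => phi (x, c t)) (phiy (x, c x) * c').
  exact: (@is_derive1_comp _ (fun y => phi (x, y)) c x _ _ (dy x (c x)) dc).
have cc : {for x, continuous c}.
  apply: differentiable_continuous; apply/derivable1_diffP.
  exact: (@ex_derive _ _ _ _ _ _ _ dc).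
pose g t := phi (t, c t) - phi (x, c t).
have d1 : is_derive x 1 g (phix (x, c x)).
  have cv : h^-1 *: ((g \o shift x) (h *: 1) - g x) @[h --> 0^'] --> phix (x, c x).
    apply/cvgrPdist_le => e e0.
    have /(cx (x, c x))[[P Q] /= [/nbhs_ballP[d /= d0 HP] nQ] Hd] :
      nbhs (phix (x, c x)) (ball (phix (x, c x)) e) by exact: nbhsx_ballx.
    have cQ : \forall h \near nbhs (0 : R), Q (c ((h : R) + x)).
      have hx : h + x @[h --> (0 : R)] --> 0 + x by apply: cvgD; [exact: cvg_id|exact: cvg_cst].
      by rewrite add0r in hx; exact: (cvg_comp _ _ hx cc).
    near=> h.
    have h0 : h != 0 by near: h; exact: nbhs_dnbhs_neq.
    have hd : `|h| < d by near: h; apply: dnbhs0_lt.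
    have hc : Q (c (h + x)) by near: h; exact: cvg_within cQ.
    have [xi xi_h E] := MVT_between x h (dx ^~ (c (h + x))).
    rewrite /= /g subrr subr0 /GRing.scale/= mulr1 [h + x]addrC in hc E *.
    rewrite E mulrCA mulVf// mulr1 ltW//.
    apply: (Hd (xi, c (x + h))); split => //=; apply: HP.
    by rewrite /ball/= distrC (le_lt_trans xi_h).
  by apply: DeriveDef; [exact: cvgP cv|exact: cvg_lim cv].
have := is_deriveD d1 d2; congr is_derive; apply/funext => t.
by rewrite /g !fctE subrK.
Unshelve. all: by end_near.
Qed.

End calculus.

(** * Fields along a pencil of parabolic arcs *)

Section lens.
Context {R : realType}.
Notation mR := (measurableTypeR R).
Notation mu := (@lebesgue_measure R).
Notation mu2 := (lebesgue2 R).

Definition unitI (x : R) : R := \1_(`]0, 1[) x.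
Definition width (x : R) : R := x * (1 - x).
(** The inverse of [width] on the open unit interval; its values elsewhere are multiplied by
    [unitI], which is 0 there. *)
Definition iwidth (x : R) : R := width x `^ (-1).

(** In the coordinates (x, s) with y = s w(x), the arc of parameter s has tangent (1, s w'(x)) with
    w'(x) = 1 - 2 x, and the flux G(s) ds has density G(s) / w(x) with respect to dy. *)
Definition lens (G : R -> R) (z : R * R) : R * R :=
  let s := z.2 * iwidth z.1 in
  (unitI z.1 * (iwidth z.1 * G s),
   unitI z.1 * ((1 - 2 * z.1) * (iwidth z.1 * (s * G s)))).

Definition profile (G : R -> R) :=
  measurable_fun [set: mR] (G : mR -> R) /\ forall s, `|G s| <= \1_(`]-1, 1]) s.

(** For q = 1 this dominates both components of any lens whose profile is bounded by 1. Its powers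
    keep the same form, with the exponent moved into [q]. *)
Definition lens_kernel (q : R) (z : R * R) : R :=
  unitI z.1 * (width z.1 `^ (- q) * \1_(`]- width z.1, width z.1]) z.2).

Lemma unitI1 x : 0 < x < 1 -> unitI x = 1.
Proof. by move=> x01; rewrite /unitI indicE mem_setE in_itv/= x01. Qed.

Lemma unitI0 x : ~~ (0 < x < 1) -> unitI x = 0.
Proof. by move=> /negbTE x01; rewrite /unitI indicE mem_setE in_itv/= x01. Qed.

Lemma width_gt0 x : 0 < x < 1 -> 0 < width x.
Proof. by move=> /andP[x0 x1]; rewrite mulr_gt0// subr_gt0. Qed.

Lemma width_le1 x : 0 < x < 1 -> width x <= 1.
Proof. by move=> /andP[x0 x1]; rewrite mulr_ile1// ?subr_ge0 ?gerBl ltW. Qed.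

Lemma iwidthE x : 0 < x < 1 -> iwidth x = (width x)^-1.
Proof. by move=> /width_gt0/ltW x0; rewrite /iwidth powR_inv1. Qed.

Lemma iwidth_ge0 x : 0 <= iwidth x. Proof. exact: powR_ge0. Qed.

Lemma unitI_meas : measurable_fun [set: mR] (unitI : mR -> R).
Proof. by apply: measurable_indic; exact: measurable_itv. Qed.

Lemma width_meas : measurable_fun [set: mR] (width : mR -> R).
Proof.
apply: (@measurable_funM _ mR R setT id (fun x => 1 - x)) => //.
by apply: (@measurable_funB _ mR R setT (cst 1) id).
Qed.

Lemma iwidth_meas : measurable_fun [set: mR] (iwidth : mR -> R).
Proof. exact: (measurableT_comp (measurable_powR (-1)) width_meas). Qed.

Lemma slope_meas : measurable_fun [set: mR * mR] (fun z : mR * mR => z.2 * iwidth z.1 : R).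
Proof.
apply: measurable_funM; first exact: measurable_snd.
exact: (measurableT_comp iwidth_meas measurable_fst).
Qed.

Lemma profile_mul (G : R -> R) : profile G -> profile (fun s => s * G s).
Proof.
move=> [mG G1]; split.
  by apply: (@measurable_funM _ mR R setT id G).
move=> s; rewrite normrM; apply: le_trans (_ : `|s| * \1_(`]-1, 1]) s <= _).
  by rewrite ler_wpM2l.
rewrite indicE mem_setE in_itv/=; case: (boolP (-1 < s <= 1)) => [/andP[s0 s1]|_].
  by rewrite mulr1 ler_norml s1 ltW.
by rewrite mulr0.
Qed.

Lemma lens1_meas G : profile G ->
  measurable_fun [set: mR * mR] (fun z : mR * mR => (lens G z).1 : R).
Proof.
move=> [mG _]; apply: measurable_funM.
  exact: (measurableT_comp unitI_meas measurable_fst).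
apply: measurable_funM; first exact: (measurableT_comp iwidth_meas measurable_fst).
exact: (measurableT_comp mG slope_meas).
Qed.

Lemma lens2_meas G : profile G ->
  measurable_fun [set: mR * mR] (fun z : mR * mR => (lens G z).2 : R).
Proof.
move=> /profile_mul[mG _]; apply: measurable_funM.
  exact: (measurableT_comp unitI_meas measurable_fst).
apply: measurable_funM.
  have m2 : measurable_fun [set: mR] (fun x : mR => 1 - 2 * x : R).
    by apply: (@measurable_funB _ mR R setT (cst 1) (fun x => 2 * x)) => //;
      apply: (@measurable_funM _ mR R setT (cst 2) id).
  exact: (measurableT_comp m2 measurable_fst).
apply: measurable_funM; first exact: (measurableT_comp iwidth_meas measurable_fst).
exact: (measurableT_comp mG slope_meas).
Qed.

Lemma profile_slope G z : profile G -> 0 < z.1 < 1 ->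
  `|iwidth z.1 * G (z.2 * iwidth z.1)| <= lens_kernel 1 z.
Proof.
move=> [_ G1] z01; have w0 := width_gt0 z01.
rewrite /lens_kernel unitI1// mul1r normrM (ger0_norm (iwidth_ge0 _)).
rewrite ler_wpM2l ?iwidth_ge0// (le_trans (G1 _))// iwidthE//.
rewrite !indicE !mem_setE !in_itv/= ler_pdivrMr// ltr_pdivlMr// mul1r mulN1r.
exact: lexx.
Qed.

Lemma lens1_bound G z : profile G -> `|(lens G z).1| <= lens_kernel 1 z.
Proof.
move=> pG; have [z01|z01] := boolP (0 < z.1 < 1).
  by rewrite /= unitI1// mul1r profile_slope.
by rewrite /lens_kernel /= unitI0// !mul0r normr0.
Qed.

Lemma lens2_bound G z : profile G -> `|(lens G z).2| <= lens_kernel 1 z.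
Proof.
move=> pG; have [z01|z01] := boolP (0 < z.1 < 1); last first.
  by rewrite /lens_kernel /= unitI0// !mul0r normr0.
rewrite /= unitI1// mul1r normrM; apply: (le_trans _ (profile_slope (profile_mul pG) z01)).
have /andP[z0 z1] := z01.
rewrite ler_piMl// ler_norml; apply/andP; split; lra.
Qed.

Lemma lens_kernel_powR q (t : R) z : 0 < q -> `|t| <= lens_kernel 1 z ->
  `|t| `^ q <= lens_kernel q z.
Proof.
move=> q0 tk; apply: (@le_trans _ _ (lens_kernel 1 z `^ q)).
  have k0 : 0 <= lens_kernel 1 z by exact: le_trans tk.
  by apply: ge0_ler_powR; rewrite ?nnegrE//; exact: ltW.
rewrite /lens_kernel; have [z01|z01] := boolP (0 < z.1 < 1); last first.
  by rewrite unitI0// !mul0r powR0// gt_eqF.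
rewrite unitI1// !mul1r [\1_(_) _]indicE; case: (_ \in _) => /=.
  by rewrite !mulr1 -powRrM mulN1r.
by rewrite !mulr0 powR0// gt_eqF.
Qed.

Lemma lens_kernel_meas q : measurable_fun [set: mR * mR] (lens_kernel q : mR * mR -> R).
Proof.
apply: measurable_funM; first exact: (measurableT_comp unitI_meas measurable_fst).
apply: measurable_funM.
  exact: (measurableT_comp (measurableT_comp (measurable_powR _) width_meas) measurable_fst).
have -> : (fun z : mR * mR => \1_(`]- width z.1, width z.1]) z.2 : R) =
    \1_([set z : mR * mR | (z.2 : R) <= width z.1] `\` [set z : mR * mR | (z.2 : R) <= - width z.1]).
  apply/funext => z; rewrite !indicE mem_setE in_itv/=; congr (_%:R); congr nat_of_bool.
  apply/idP/idP; rewrite inE /=.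
    by move=> /andP[z1 z2]; split=> //; apply/negP; rewrite -ltNge.
  by move=> [z1 /negP]; rewrite -ltNge => ->.
have mw : measurable_fun [set: mR * mR] (fun z : mR * mR => width z.1 : R).
  exact: (measurableT_comp width_meas measurable_fst).
apply: measurable_indic; apply: measurableD.
  by rewrite -[X in measurable X]setTI; apply: measurable_fun_le.
rewrite -[X in measurable X]setTI; apply: measurable_fun_le => //.
exact: measurable_funN.
Qed.

(** The slice over x has integral 2 w(x)^(1 - q), and 1 - q > -1 makes this integrable at both ends
    of the unit interval. *)
Lemma lens_kernel_intg q : 1 <= q < 2 -> intg mu2 (lens_kernel q).
Proof.
move=> /andP[q1 q2]; apply: intg_tonelli.
- exact: lens_kernel_meas.
- apply: aeW => x.
  have := intgZ (unitI x * width x `^ (- q)) (indic_itv_intg (- width x) (width x)).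
  by congr intg; apply/funext => y; rewrite /lens_kernel mulrA.
have r01 : 0 <= q - 1 < 1 by apply/andP; split; lra.
have mI : measurable_fun [set: mR] (fun x : mR => unitI x * (2 * (x * (1 - x)) `^ (- (q - 1))) : R).
  apply: measurable_funM; first exact: unitI_meas.
  apply: measurable_funM => //.
  exact: (measurableT_comp (measurable_powR (- (q - 1))) width_meas).
have E : (fun x => \int[mu]_y `|lens_kernel q (x, y)|) =
    fun x => unitI x * (2 * (x * (1 - x)) `^ (- (q - 1))).
  apply/funext => x; have [x01|x01] := boolP (0 < x < 1); last first.
    rewrite unitI0// mul0r -[RHS](@Rint_cst0 _ mR R mu); apply: Rint_eq => y.
    by rewrite /lens_kernel unitI0// mul0r normr0.
  have w0 := width_gt0 x01.
  transitivity (\int[mu]_y (width x `^ (- q) * \1_(`]- width x, width x]) y)).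
    apply: Rint_eq => y; rewrite /lens_kernel/= unitI1// mul1r ger0_norm//.
    by rewrite mulr_ge0 ?powR_ge0// indicE.
  rewrite RintZ; last exact: indic_itv_intg.
  rewrite Rint_indic_itv; last by lra.
  rewrite unitI1// mul1r -/(width x) opprB -[1 - q]/(1 - q) powRD ?(gt_eqF w0) ?implybT//.
  rewrite powRr1 ?ltW//; ring.
rewrite E.
apply: (@intg_le _ mR R mu _ (fun x => 4 * (unitI x * (x `^ (- (q - 1)) + (1 - x) `^ (- (q - 1)))))) => //.
  move=> x; have [x01|x01] := boolP (0 < x < 1); last by rewrite unitI0// !mul0r normr0 mulr0.
  rewrite unitI1// !mul1r ger0_norm; last by rewrite mulr_ge0 ?powR_ge0.
  have := powR_parabola_le x01 r01; lra.
by apply: intgZ; exact: powR_ends_intg.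
Qed.

Lemma lens_Lfun (f : mR * mR -> R) (p : \bar R) : (1 <= p)%E -> (p < 2%:E)%E ->
  measurable_fun [set: mR * mR] f -> (forall z, `|f z| <= lens_kernel 1 z) ->
  f \in Lfun mu2 p.
Proof.
case: p => [q| |] //; rewrite lee_fin lte_fin => q1 q2 mf fk.
have q0 : 0 < q by rewrite (lt_le_trans _ q1).
have q12 : 1 <= q < 2 by rewrite q1.
rewrite inE; apply/andP; split; rewrite inE//=.
rewrite /finite_norm unlock poweR_lty//.
have /integrableP[_] := lens_kernel_intg q12.
have mn : measurable_fun [set: mR * mR] (fun z => `|f z| `^ q : R).
  by apply: (measurableT_comp (measurable_powR q)); exact: measurableT_comp.
apply: le_lt_trans; apply: ge0_le_integral => //.
- by move=> z _; exact: poweR_ge0.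
- by have /measurable_EFinP mn' := mn; exact: mn'.
- by apply: measurableT_comp => //; apply/measurable_EFinP; exact: lens_kernel_meas.
- move=> z _; rewrite [X in (X <= _)%E]/= lee_fin.
  exact: (le_trans (lens_kernel_powR q0 (fk z)) (ler_norm _)).
Qed.

Lemma lens_support G z : profile G -> lens G z != 0 -> 0 < z.1 < 1 /\ `|z.2| <= 1.
Proof.
move=> pG; have [z01 nz|z01] := boolP (0 < z.1 < 1); last first.
  by rewrite /lens unitI0// !mul0r eqxx.
split=> //; rewrite leNgt; apply: contra nz => z2.
have k0 : lens_kernel 1 z = 0.
  rewrite /lens_kernel indicE mem_setE in_itv/=.
  case: (boolP (- width z.1 < z.2 <= width z.1)) => [/andP[h1 h2]|_]; last by rewrite !mulr0.
  exfalso; move: z2; apply/negP; rewrite -leNgt ler_norml.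
  by have := width_le1 z01 => h; apply/andP; split; lra.
have := lens1_bound z pG; have := lens2_bound z pG; rewrite k0 !normr_le0.
by move=> /eqP e2 /eqP e1; rewrite [lens G z]surjective_pairing e1 e2.
Qed.

Lemma lens_intg1 G : profile G -> intg mu2 (fun z => (lens G z).1).
Proof.
move=> pG; have q : 1 <= (1 : R) < 2 by rewrite lexx ltr1n.
exact: (intg_le (lens1_meas pG) (fun z => lens1_bound z pG) (lens_kernel_intg q)).
Qed.

Lemma lens_intg2 G : profile G -> intg mu2 (fun z => (lens G z).2).
Proof.
move=> pG; have q : 1 <= (1 : R) < 2 by rewrite lexx ltr1n.
exact: (intg_le (lens2_meas pG) (fun z => lens2_bound z pG) (lens_kernel_intg q)).
Qed.

Lemma profile_intg G : profile G -> intg mu G.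
Proof. by move=> [mG G1]; exact: (intg_le mG G1 (indic_itv_intg _ _)). Qed.

Section flux.
Variables (G : R -> R) (phi : R * R -> R) (C : R).
Hypothesis pG : profile G.
Let phix := partial1 phi.
Let phiy := partial2 phi.
Hypothesis dphix : forall x y : R, is_derive x 1 (fun x => phi (x, y)) (phix (x, y)).
Hypothesis dphiy : forall x y : R, is_derive y 1 (fun y => phi (x, y)) (phiy (x, y)).
Hypothesis cphix : continuous phix.
Hypothesis cphiy : continuous phiy.
Hypothesis bphix : forall z, `|phix z| <= C.
Hypothesis bphiy : forall z, `|phiy z| <= C.

(* derivative of [phi] along the curve [y = s * width x] *)
Let D (z : R * R) : R := phix (z.1, z.2 * width z.1) + phiy (z.1, z.2 * width z.1) * (z.2 * (1 - 2 * z.1)).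

Let curve_continuous : continuous (fun z : R * R => (z.1, z.2 * width z.1) : R * R).
Proof.
move=> z.
have c1 : {for z, continuous (fun z : R * R => z.1)} by exact: cvg_fst.
have c2 : {for z, continuous (fun z : R * R => z.2 * width z.1)}.
  apply: cvgM; first exact: cvg_snd.
  apply: cvgM; first exact: cvg_fst.
  by apply: cvgB; [exact: cvg_cst|exact: cvg_fst].
exact: (cvg_pair c1 c2).
Qed.

Let D_continuous : continuous D.
Proof.
move=> z.
have h1 : {for z, continuous (fun z : R * R => phix (z.1, z.2 * width z.1))}.
  apply: (@continuous_comp _ _ _ (fun z : R * R => (z.1, z.2 * width z.1) : R * R) phix).
    exact: curve_continuous.
  exact: cphix.
have h2 : {for z, continuous (fun z : R * R => phiy (z.1, z.2 * width z.1))}.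
  apply: (@continuous_comp _ _ _ (fun z : R * R => (z.1, z.2 * width z.1) : R * R) phiy).
    exact: curve_continuous.
  exact: cphiy.
have h3 : {for z, continuous (fun z : R * R => z.2 * (1 - 2 * z.1))}.
  apply: cvgM; first exact: cvg_snd.
  by apply: cvgB; [exact: cvg_cst|apply: cvgM; [exact: cvg_cst|exact: cvg_fst]].
exact: (cvgD h1 (cvgM h2 h3)).
Qed.

Let D_bound x s : 0 < x < 1 -> `|G s * D (x, s)| <= (C + C) * \1_(`]-1, 1]) s.
Proof.
move=> /andP[x0 x1]; have [_ /(_ s) Gs] := pG.
have C0 : 0 <= C by exact: le_trans (bphix (0, 0)).
move: Gs; rewrite indicE mem_setE in_itv/=; case: (boolP (-1 < s <= 1)) => [/andP[s0 s1]|_] /= Gs.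
  rewrite mulr1 normrM; apply: (@le_trans _ _ (1 * `|D (x, s)|)); first by rewrite ler_wpM2r.
  rewrite mul1r /D/= (le_trans (ler_normD _ _))// lerD//.
  rewrite normrM -[leRHS]mulr1 ler_pM// normrM mulr_ile1// ler_norml; apply/andP; split; lra.
have -> : G s = 0 by apply/eqP; rewrite -normr_le0.
by rewrite mul0r normr0 mulr0.
Qed.

Let slice_flux x :
  \int[mu]_y ((lens G (x, y)).1 * phix (x, y) + (lens G (x, y)).2 * phiy (x, y)) =
  \int[mu]_s (unitI x * (G s * D (x, s))).
Proof.
have [x01|x01] := boolP (0 < x < 1); last first.
  by apply: Rint_eq => y; rewrite /lens/= unitI0// !mul0r addr0.
have w0 := width_gt0 x01.
have iw0 : 0 < iwidth x by rewrite iwidthE// invr_gt0.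
have mG := pG.1.
have mD : measurable_fun [set: mR] (fun s : mR => D (x, s)).
  exact: (measurableT_comp (continuous2_measurable D_continuous) (measurable_pair1 x)).
have ig : intg mu (fun s => G s * D (x, s)).
  apply: (@intg_le _ mR R mu _ (fun s => (C + C) * \1_(`]-1, 1]) s)).
  - exact: measurable_funM.
  - by move=> s; exact: D_bound.
  - by apply: intgZ; exact: indic_itv_intg.
transitivity (\int[mu]_y (iwidth x * (G (iwidth x * y) * D (x, iwidth x * y)))).
  apply: Rint_eq => y; rewrite /lens /D /= unitI1// !mul1r [iwidth x * y]mulrC.
  have -> : y * iwidth x * width x = y by rewrite iwidthE// divfK// gt_eqF.
  ring.
have [i2 E2] := Rint_scale iw0 ig.
rewrite RintZ// E2 mulrA divff ?gt_eqF// mul1r.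
by apply: Rint_eq => s; rewrite unitI1// mul1r.
Qed.

Let curve_flux s : \int[mu]_x (unitI x * (G s * D (x, s))) = G s * (phi (1, 0) - phi (0, 0)).
Proof.
have dw (x : R) : is_derive x 1 (fun x => s * width x) (s * (1 - 2 * x)).
  rewrite /width; apply: is_derive_eq.
  by rewrite /GRing.scale/=; ring.
have dF (x : R) : is_derive x 1 (fun x => phi (x, s * width x)) (D (x, s)).
  exact: (chain_rule2 dphix dphiy cphix (dw x)).
have cD (x : R) : {for x, continuous (fun x => D (x, s))}.
  have c1 : {for x, continuous (fun x : R => x)} by exact: cvg_id.
  have c2 : {for x, continuous (fun _ : R => s)} by exact: cvg_cst.
  apply: (@continuous_comp _ _ _ (fun x : R => (x, s) : R * R) D).
    exact: (cvg_pair c1 c2).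
  exact: D_continuous.
have I := Rint_derivative (@ltr01 R) (fun x _ => dF x) (fun x _ => cD x).
have mD : measurable_fun [set: mR] (fun x : mR => D (x, s)) by exact: measurable_continuous.
have m01 : measurable_fun [set: mR] (\1_(`[0, 1]%classic) : mR -> R).
  by apply: measurable_indic; exact: measurable_itv.
transitivity (\int[mu]_x (\1_(`[0, 1]) x * (G s * D (x, s)))).
  have ne (t : R) : {ae mu, forall x : mR, (x : R) != t}.
    exists [set t]; split; first exact: measurable_set1.
      exact: lebesgue_measure_set1.
    by move=> y /=; apply: contra_notP => /eqP.
  apply: Rint_ae.
  - by apply: measurable_funM; [exact: unitI_meas|exact: measurable_funM].
  - by apply: measurable_funM => //; exact: measurable_funM.
  apply: (ae_mono2 (ne 0) (ne 1)) => x x0 x1; congr (_ * _).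
  rewrite /unitI !indicE !mem_setE !in_itv/= !le_eqVlt.
  by rewrite (negbTE x1) [0 == x]eq_sym (negbTE x0).
rewrite -Rint_in RintegralZl//; last first.
  apply: continuous_compact_integrable; first exact: segment_compact.
  exact: continuous_subspaceT.
congr (_ * _); rewrite /Rintegral I /= /width.
by rewrite subrr mulr0 mulr0 mul0r mulr0.
Qed.

(** The substitution y = s w(x) has Jacobian w(x), which cancels [iwidth]. Integrating in x first
    along each arc gives an increment of [phi], the same for all s because w vanishes at 0 and 1 and
    all arcs share their end points. *)
Lemma lens_flux :
  intg mu2 (fun z => (lens G z).1 * phix z + (lens G z).2 * phiy z) /\
  \int[mu2]_z ((lens G z).1 * phix z + (lens G z).2 * phiy z) =
  (\int[mu]_s G s) * (phi (1, 0) - phi (0, 0)).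
Proof.
have m1 := continuous2_measurable cphix; have m2 := continuous2_measurable cphiy.
have i : intg mu2 (fun z => (lens G z).1 * phix z + (lens G z).2 * phiy z).
  exact: (intgD (intg_mulb (lens_intg1 pG) m1 bphix) (intg_mulb (lens_intg2 pG) m2 bphiy)).
split; first exact: i.
have [_ ->] := Rint_fubini i.
transitivity (\int[mu]_x \int[mu]_s (unitI x * (G s * D (x, s)))); first exact: Rint_eq.
have iG : intg mu2 (fun z => unitI z.1 * (G z.2 * D z)).
  apply: (@intg_le _ (mR * mR)%type R mu2 _ (fun z => (C + C) * (unitI z.1 * \1_(`]-1, 1]) z.2))).
  - apply: measurable_funM; first exact: (measurableT_comp unitI_meas measurable_fst).
    apply: measurable_funM; first exact: (measurableT_comp pG.1 measurable_snd).
    exact: continuous2_measurable D_continuous.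
  - move=> z; have [z01|z01] := boolP (0 < z.1 < 1); last by rewrite unitI0// !mul0r normr0 mulr0.
    by rewrite unitI1// !mul1r; case: z z01 => x s; exact: D_bound.
  - apply: intgZ; apply: tensor_intg; [exact: itvoo_intg|exact: indic_itv_intg].
rewrite (Rint_swap iG) mulrC -RintZ; last exact: profile_intg pG.
by apply: Rint_eq => s; rewrite mulrC; exact: curve_flux.
Qed.

End flux.
End lens.

(** * Failure of the chain rule for the square *)

Section counterexample.
Context {R : realType}.
Notation mR := (measurableTypeR R).
Notation mu := (@lebesgue_measure R).
Notation mu2 := (lebesgue2 R).

Lemma lens_integral (G : R -> R) (phi : R * R -> R) : profile G -> test_function phi ->
  (\int[mu2]_z ((lens G z).1 * partial1 phi z + (lens G z).2 * partial2 phi z)%:E =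
   ((\int[mu]_s G s) * (phi (1, 0) - phi (0, 0)))%:E)%E.
Proof.
move=> pG tf; have [e1 e2 _ c1 c2] := test_function_regular tf.
have [C _ B] := test_function_bounded tf.
have b1 z : `|partial1 phi z| <= C by have [] := B z.
have b2 z : `|partial2 phi z| <= C by have [] := B z.
have [i E] := lens_flux pG e1 e2 c1 c2 b1 b2.
by rewrite (intgE i) E.
Qed.

Let cell1 : R -> R := \1_(`]-1, - 2^-1]).
Let cell2 : R -> R := \1_(`]- 2^-1, 2^-1]).
Let cell3 : R -> R := \1_(`]2^-1, 1]).

Let cells s : [\/ [/\ cell1 s = 1, cell2 s = 0, cell3 s = 0 & \1_(`]-1, 1]) s = 1 :> R],
  [/\ cell1 s = 0, cell2 s = 1, cell3 s = 0 & \1_(`]-1, 1]) s = 1 :> R],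
  [/\ cell1 s = 0, cell2 s = 0, cell3 s = 1 & \1_(`]-1, 1]) s = 1 :> R] |
  [/\ cell1 s = 0, cell2 s = 0, cell3 s = 0 & \1_(`]-1, 1]) s = 0 :> R]].
Proof.
have itv (a b : R) : [set` `]a, b]] s -> \1_(`]a, b]) s = 1 :> R.
  by move=> h; rewrite indicE mem_set.
have nitv (a b : R) : s <= a \/ b < s -> \1_(`]a, b]) s = 0 :> R.
  move=> h; rewrite indicE memNset//= in_itv/= => /andP[].
  by case: h => h; [rewrite ltNge h|rewrite leNgt h].
have [s1|s1] := leP s (-1).
  by apply: Or44; split; apply: nitv; left; lra.
have [s2|s2] := leP s (- 2^-1).
  apply: Or41; split; try (apply: nitv; left; lra); apply: itv => /=; rewrite in_itv/= s1/=; lra.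
have [s3|s3] := leP s 2^-1.
  apply: Or42; split; [by apply: nitv; right; lra|apply: itv => /=; rewrite in_itv/=; apply/andP; split; lra
    |by apply: nitv; left; lra|by apply: itv => /=; rewrite in_itv/=; apply/andP; split; lra].
have [s4|s4] := leP s 1.
  apply: Or43; split; [by apply: nitv; right; lra|by apply: nitv; right; lra
    |by apply: itv => /=; rewrite in_itv/=; apply/andP; split; lra
    |by apply: itv => /=; rewrite in_itv/=; apply/andP; split; lra].
by apply: Or44; split; apply: nitv; right; lra.
Qed.

(** Up to cell end points [G0] is even and [h] is odd, so [h] times [G0] has integral 0 by symmetry.
    The middle cell, where [h] vanishes, balances the integral of [G0] and disappears from the
    product with the square of [h]. *)
Let G0 s := cell2 s - cell1 s - cell3 s.
Let h s := cell3 s - cell1 s.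
Let G1 s := cell1 s - cell3 s.
Let G2 s := - (cell1 s + cell3 s).

Let mc1 : measurable_fun [set: mR] (cell1 : mR -> R).
Proof. by apply: measurable_indic; exact: measurable_itv. Qed.
Let mc2 : measurable_fun [set: mR] (cell2 : mR -> R).
Proof. by apply: measurable_indic; exact: measurable_itv. Qed.
Let mc3 : measurable_fun [set: mR] (cell3 : mR -> R).
Proof. by apply: measurable_indic; exact: measurable_itv. Qed.

Let pG0 : profile G0.
Proof.
split; first by apply: measurable_funB => //; exact: measurable_funB.
by move=> s; rewrite ler_norml /G0; case: (cells s) => -[e1 e2 e3 e4]; rewrite e1 e2 e3 e4; apply/andP; split; lra.
Qed.

Let pG1 : profile G1.
Proof.
split; first by apply: measurable_funB.
by move=> s; rewrite ler_norml /G1; case: (cells s) => -[e1 e2 e3 e4]; rewrite e1 e3 e4; apply/andP; split; lra.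
Qed.

Let pG2 : profile G2.
Proof.
split; first by apply: measurable_funN; exact: measurable_funD.
by move=> s; rewrite ler_norml /G2; case: (cells s) => -[e1 e2 e3 e4]; rewrite e1 e3 e4; apply/andP; split; lra.
Qed.

Let hG0 s : h s * G0 s = G1 s.
Proof. by case: (cells s) => -[e1 e2 e3 e4]; rewrite /h /G0 /G1 e1 e2 e3; lra. Qed.

Let hG1 s : h s * G1 s = G2 s.
Proof. by case: (cells s) => -[e1 e2 e3 e4]; rewrite /h /G1 /G2 e1 e3; lra. Qed.

Let h_norm s : `|h s| <= 1.
Proof.
by rewrite ler_norml /h; case: (cells s) => -[e1 e2 e3 e4]; rewrite e1 e3; apply/andP; split; lra.
Qed.

Let I1 : \int[mu]_s cell1 s = 2^-1. Proof. rewrite Rint_indic_itv; lra. Qed.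
Let I2 : \int[mu]_s cell2 s = 1. Proof. rewrite Rint_indic_itv; lra. Qed.
Let I3 : \int[mu]_s cell3 s = 2^-1. Proof. rewrite Rint_indic_itv; lra. Qed.

Let i1 : intg mu cell1 := indic_itv_intg _ _.
Let i2 : intg mu cell2 := indic_itv_intg _ _.
Let i3 : intg mu cell3 := indic_itv_intg _ _.

Let IG0 : \int[mu]_s G0 s = 0.
Proof. rewrite /G0 (RintB (intgB i2 i1) i3) (RintB i2 i1) I1 I2 I3; lra. Qed.

Let IG1 : \int[mu]_s G1 s = 0.
Proof. by rewrite /G1 (RintB i1 i3) I1 I3 subrr. Qed.

Let IG2 : \int[mu]_s G2 s = -1.
Proof. rewrite /G2 (RintN (intgD i1 i3)) (RintD i1 i3) I1 I3; lra. Qed.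

Let rho (z : R * R) : R := unitI z.1 * h (z.2 * iwidth z.1).

Let lens_mul (H : R -> R) z : rho z *: lens H z = lens (fun s => h s * H s) z.
Proof.
rewrite /lens /rho; have [z01|z01] := boolP (0 < z.1 < 1).
  by rewrite unitI1// !mul1r; congr pair; rewrite /GRing.scale/=; ring.
by rewrite unitI0// !mul0r scale0r.
Qed.

Let rho_meas : measurable_fun [set: mR * mR] (rho : mR * mR -> R).
Proof.
have mh : measurable_fun [set: mR] (h : mR -> R) by apply: measurable_funB.
apply: measurable_funM; first exact: (measurableT_comp unitI_meas measurable_fst).
exact: (measurableT_comp mh slope_meas).
Qed.

Let rho_Lfun : rho \in Lfun mu2 +oo%E.
Proof.
rewrite inE; apply/andP; split; rewrite inE//=.
rewrite /finite_norm unlock; case: ifP => _ //.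
apply: (@le_lt_trans _ _ 1%E); last exact: ltry.
apply/ess_supP; apply: aeW => z /=; rewrite lee_fin.
rewrite /rho normrM mulr_ile1// ?h_norm//; exact: indic_norm1.
Qed.

Theorem crp_fails (p : \bar R) : (1 <= p)%E -> (p < 2%:E)%E ->
  exists v : R * R -> R * R,
    [/\ Lp_field p v, compactly_supported v, div_free v & ~ CRP_infty v].
Proof.
move=> p1 p2; exists (lens G0); split.
- split; apply: lens_Lfun => //.
  + exact: lens1_meas.
  + by move=> z; exact: lens1_bound.
  + exact: lens2_meas.
  + by move=> z; exact: lens2_bound.
- exists (`[0, 1]%classic `*` `[-1, 1]%classic).
    by apply: compact_setX; exact: segment_compact.
  apply: aeW => z nz; apply/eqP; apply: contra_notT nz => /(lens_support pG0)[/andP[z0 z1] z2].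
  by split; rewrite /= in_itv/= -?ler_norml// !ltW.
- by move=> phi tf; rewrite (lens_integral pG0 tf) IG0 mul0r.
(* The square is the right choice of beta: multiplying by [rho] twice sends the profile [G0] to [G1]
   and then to [G2], whose integral is -1. *)
have beta_derive (t : R) : is_derive t 1 (fun t : R => t ^+ 2) (2 * t).
  apply: is_derive_eq; rewrite /GRing.scale/=; ring.
have beta_C1 : C1 (fun t : R => t ^+ 2).
  split; first by move=> t; exact: (@ex_derive _ _ _ _ _ _ _ (beta_derive t)).
  have -> : derive1 (fun t : R => t ^+ 2) = fun t => 2 * t.
    by apply/funext => t; rewrite derive1E; exact: (@derive_val _ _ _ _ _ _ _ (beta_derive t)).
  by move=> t; apply: cvgM; [exact: cvg_cst|exact: cvg_id].
have E1 : (fun z => rho z *: lens G0 z) = lens G1.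
  by apply/funext => z; rewrite lens_mul; congr (lens _ z); apply/funext => s; exact: hG0.
have E2 : (fun z => rho z ^+ 2 *: lens G0 z) = lens G2.
  apply/funext => z; rewrite expr2 -scalerA [X in _ *: X](congr1 (fun F => F z) E1) lens_mul.
  by congr (lens _ z); apply/funext => s; exact: hG1.
move=> /(_ rho _ rho_Lfun beta_C1); rewrite E1 E2 => H.
have d1 : div_free (lens G1).
  by move=> phi tf; rewrite (lens_integral pG1 tf) IG1 mul0r.
(* The product of these bumps separates the two end points: it is 0 at (0, 0) and positive at (1,
   0). *)
pose A : R -> R := bump 2^-1 2 0; pose B : R -> R := bump (-1) 1 0.
have tf : test_function (fun z : R * R => A z.1 * B z.2).
  have supp (a b x : R) : -1 <= a -> b <= 2 -> bump a b 0 x != 0 -> -1 <= x <= 2.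
    move=> a1 b2; apply: contra_neqT => nx; apply/eqP; rewrite -normr_le0.
    apply: (le_trans (bump_norm_le _ _ _ _)); rewrite indicE mem_setE in_itv/=.
    case: (boolP (a < x < b)) => // /andP[h1 h2]; exfalso; move/negP: nx; apply.
    by apply/andP; split; lra.
  apply: (@test_function_tensor _ _ _ (-1) 2).
  - by move=> k; exact: Ck_bump.
  - by move=> k; exact: Ck_bump.
  - by move=> x; apply: supp; lra.
  - by move=> x; apply: supp; lra.
have := H d1 _ tf; rewrite (lens_integral pG2 tf) IG2 mulN1r => /(congr1 fine)/= /eqP.
rewrite oppr_eq0 subr_eq0 /A /B /bump => /eqP E.
have f0 (t : R) : 0 < t -> 0 < flat 1 t.
  by move=> t0; rewrite /flat t0 hornerC mul1r expR_gt0.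
have z0 (t : R) : t <= 0 -> flat 1 t = 0 by move=> t0; rewrite /flat ltNge t0.
move: E; rewrite [flat 1 (1 * (0 - 2^-1))]z0; last by lra.
rewrite !mul0r => /eqP; rewrite gt_eqF// !mulr_gt0// f0//; lra.
Qed.

End counterexample.

Theorem theorem1p4 (R : realType) (p : \bar R) (hp : (1 <= p)%E) :
  ((p < 2%:E)%E ->
    exists v : R * R -> R * R,
      [/\ Lp_field p v, compactly_supported v, div_free v & ~ CRP_infty v]) /\
  ((2%:E <= p)%E ->
    forall v : R * R -> R * R,
      Lp_field p v -> compactly_supported v -> div_free v -> CRP_infty v).
Proof.
split; first exact: crp_fails.
by move=> p2 v; exact: crp_of_ge2.
Qed.
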